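(* Suppose that $\mu$ is a $\Lambda$-nice reflectionless measure for the $s$-Riesz transform in $\mathbb{R}^d$, with $s\in(0,d-1]$. For each $\varepsilon>0$ there is a constant $\lambda=\lambda(\varepsilon)>0$ such that if $\mu(B(x,r))>\varepsilon r^s$ (for some $x\in\mathbb{R}^d$, $r>0$), then there is a ball $B'\subset B(x,3r)$ of radius $\lambda r$ that does not intersect $\operatorname{supp}(\mu)$.
   Context: A measure means a non-negative locally finite Borel measure on $\mathbb{R}^d$; $\operatorname{supp}(\mu)$ is its closed support. For $\Lambda>0$, $\mu$ is $\Lambda$-nice if $\mu(B(x,r))\le\Lambda r^s$ for every ball $B(x,r)\subset\mathbb{R}^d$. The $s$-Riesz transform $R$ has kernel $K(x)=\frac{x}{|x|^{s+1}}$, $x\in\mathbb{R}^d\setminus\{0\}$. Reflectionless measures. $\operatorname{Lip}_0(\mathbb{R}^d)$ is the set of compactly supported scalar Lipschitz functions. A nice measure $\mu$ has no atoms, $(x,y)\mapsto|x-y|^{-(s-1)}$ lies in $L^1_{\rm loc}(\mu\times\mu)$, and $\int_{|x|\ge1}|x|^{-s-1}d\mu(x)<\infty$. For $f,\varphi\in\operatorname{Lip}_0(\mathbb{R}^d)$ put $\langle R(f\mu),\varphi\rangle_\mu=\iint K(x-y)\,\tfrac12[f(y)\varphi(x)-\varphi(y)f(x)]\,d\mu(x)d\mu(y)$. If $f\in\operatorname{Lip}_0(\mathbb{R}^d)$ has $\int f\,d\mu=0$, put $\langle R(f\mu),1\rangle_\mu=\langle R(f\mu),\psi\rangle_\mu+\int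 R(f\mu)(x)[1-\psi(x)]\,d\mu(x)$, where $\psi\in\operatorname{Lip}_0(\mathbb{R}^d)$ equals $1$ on a neighbourhood of $\operatorname{supp} f$ and $R(f\mu)(x)=\int K(x-y)f(y)\,d\mu(y)$ (independent of $\psi$). $\mu$ is reflectionless for the $s$-Riesz transform if $\langle R(f\mu),1\rangle_\mu=0$ for every $f\in\operatorname{Lip}_0(\mathbb{R}^d)$ with $\int f\,d\mu=0$. *)

(* Defs.v *)
From HB Require Import structures.
From mathcomp Require Import all_boot all_order all_algebra.
From mathcomp Require Import all_classical all_reals all_analysis.

Set Implicit Arguments.
Unset Strict Implicit.
Unset Printing Implicit Defensive.

Import Order.TTheory GRing.Theory Num.Theory.
Import numFieldNormedType.Exports.

Local Open Scope classical_set_scope.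
Local Open Scope ring_scope.

(* The library norm on 'rV[R]_d is the sup norm, so the Euclidean norm and its
   balls are defined here.  Both norms induce the same topology; [open],
   [closure] and [compact] below are the library's. *)
Definition l2norm (R : realType) (d : nat) (x : 'rV[R]_d) : R :=
  Num.sqrt (\sum_(i < d) x 0 i ^+ 2).

Definition l2ball (R : realType) (d : nat) (x : 'rV[R]_d) (r : R) :
    set 'rV[R]_d :=
  [set y | l2norm (y - x) < r].

(* R^d with its Borel sigma-algebra (convertible to 'rV[R]_d). *)
Definition borel_rV (R : realType) (d : nat) :=
  g_sigma_algebraType [set A : set 'rV[R]_d | open A].

Section Riesz.
Context (R : realType) (d : nat).
Implicit Types (mu : {measure set (borel_rV R d) -> \bar R}).
Implicit Types (f phi psi : 'rV[R]_d -> R) (s Lam : R).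

Definition locally_finite mu : Prop :=
  forall x : 'rV[R]_d, exists2 U : set 'rV[R]_d,
    open_nbhs x U & (mu U < +oo)%E.

Definition measure_supp mu : set 'rV[R]_d :=
  [set x | forall U : set 'rV[R]_d, open_nbhs x U -> (0 < mu U)%E].

Definition nice s Lam mu : Prop :=
  forall (x : 'rV[R]_d) (r : R), 0 < r ->
    (mu (l2ball x r) <= (Lam * r `^ s)%:E)%E.

Definition fun_supp f : set 'rV[R]_d := closure [set x | f x != 0].

Definition Lip0 f : Prop :=
  (exists L : R, forall x y, `|f x - f y| <= L * l2norm (x - y))
  /\ compact (fun_supp f).

(* The value at x = 0 is 0; it is immaterial, since nice measures have no
   atoms. *)
Definition riesz_kernel s (x : 'rV[R]_d) : 'rV[R]_d :=
  (l2norm x `^ (s + 1))^-1 *: x.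

(* <R(f mu), phi>_mu; vector-valued integrals are taken coordinatewise.
   For [Lip0] f, phi and nice mu the integrand is absolutely integrable, so
   [fine] discards nothing. *)
Definition riesz_pairing s mu f phi : 'rV[R]_d :=
  \row_(i < d) fine (\int[(mu \x mu)%E]_z
    (riesz_kernel s (z.1 - z.2) 0 i
       * (2^-1 * (f z.2 * phi z.1 - phi z.2 * f z.1)))%:E)%E.

(* R(f mu)(x), which is only meaningful for x outside the support of f. *)
Definition riesz_transform s mu f (x : 'rV[R]_d) : 'rV[R]_d :=
  \row_(i < d) fine (\int[mu]_y (riesz_kernel s (x - y) 0 i * f y)%:E)%E.

Definition cutoff_for f psi : Prop :=
  Lip0 psi /\
  exists2 U : set 'rV[R]_d,
    open U /\ fun_supp f `<=` U & forall x, U x -> psi x = 1.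

(* <R(f mu), 1>_mu computed with the cutoff psi.  In the second integral
   [1 - psi x] vanishes near the support of f, which is the only place where
   [riesz_transform] takes junk values. *)
Definition riesz_pairing1 s mu f psi : 'rV[R]_d :=
  riesz_pairing s mu f psi +
  \row_(i < d) fine
    (\int[mu]_x (riesz_transform s mu f x 0 i * (1 - psi x))%:E)%E.

(* The value of [riesz_pairing1] does not depend on the cutoff when mu is nice
   and f has mean zero, and every [Lip0] function has a cutoff, so quantifying
   over all psi is the same as fixing one. *)
Definition reflectionless s mu : Prop :=
  forall f, Lip0 f -> (\int[mu]_x (f x)%:E = 0)%E ->
  forall psi, cutoff_for f psi -> riesz_pairing1 s mu f psi = 0.

End Riesz.

(* Main.v *)
(** Suppose that every ball of radius [lam r] in [B(x, 3r)] meets the support.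
    Around a support point one finds a bump function whose transition layer
    carries a controlled share of the mass: the masses of concentric balls
    cannot drop by the factor [2^(s+1)] at every dyadic step.  Testing
    reflectionlessness against combinations of such normalized bumps, placed
    near the points of a fine grid with weights summing to zero, and replacing
    the Riesz kernel by [x (|x|^2 + t^2)^(-(s+1)/2)], shows that the weighted
    sum of the smoothed transforms at the grid points is small.  When the
    weights are the discrete partial differences of a tent function, summation
    by parts turns this sum into an average of the discrete divergence of the
    smoothed kernel.  As [s <= d - 1], that divergence is positive, so the sum
    is at least a constant times [mu(B(x, r)) / r^s], a contradiction.  Close
    to a grid point the smoothed kernel is only bounded through the energy of
    exponent [s + 1/2 < d], so the grid is first translated to a position where
    its average energy is controlled. *)
Require Import Defs.
From HB Require Import structures.
From mathcomp Require Import all_boot all_order all_algebra.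
From mathcomp Require Import all_classical all_reals all_analysis.
From mathcomp Require Import measurable_realfun ring lra.

Set Implicit Arguments.
Unset Strict Implicit.
Unset Printing Implicit Defensive.

Import Order.TTheory GRing.Theory Num.Theory.
Import numFieldNormedType.Exports.

Local Open Scope classical_set_scope.
Local Open Scope ring_scope.


(** * Norm, balls and kernels *)

(** No lower bound on the mass near a support point is available, so a bump can only be used after
    division by its integral, and every error has to be relative to that integral. Hence the
    doubling condition between [T - ell] and [T]: it bounds the mass on which a bump lives by its
    integral. The exponent [s + 1/2] has to exceed [s] for two reasons. Niceness alone leaves the
    integral of [|x|^(-s)] logarithmically divergent, while within distance [e] this kernel is at
    most [e^(1/2) |x|^(-(s+1/2))], so a bounded energy makes the near part small with [e]. The same
    bound forces the density [mu(B(z, l)) / l^s] to decay like [l^(1/2)], and low density is what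
    the bump construction requires. The constants have a rigid order: the near radius, then the
    smoothing scale, then the grid, whose size depends on that scale, and the radius of the empty
    ball last. The order closes because the lower bound for the discrete divergence is uniform in
    the smoothing scale, and because the near part sees only the average of the energies over the
    grid, in which the number of grid points cancels. *)

Section PowR.
Context {R : realType}.
Implicit Types (u v q a b : R).

Lemma powRD_gt0 u a b : 0 < u -> u `^ (a + b) = u `^ a * u `^ b.
Proof. by move=> u0; rewrite powRD// (gt_eqF u0) implybT. Qed.

Lemma powRB1_gt0 u a : 0 < u -> u `^ (a - 1) = u `^ a / u.
Proof. by move=> u0; rewrite powRD_gt0// powR_inv1 ?ltW. Qed.

(** Convexity: the graph of [t^(-q)] lies above its tangent at [u]. This replaces the mean value
    theorem in all kernel estimates below. *)
Lemma powRN_tangent u v q : 0 < u -> 0 < v -> 0 <= q ->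
  u `^ (- q) - v `^ (- q) <= q * u `^ (- q - 1) * (v - u).
Proof.
move=> u0 v0 q0.
have un0 : u != 0 by rewrite gt_eqF.
have vu0 : 0 < v / u by rewrite divr_gt0.
have -> : v `^ (- q) = u `^ (- q) * (v / u) `^ (- q).
  by rewrite -powRM ?(ltW u0) ?(ltW vu0)// mulrCA divff ?mulr1.
have E : 1 - q * (v / u - 1) <= (v / u) `^ (- q).
  rewrite /powR gt_eqF//; apply: le_trans (expR_ge1Dx _).
  rewrite mulNr lerD2l lerN2 ler_wpM2l//.
  have := @le_ln1Dx R (v / u - 1).
  by rewrite (addrC 1) subrK; apply; lra.
have -> : u `^ (- q - 1) = u `^ (- q) / u.
  exact: powRB1_gt0.
have -> : q * (u `^ (- q) / u) * (v - u) = u `^ (- q) * (q * (v / u - 1)).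
  by field.
by rewrite -{1}(mulr1 (u `^ _)) -mulrBr ler_wpM2l ?powR_ge0//; lra.
Qed.

Lemma ger_powRN u v q : 0 < u -> u <= v -> 0 <= q -> v `^ (- q) <= u `^ (- q).
Proof.
move=> u0 uv q0; have v0 := lt_le_trans u0 uv.
rewrite !powRN lef_pV2 ?posrE ?powR_gt0//.
by rewrite ge0_ler_powR// nnegrE ltW.
Qed.

Lemma powR_sqr u q : 0 <= u -> (u ^+ 2) `^ q = u `^ (2 * q).
Proof. by move=> u0; rewrite -powR_mulrn// -powRrM. Qed.

Lemma powRVN u q : 0 <= u -> u^-1 `^ (- q) = u `^ q.
Proof. by move=> u0; rewrite -(powR_inv1 u0) -powRrM mulN1r opprK. Qed.

Lemma powRX u q (n : nat) : 0 <= u -> (u ^+ n) `^ q = (u `^ q) ^+ n.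
Proof.
by move=> u0; rewrite -powR_mulrn// -powRrM mulrC powRrM powR_mulrn ?powR_ge0.
Qed.

End PowR.

Section L2norm.
Context {R : realType} {d : nat}.
Implicit Types (x y z : 'rV[R]_d) (i : 'I_d).

Lemma l2norm_ge0 x : 0 <= l2norm x. Proof. exact: sqrtr_ge0. Qed.

Lemma sqr_l2norm x : l2norm x ^+ 2 = \sum_(i < d) x 0 i ^+ 2.
Proof. by rewrite sqr_sqrtr// sumr_ge0// => i _; rewrite sqr_ge0. Qed.

Lemma l2norm0 : l2norm (0 : 'rV[R]_d) = 0.
Proof. by rewrite /l2norm big1 ?sqrtr0// => i _; rewrite mxE expr0n. Qed.

Lemma l2normN x : l2norm (- x) = l2norm x.
Proof. by congr Num.sqrt; apply: eq_bigr => i _; rewrite mxE sqrrN. Qed.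

Lemma l2norm_distC x y : l2norm (x - y) = l2norm (y - x).
Proof. by rewrite -l2normN opprB. Qed.

Lemma coord_le_l2norm x i : `|x 0 i| <= l2norm x.
Proof.
rewrite -sqrtr_sqr ler_wsqrtr// (bigD1 i)//= lerDl sumr_ge0// => j _.
exact: sqr_ge0.
Qed.

Lemma l2norm_eq0 x : (l2norm x == 0) = (x == 0).
Proof.
apply/eqP/eqP => [x0|->]; last exact: l2norm0.
apply/rowP => i; rewrite mxE; apply/eqP; rewrite -normr_le0 -x0.
exact: coord_le_l2norm.
Qed.

Lemma l2norm_gt0 x : (0 < l2norm x) = (x != 0).
Proof. by rewrite lt_def l2norm_ge0 l2norm_eq0 andbT. Qed.

Lemma l2normZ (a : R) x : l2norm (a *: x) = `|a| * l2norm x.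
Proof.
rewrite /l2norm -sqrtr_sqr -sqrtrM ?sqr_ge0// mulr_sumr; congr Num.sqrt.
by apply: eq_bigr => i _; rewrite mxE exprMn.
Qed.

Lemma ler_l2norm_dot x y :
  \sum_(i < d) x 0 i * y 0 i <= l2norm x * l2norm y.
Proof.
have [->|x0] := eqVneq x 0.
  by rewrite l2norm0 mul0r big1// => i _; rewrite mxE mul0r.
have [->|y0] := eqVneq y 0.
  by rewrite l2norm0 mulr0 big1// => i _; rewrite mxE mulr0.
have {}x0 : 0 < l2norm x by rewrite l2norm_gt0.
have {}y0 : 0 < l2norm y by rewrite l2norm_gt0.
have := @sumr_ge0 R 'I_d (index_enum _) xpredT
  (fun i => (l2norm y * x 0 i - l2norm x * y 0 i) ^+ 2) (fun i _ => sqr_ge0 _).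
rewrite (eq_bigr (fun i => l2norm y ^+ 2 * x 0 i ^+ 2 +
    (l2norm x ^+ 2 * y 0 i ^+ 2 -
     2 * (l2norm x * l2norm y) * (x 0 i * y 0 i)))); last by move=> i _; ring.
rewrite big_split sumrB/= -!mulr_sumr -!sqr_l2norm => H.
rewrite -(@ler_pM2l _ (2 * (l2norm x * l2norm y))) ?mulr_gt0//.
nra.
Qed.

Lemma ler_l2normD x y : l2norm (x + y) <= l2norm x + l2norm y.
Proof.
rewrite -(@ler_pXn2r _ 2)// ?nnegrE ?addr_ge0 ?l2norm_ge0//.
rewrite sqr_l2norm (eq_bigr (fun i => x 0 i ^+ 2 + (y 0 i ^+ 2 +
  2 * (x 0 i * y 0 i)))); last by move=> i _; rewrite mxE; ring.
rewrite !big_split/= -mulr_sumr -!sqr_l2norm.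
have := ler_l2norm_dot x y; nra.
Qed.

Lemma ler_l2dist x y : `|l2norm x - l2norm y| <= l2norm (x - y).
Proof.
have := ler_l2normD (x - y) y; have := ler_l2normD (y - x) x.
rewrite !subrK (l2norm_distC y x) ler_norml; lra.
Qed.

Lemma l2norm_le_sum x : l2norm x <= \sum_(i < d) `|x 0 i|.
Proof.
rewrite -(@ler_pXn2r _ 2)// ?nnegrE ?l2norm_ge0 ?sumr_ge0//.
rewrite sqr_l2norm expr2 mulr_suml ler_sum// => i _.
by rewrite -real_normK ?num_real// expr2 ler_wpM2l// (bigD1 i)//= lerDl sumr_ge0.
Qed.

Lemma mx_norm_le_l2norm x : `|x| <= l2norm x.
Proof.
rewrite [leLHS]/Num.norm /= mx_normrE; apply/bigmax_leP; split => [|[i j] _ /=].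
  exact: l2norm_ge0.
by rewrite ord1; exact: coord_le_l2norm.
Qed.

Lemma continuous_l2norm : continuous (@l2norm R d).
Proof.
move=> x; apply: (@continuous_comp _ _ _ (fun x : 'rV[R]_d => \sum_(i < d) x 0 i ^+ 2)).
  elim: (index_enum _) => [|i r IH].
    have -> : (fun x : 'rV[R]_d => \sum_(i <- [::]) x 0 i ^+ 2) = cst 0.
      by apply/funext => y; rewrite big_nil.
    exact: cst_continuous.
  have -> : (fun x : 'rV[R]_d => \sum_(i <- i :: r) x 0 i ^+ 2) =
            (fun x => x 0 i ^+ 2) \+ (fun x => \sum_(i <- r) x 0 i ^+ 2).
    by apply/funext => y; rewrite big_cons.
  apply: continuousD; last exact: IH.
  by apply: (@continuous_comp _ _ _ (fun x : 'rV[R]_d => x 0 i) (fun a => a ^+ 2));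
    [exact: coord_continuous|exact: exprn_continuous].
exact: sqrt_continuous.
Qed.

Lemma continuous_l2dist x : continuous (fun y => l2norm (y - x)).
Proof.
move=> y; apply: (@continuous_comp _ _ _ (fun y => y - x)).
  by apply: continuousB; [exact: cvg_id|exact: cst_continuous].
exact: continuous_l2norm.
Qed.

Lemma open_l2ball x (r : R) : open (l2ball x r).
Proof.
have -> : l2ball x r = (fun y => l2norm (y - x)) @^-1` [set a | a < r] by [].
by apply: open_comp; [move=> y _; exact: continuous_l2dist|exact: open_lt].
Qed.

Lemma l2ball_center x (r : R) : 0 < r -> l2ball x r x.
Proof. by move=> r0; rewrite /l2ball/= subrr l2norm0. Qed.

Lemma closed_l2ball_closed x (r : R) : closed [set y | l2norm (y - x) <= r].
Proof.
have -> : [set y | l2norm (y - x) <= r] =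
  (fun y => l2norm (y - x)) @^-1` [set a | a <= r] by [].
by apply: preimage_closed; [move=> y _; exact: continuous_l2dist|exact: closed_le].
Qed.

Lemma closed_l2ball_compact x (r : R) : compact [set y | l2norm (y - x) <= r].
Proof.
apply: bounded_closed_compact.
  exists (r + `|x|); split; first exact: num_real.
  move=> M rM y /= yx; rewrite -(subrK x y); apply: le_trans (ler_normD _ _) _.
  apply: le_trans (ltW rM); rewrite lerD2r.
  exact: le_trans (mx_norm_le_l2norm _) yx.
exact: closed_l2ball_closed.
Qed.

Lemma Lip0_of_ball (f : 'rV[R]_d -> R) x (L r : R) :
  (forall y z, `|f y - f z| <= L * l2norm (y - z)) ->
  (forall y, r < l2norm (y - x) -> f y = 0) -> Lip0 f.
Proof.
move=> fL f0; split; first by exists L.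
apply: (subclosed_compact _ (@closed_l2ball_compact x r)).
  exact: closed_closure.
rewrite [X in _ `<=` X](iffLR (closure_id _) (@closed_l2ball_closed x r)).
apply: closureS => y /= fy; rewrite leNgt; apply/negP => /f0 fy0.
by rewrite fy0 eqxx in fy.
Qed.

End L2norm.

Section Kernels.
Context {R : realType} {d : nat}.
Variable s : R.
Hypothesis s0 : 0 < s.
Implicit Types (x y z a b : 'rV[R]_d) (i : 'I_d) (t m : R).

Definition smooth_kernel t x i : R :=
  x 0 i * (l2norm x ^+ 2 + t ^+ 2) `^ (- ((s + 1) / 2)).

Lemma riesz_kernelE x i :
  riesz_kernel s x 0 i = x 0 i * l2norm x `^ (- (s + 1)).
Proof. by rewrite mxE mulrC powRN. Qed.

Lemma riesz_kernelN x i : riesz_kernel s (- x) 0 i = - riesz_kernel s x 0 i.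
Proof. by rewrite !riesz_kernelE l2normN mxE mulNr. Qed.

Lemma riesz_kernel_le x i : `|riesz_kernel s x 0 i| <= l2norm x `^ (- s).
Proof.
have [->|] := eqVneq x 0.
  by rewrite riesz_kernelE mxE mul0r normr0 powR_ge0.
rewrite -l2norm_gt0 => x0.
rewrite riesz_kernelE normrM (ger0_norm (powR_ge0 _ _)).
have -> : - s = 1 + - (s + 1) by lra.
rewrite [leRHS]powRD_gt0//.
by rewrite powRr1 ?l2norm_ge0// ler_wpM2r ?powR_ge0 ?coord_le_l2norm.
Qed.

(** The parameter [m] is left free because it is taken to be [t] in one place and the larger of
    [|x|] and a scale below [t] in another. *)
Lemma smooth_kernel_le t x i m : 0 < m -> m ^+ 2 <= l2norm x ^+ 2 + t ^+ 2 ->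
  `|smooth_kernel t x i| <= m `^ (- s).
Proof.
move=> m0 mx; set D := l2norm x ^+ 2 + t ^+ 2.
have D0 : 0 < D by apply: lt_le_trans mx; rewrite exprn_gt0.
rewrite normrM (ger0_norm (powR_ge0 _ _)).
have H : `|x 0 i| <= D `^ 2^-1.
  rewrite powR12_sqrt ?(ltW D0)//; apply: le_trans (coord_le_l2norm _ _) _.
  rewrite -[leLHS]ger0_norm ?l2norm_ge0// -sqrtr_sqr ler_wsqrtr// lerDl.
  exact: sqr_ge0.
apply: (le_trans (ler_wpM2r (powR_ge0 _ _) H)).
rewrite -powRD_gt0//.
have -> : 2^-1 + - ((s + 1) / 2) = - (s / 2) by field.
have -> : m `^ (- s) = (m ^+ 2) `^ (- (s / 2)).
  by rewrite powR_sqr ?ltW//; congr (_ `^ _); field.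
by apply: ger_powRN => //; [rewrite exprn_gt0|rewrite divr_ge0 ?ltW].
Qed.

Lemma riesz_kernel_lip a b i m : 0 < m -> m <= l2norm a -> m <= l2norm b ->
  `|riesz_kernel s a 0 i - riesz_kernel s b 0 i| <=
    (s + 2) * l2norm (a - b) * m `^ (- (s + 1)).
Proof.
move=> m0; wlog ba : a b / l2norm b <= l2norm a => [H ma mb|ma mb].
  have [|/ltW] := leP (l2norm b) (l2norm a); first by move/H; apply.
  by move/H => /(_ mb ma); rewrite distrC l2norm_distC.
have b0 := lt_le_trans m0 mb; have a0 := lt_le_trans m0 ma.
rewrite !riesz_kernelE; set q := s + 1.
have q0 : 0 <= q by move: s0; rewrite /q; lra.
have -> : a 0 i * l2norm a `^ (- q) - b 0 i * l2norm b `^ (- q) =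
  (a - b) 0 i * l2norm a `^ (- q) -
  b 0 i * (l2norm b `^ (- q) - l2norm a `^ (- q)) by rewrite !mxE; ring.
have T : 0 <= l2norm b `^ (- q) - l2norm a `^ (- q).
  by rewrite subr_ge0 ger_powRN.
have := powRN_tangent b0 a0 q0.
have -> : l2norm b `^ (- q - 1) = l2norm b `^ (- q) / l2norm b.
  exact: powRB1_gt0.
have ab : l2norm a - l2norm b <= l2norm (a - b).
  exact: le_trans (ler_norm _) (ler_l2dist a b).
have Pb : l2norm b `^ (- q) <= m `^ (- q) by apply: ger_powRN.
have Pa : l2norm a `^ (- q) <= m `^ (- q) by apply: ger_powRN.
set A := l2norm a `^ _ in T Pa *; set B := l2norm b `^ _ in T Pb *.
set M := m `^ _ in Pa Pb *; set n := l2norm (a - b) in ab *.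
have A0 : 0 <= A by apply: powR_ge0.
have B0 : 0 <= B by apply: powR_ge0.
have n0 : 0 <= n by apply: l2norm_ge0.
move=> H; apply: (le_trans (ler_normB _ _)); rewrite !normrM.
rewrite (ger0_norm A0) (ger0_norm T).
have h1 : `|(a - b) 0 i| * A <= n * M.
  by apply: ler_pM => //; exact: coord_le_l2norm.
have h2 : `|b 0 i| * (B - A) <= q * n * M.
  apply: (@le_trans _ _ (l2norm b * (q * (B / l2norm b) * n))).
    apply: ler_pM => //; first exact: coord_le_l2norm.
    apply: (le_trans H); rewrite ler_wpM2l// mulr_ge0// divr_ge0//.
    exact: ltW.
  have -> : l2norm b * (q * (B / l2norm b) * n) = q * n * B.
    by field; rewrite gt_eqF.
  by rewrite ler_wpM2l// mulr_ge0.
rewrite /q in h2; nra.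
Qed.

(** The tangent is taken in the variable [|b|^2], so smoothing is a perturbation of second order in
    [t], at the price of two powers of the distance. *)
Lemma riesz_smooth_kernel_dist t b i m : 0 < m -> m <= l2norm b ->
  `|riesz_kernel s b 0 i - smooth_kernel t b i| <=
     (s + 1) / 2 * t ^+ 2 * m `^ (- (s + 2)).
Proof.
move=> m0 mb; have b0 := lt_le_trans m0 mb.
set p := (s + 1) / 2.
have p0 : 0 <= p by move: s0; rewrite /p; lra.
have b20 : 0 < l2norm b ^+ 2 by rewrite exprn_gt0.
have bt0 : 0 < l2norm b ^+ 2 + t ^+ 2 by rewrite ltr_wpDr ?sqr_ge0.
have := powRN_tangent b20 bt0 p0.
have T : (l2norm b ^+ 2 + t ^+ 2) `^ (- p) <= (l2norm b ^+ 2) `^ (- p).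
  by apply: ger_powRN => //; rewrite lerDl sqr_ge0.
rewrite riesz_kernelE /smooth_kernel -/p.
rewrite [_ + t ^+ 2 - _](_ : _ = t ^+ 2); last by ring.
have -> : l2norm b `^ (- (s + 1)) = (l2norm b ^+ 2) `^ (- p).
  by rewrite powR_sqr ?l2norm_ge0//; congr (_ `^ _); rewrite /p; field.
move=> H; rewrite -mulrBr normrM [`|_ `^ _ - _|]ger0_norm ?subr_ge0//.
apply: (@le_trans _ _ (l2norm b * (p * (l2norm b ^+ 2) `^ (- p - 1) * t ^+ 2))).
  by apply: ler_pM => //; [rewrite subr_ge0|exact: coord_le_l2norm].
have -> : l2norm b * (p * (l2norm b ^+ 2) `^ (- p - 1) * t ^+ 2) =
   p * t ^+ 2 * l2norm b `^ (- (s + 2)).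
  rewrite powR_sqr ?l2norm_ge0//.
  have -> : - (s + 2) = 1 + 2 * (- p - 1) by rewrite /p; field.
  rewrite (@powRD_gt0 _ _ 1)// powRr1 ?l2norm_ge0//; ring.
apply: ler_wpM2l; first by rewrite mulr_ge0 ?sqr_ge0.
by apply: ger_powRN => //; move: s0; lra.
Qed.

End Kernels.

(** * Integration of radial kernels against nice measures *)

Section IntegralTools.
Context {R : realType} {dp : measure_display} {T : measurableType dp}.
Variable mu : {measure set T -> \bar R}.
Implicit Types (f g : T -> R) (A : set T) (c b : R).

Lemma le_integral_EFin f g : measurable_fun setT f -> measurable_fun setT g ->
  (forall x, 0 <= f x) -> (forall x, f x <= g x) ->
  (\int[mu]_x (f x)%:E <= \int[mu]_x (g x)%:E)%E.
Proof.
move=> mf mg f0 fg; apply: ge0_le_integral => //.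
- by move=> x _; rewrite lee_fin.
- exact/measurable_EFinP.
- exact/measurable_EFinP.
- by move=> x _; rewrite lee_fin.
Qed.

Lemma integral_Zindic c A : 0 <= c -> measurable A ->
  (\int[mu]_x (c * \1_A x)%:E = c%:E * mu A)%E.
Proof.
move=> c0 mA; under eq_integral do rewrite EFinM.
rewrite ge0_integralZl_EFin//.
- by rewrite integral_indic// setIT.
- by apply/measurable_EFinP; exact: measurable_indic.
Qed.

(* The majorant only has to hold where [f] is positive, so a junk value at a
   singularity is harmless as long as it is not positive. *)
Lemma integral_le_geometric f (A : (set T)^nat) (c : R^nat) b :
  0 <= b -> measurable_fun setT f -> (forall x, 0 <= f x) ->
  (forall k, measurable (A k)) -> (forall k, 0 <= c k) ->
  (forall x, 0 < f x -> exists2 k, A k x & f x <= c k) ->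
  (forall k, (c k)%:E * mu (A k) <= (b / 2 ^+ k.+1)%:E)%E ->
  (\int[mu]_x (f x)%:E <= b%:E)%E.
Proof.
move=> b0 mf f0 mA c0 fA cA.
pose g k x : \bar R := (c k * \1_(A k) x)%:E.
have g0 k x : (0 <= g k x)%E by rewrite lee_fin mulr_ge0.
have mg k : measurable_fun setT (g k).
  apply/measurable_EFinP; apply: measurable_funM; first exact: measurable_cst.
  by apply: measurable_indic; exact: mA.
apply: (@le_trans _ _ (\int[mu]_x (\sum_(k <oo) g k x))%E).
  apply: ge0_le_integral => //.
  - by move=> x _; rewrite lee_fin.
  - exact/measurable_EFinP.
  - by apply: ge0_emeasurable_sum => //; exact: mg.
  - move=> x _; have [f0'|/fA[k Ak fck]] := leP (f x) 0.
      by apply: (@le_trans _ _ 0%E); [rewrite lee_fin|exact: nneseries_ge0].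
    apply: (@le_trans _ _ (\sum_(0 <= i < k.+1) g i x)%E); last first.
      by apply: nneseries_lim_ge => n _ _; exact: g0.
    rewrite big_nat_recr//= -[leLHS]add0e leeD//.
      by apply: sume_ge0 => i _; exact: g0.
    by rewrite lee_fin indicE mem_set// mulr1.
rewrite integral_nneseries//.
apply: (@le_trans _ _ (\sum_(k <oo) (b / 2 ^+ k.+1)%:E)%E).
  apply: lee_nneseries; first by move=> k _ _; apply: integral_ge0 => x _; exact: g0.
  by move=> k _; rewrite (integral_Zindic (c0 k) (mA k)); exact: cA.
have /cvg_lim := @cvg_geometric_eseries_half R b 0.
rewrite expr0 divr1 => <-//.
rewrite (_ : (fun n => _) = eseries (fun k => (b / (2 ^ (k + 1))%:R)%:E)) //.
apply/funext => n; rewrite /eseries/=; apply: eq_bigr => k _.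
by rewrite natrX addn1.
Qed.

(* No measurability is needed: the integral of a nonnegative function is a
   supremum over the simple functions below it. *)
Lemma le_integral_nonmeas (f g : T -> \bar R) : (forall x, 0 <= f x)%E ->
  (forall x, f x <= g x)%E -> (\int[mu]_x f x <= \int[mu]_x g x)%E.
Proof.
move=> f0 fg; have g0 x : (0 <= g x)%E by apply: le_trans (fg x).
rewrite !ge0_integralTE//; apply: ereal_sup_le => _ [h hf <-].
by exists h => // x; apply: le_trans (fg x).
Qed.

(** The positive and negative parts both have integrals in [[0, b]], so [fine] is applied to a real
    number. One use is for the Riesz transform as a function of its base point, whose measurability
    is never established. *)
Lemma integral_abs_le f b : 0 <= b ->
  (\int[mu]_x `|f x|%:E <= b%:E)%E -> `|fine (\int[mu]_x (f x)%:E)| <= b.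
Proof.
move=> b0 H.
have Hle (g : T -> \bar R) : (forall x, 0 <= g x)%E ->
    (forall x, (g x <= `|f x|%:E)%E) -> (0 <= \int[mu]_x g x <= b%:E)%E.
  by move=> g0 gf; rewrite integral_ge0//=; apply: le_trans H; exact: le_integral_nonmeas.
rewrite integralE.
have /andP[p0 pb] : (0 <= \int[mu]_x (EFin \o f)^\+ x <= b%:E)%E.
  apply: Hle => x; rewrite funeposE/=; first by rewrite le_max lexx orbT.
  by rewrite -EFin_max lee_fin ge_max ler_norm normr_ge0.
have /andP[n0 nb] : (0 <= \int[mu]_x (EFin \o f)^\- x <= b%:E)%E.
  apply: Hle => x; rewrite funenegE/=; first by rewrite le_max lexx orbT.
  by rewrite -EFin_max lee_fin ge_max -normrN ler_norm normr_ge0.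
move: p0 pb n0 nb.
case: (integral _ _ _) => [p| |] //; case: (integral _ _ _) => [n| |] //.
by rewrite !lee_fin /= => *; rewrite ler_norml; lra.
Qed.

End IntegralTools.

(** * Borel measurability, sigma-finiteness and dyadic shells *)

Section BorelRV.
Context {R : realType} {d : nat}.
Implicit Types (x y : 'rV[R]_d).

Lemma open_measurable_rV (A : set 'rV[R]_d) :
  open A -> measurable (A : set (borel_rV R d)).
Proof. by move=> oA; apply: sub_sigma_algebra. Qed.

Lemma measurable_l2ball x (r : R) : measurable (l2ball x r : set (borel_rV R d)).
Proof. by apply: open_measurable_rV; exact: open_l2ball. Qed.

Lemma continuous_measurable_rV (f : 'rV[R]_d -> R) :
  continuous f -> measurable_fun setT (f : borel_rV R d -> R).
Proof.
move=> /continuousP cf; apply: (measurability _ (RGenOpens.measurableE R)).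
move=> _ [_ [a [b ->] <-]]; rewrite setTI; apply: open_measurable_rV.
by apply: cf; exact: interval_open.
Qed.

Lemma measurable_coord (i : 'I_d) :
  measurable_fun setT (fun x : borel_rV R d => (x : 'rV[R]_d) 0 i).
Proof. by apply: continuous_measurable_rV; exact: coord_continuous. Qed.

Lemma measurable_sqrt : measurable_fun setT (@Num.sqrt R).
Proof. by apply: continuous_measurable_fun; exact: sqrt_continuous. Qed.

Section fun_rV.
Context {dp : measure_display} {T : measurableType dp}.
Variable h : T -> 'rV[R]_d.
Hypothesis mh : forall i, measurable_fun setT (fun t => h t 0 i).

Lemma measurable_l2norm : measurable_fun setT (fun t => l2norm (h t)).
Proof.
apply: measurableT_comp; first exact: measurable_sqrt.
by apply: measurable_sum => i; exact: measurable_funX.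
Qed.

End fun_rV.

End BorelRV.

Section SigmaFinite.
Context {R : realType} {d : nat}.
Variables (s Lam : R) (mu : {measure set (borel_rV R d) -> \bar R}).
Hypothesis nice_mu : nice s Lam mu.

Lemma nice_sigma_finite : sigma_finite setT mu.
Proof.
exists (fun n : nat => l2ball (0 : 'rV[R]_d) n.+1%:R).
  apply/seteqP; split => // x _; exists (Num.truncn (l2norm x)) => //.
  by rewrite /l2ball/= subr0; exact: truncnS_gt.
move=> n; split; first exact: measurable_l2ball.
by apply: le_lt_trans (nice_mu _ _) (ltry _).
Qed.

(** Fubini's theorem asks for this structure. The underlying measure is still [mu], so integrals
    against either are convertible. *)
Definition nice_sigma_finite_measure :
    {sigma_finite_measure set (borel_rV R d) -> \bar R} :=
  HB.pack (Measure.sort mu) (Measure.class mu)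
    (@isSFinite.Build _ _ _ mu (sfinite_measure_sigma_finite nice_sigma_finite))
    (@isSigmaFinite.Build _ _ _ mu nice_sigma_finite).

End SigmaFinite.

Section Dyadic.
Context {R : realType}.
Implicit Types (a u : R).

Lemma ltr_nat_pow2 (n : nat) : n%:R < 2 ^+ n :> R.
Proof. by rewrite -natrX ltr_nat ltn_expl. Qed.

Lemma dyadic_below a u : 0 < u -> u < a ->
  exists k : nat, a / 2 ^+ k.+1 <= u < a / 2 ^+ k.
Proof.
move=> u0 ua; have a0 := lt_trans u0 ua.
have ex : exists k : nat, a / 2 ^+ k.+1 <= u.
  exists (Num.truncn (a / u)); rewrite ler_pdivrMr ?exprn_gt0// mulrC.
  rewrite -ler_pdivrMr//; apply: ltW; apply: lt_trans (ltr_nat_pow2 _).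
  exact: truncnS_gt.
case: (ex_minnP ex) => k ku kmin; exists k; rewrite ku/=.
case: k ku kmin => [|k] ku kmin; first by rewrite expr0 divr1.
by rewrite ltNge; apply/negP => /kmin; rewrite ltnn.
Qed.

Lemma dyadic_above a u : 0 < a -> a <= u ->
  exists k : nat, a * 2 ^+ k <= u < a * 2 ^+ k.+1.
Proof.
move=> a0 au.
have ex : exists k : nat, u < a * 2 ^+ k.+1.
  exists (Num.truncn (u / a)); rewrite mulrC -ltr_pdivrMr//.
  by apply: lt_trans (ltr_nat_pow2 _); exact: truncnS_gt.
case: (ex_minnP ex) => k ku kmin; exists k; rewrite ku andbT.
case: k ku kmin => [|k] ku kmin; first by rewrite expr0 mulr1.
by rewrite leNgt; apply/negP => /kmin; rewrite ltnn.
Qed.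

End Dyadic.

Section NiceIntegrals.
Context {R : realType} {d : nat}.
Variables (s Lam : R) (mu : {measure set (borel_rV R d) -> \bar R}).
Hypotheses (s0 : 0 < s) (Lam0 : 0 < Lam) (nice_mu : nice s Lam mu).
Implicit Types (x y : 'rV[R]_d) (a : R).

Lemma measurable_indic_l2ball x a :
  measurable_fun setT (\1_(l2ball x a) : borel_rV R d -> R).
Proof. by apply: measurable_indic; exact: measurable_l2ball. Qed.

Lemma measurable_l2dist x :
  measurable_fun setT (fun y : borel_rV R d => l2norm (x - y)).
Proof.
have -> : (fun y : borel_rV R d => l2norm (x - y)) = (fun y => l2norm (y - x)).
  by apply/funext => y; rewrite l2norm_distC.
by apply: continuous_measurable_rV; exact: continuous_l2dist.
Qed.

Lemma measurable_l2dist_powR x q :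
  measurable_fun setT (fun y : borel_rV R d => l2norm (x - y) `^ q).
Proof.
apply: (measurableT_comp (measurable_powR q)); exact: measurable_l2dist.
Qed.

(** On the shell of radius [a / 2^k] niceness cancels the factor [|x - y|^(-s)] and leaves the
    summable [a / 2^k]. The product is not merged into one power so that the integrand vanishes at
    [y = x]; for [s = 1] the merged power would be 1 there. *)
Lemma nice_integral_near x a : 0 < a ->
  (\int[mu]_y (\1_(l2ball x a) y *
      (l2norm (x - y) `^ (- s) * l2norm (x - y)))%:E <=
   (2 * 2 `^ s * Lam * a)%:E)%E.
Proof.
move=> a0.
apply: (@integral_le_geometric R _ (borel_rV R d) mu _ (fun k => l2ball x (a / 2 ^+ k))
  (fun k => 2 `^ s * (a / 2 ^+ k) `^ (- s) * (a / 2 ^+ k))).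
- by rewrite !mulr_ge0 ?powR_ge0 ?ltW.
- apply: measurable_funM; first exact: measurable_indic_l2ball.
  apply: measurable_funM; first exact: measurable_l2dist_powR.
  exact: measurable_l2dist.
- by move=> y; rewrite !mulr_ge0 ?powR_ge0 ?l2norm_ge0.
- by move=> k; exact: measurable_l2ball.
- by move=> k; rewrite !mulr_ge0 ?powR_ge0// ltW.
- move=> y; rewrite indicE; case: (boolP (y \in _)) => [|_]; last by rewrite mul0r ltxx.
  rewrite inE mul1r /l2ball/= (l2norm_distC y) => ya.
  have [->|u0] := eqVneq (l2norm (x - y)) 0; first by rewrite mulr0 ltxx.
  have {}u0 : 0 < l2norm (x - y) by rewrite lt_def u0; exact: l2norm_ge0.
  have [k /andP[ku uk]] := dyadic_below u0 ya.
  move=> _; exists k; first exact: uk.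
  have ak : 0 < a / 2 ^+ k.+1 by rewrite divr_gt0 ?exprn_gt0.
  apply: ler_pM; rewrite ?powR_ge0 ?l2norm_ge0 ?(ltW uk)//.
  apply: (le_trans (ger_powRN ak ku (ltW s0))).
  have -> : a / 2 ^+ k.+1 = 2^-1 * (a / 2 ^+ k).
    by rewrite exprS; field; rewrite expf_neq0.
  rewrite [leLHS]powRM ?invr_ge0 ?divr_ge0 ?exprn_ge0 ?(ltW a0)//.
  by rewrite powRVN.
- move=> k; have ak : 0 < a / 2 ^+ k by rewrite divr_gt0 ?exprn_gt0.
  apply: (@le_trans _ _ ((2 `^ s * (a / 2 ^+ k) `^ (- s) * (a / 2 ^+ k))%:E *
      (Lam * (a / 2 ^+ k) `^ s)%:E))%E.
    by apply: lee_wpmul2l; [rewrite lee_fin !mulr_ge0 ?powR_ge0// ltW|exact: nice_mu].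
  rewrite -EFinM lee_fin powRN.
  set P := (a / 2 ^+ k) `^ s; have P0 : P != 0 by rewrite gt_eqF ?powR_gt0.
  rewrite le_eqVlt; apply/orP; left; apply/eqP; rewrite exprS.
  by field; rewrite P0 expf_neq0.
Qed.

(** The kernel decays one power faster than the mass of balls can grow, so the shells of radius
    [a 2^k] contribute multiples of [1 / (a 2^k)]. *)
Lemma nice_integral_far x a : 0 < a ->
  (\int[mu]_y (\1_(~` l2ball x a) y * l2norm (x - y) `^ (- (s + 1)))%:E <=
   (2 * 2 `^ s * Lam / a)%:E)%E.
Proof.
move=> a0.
have c0 k : 0 < a * 2 ^+ k by rewrite mulr_gt0 ?exprn_gt0.
apply: (@integral_le_geometric R _ (borel_rV R d) mu _
  (fun k => l2ball x (a * 2 ^+ k.+1)) (fun k => (a * 2 ^+ k) `^ (- (s + 1)))).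
- by rewrite divr_ge0 ?mulr_ge0 ?powR_ge0 ?ltW.
- apply: measurable_funM; last exact: measurable_l2dist_powR.
  by apply: measurable_indic; apply: measurableC; exact: measurable_l2ball.
- by move=> y; rewrite mulr_ge0 ?powR_ge0.
- by move=> k; exact: measurable_l2ball.
- by move=> k; rewrite powR_ge0.
- move=> y; rewrite indicE; case: (boolP (y \in _)) => [|_]; last by rewrite mul0r ltxx.
  rewrite inE mul1r /l2ball/= (l2norm_distC y) => /negP; rewrite -leNgt => ya _.
  have [k /andP[ku uk]] := dyadic_above a0 ya.
  exists k; first exact: uk.
  by apply: ger_powRN => //; rewrite addr_ge0 ?ltW.
- move=> k.
  apply: (@le_trans _ _ (((a * 2 ^+ k) `^ (- (s + 1)))%:E *
      (Lam * (a * 2 ^+ k.+1) `^ s)%:E))%E.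
    by apply: lee_wpmul2l; [rewrite lee_fin powR_ge0|exact: nice_mu].
  have E : (a * 2 ^+ k.+1) `^ s = 2 `^ s * (a * 2 ^+ k) `^ s.
    by rewrite exprS mulrCA [LHS]powRM// ltW.
  rewrite -EFinM lee_fin E exprS.
  rewrite opprD powRB1_gt0// powRN.
  set P := (a * 2 ^+ k) `^ s; have P0 : P != 0 by rewrite gt_eqF ?powR_gt0.
  rewrite le_eqVlt; apply/orP; left; apply/eqP.
  by field; rewrite P0 expf_neq0// gt_eqF.
Qed.

End NiceIntegrals.

Section IntegralAdd.
Context {R : realType} {dp : measure_display} {T : measurableType dp}.
Variable mu : {measure set T -> \bar R}.
Implicit Types (f g h : T -> R) (c G H : R).

Lemma integral_le_add f g h c G H : measurable_fun setT f ->
  measurable_fun setT g -> measurable_fun setT h ->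
  (forall x, 0 <= f x) -> (forall x, 0 <= g x) -> (forall x, 0 <= h x) ->
  0 <= c -> (forall x, f x <= c * g x + h x) ->
  (\int[mu]_x (g x)%:E <= G%:E)%E -> (\int[mu]_x (h x)%:E <= H%:E)%E ->
  (\int[mu]_x (f x)%:E <= (c * G + H)%:E)%E.
Proof.
move=> mf mg mh f0 g0 h0 c0 fgh gG hH.
apply: (@le_trans _ _ (\int[mu]_x (c * g x + h x)%:E)%E).
  apply: le_integral_EFin => //; apply: measurable_funD => //.
  by apply: measurable_funM => //; exact: measurable_cst.
under eq_integral do rewrite EFinD EFinM.
rewrite ge0_integralD//; first last.
- exact/measurable_EFinP.
- by move=> x _; rewrite lee_fin.
- apply/measurable_EFinP; apply: measurable_funM => //; exact: measurable_cst.
- by move=> x _; rewrite lee_fin mulr_ge0.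
rewrite ge0_integralZl_EFin//; last 2 first.
- by move=> x _; rewrite lee_fin.
- exact/measurable_EFinP.
rewrite EFinD EFinM leeD// lee_wpmul2l// lee_fin.
Qed.

End IntegralAdd.

(** * Bump functions and the bilinear form *)

Section BumpRadius.
Context {R : realType} {d : nat}.
Variables (s Lam : R).
Hypotheses (s0 : 0 < s) (Lam0 : 0 < Lam).
Implicit Types (mu : {measure set (borel_rV R d) -> \bar R}).

Lemma nice_ball_fin_num mu (x : 'rV[R]_d) r : nice s Lam mu -> 0 < r ->
  mu (l2ball x r) \is a fin_num.
Proof. by move=> nm r0; rewrite ge0_fin_numE// (le_lt_trans (nm x r r0)) ?ltry. Qed.

Lemma le_l2ball (x : 'rV[R]_d) (r1 r2 : R) : r1 <= r2 -> l2ball x r1 `<=` l2ball x r2.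
Proof. by move=> r12 y; rewrite /l2ball/= => /lt_le_trans; apply. Qed.

Lemma le_measure_l2ball mu (x : 'rV[R]_d) r1 r2 : r1 <= r2 ->
  (mu (l2ball x r1) <= mu (l2ball x r2))%E.
Proof.
move=> r12; apply: le_measure; rewrite ?inE; [exact: measurable_l2ball..|].
exact: le_l2ball.
Qed.

(* Concentric balls of radii l/4 + l/2^(j+1) decrease to B(z, l/4), which is
   charged since z lies in the support, so the masses cannot drop by the factor
   2^(s+1) forever.  Before the first step without a drop they decay
   geometrically, which makes the mass far from the small ball harmless. *)
Lemma exists_bump_radius c0 : 0 < c0 -> exists2 th, 0 < th &
  forall mu (z : 'rV[R]_d) l, nice s Lam mu -> 0 < l ->
  measure_supp mu z -> (mu (l2ball z l) <= (th * l `^ s)%:E)%E ->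
  exists T ell, [/\ 0 < ell < T, T <= l / 2,
    (0 < mu (l2ball z (T - ell)))%E,
    (mu (l2ball z T) <= (2 * 2 `^ s)%:E * mu (l2ball z (T - ell)))%E &
    forall x, l2ball z T x ->
    (\int[mu]_y (\1_(l2ball z (3 / 4 * l)) y *
       (l2norm (x - y) `^ (- s) * Num.min 1 (l2norm (x - y) / ell)))%:E
      <= c0%:E)%E].
Proof.
(* On the shell of index [j] the kernel grows like [2^(s j)] and the mass decays like [A^(-j)]; the
   factor 2 beyond [2^s] leaves a convergent geometric series. *)
move=> c00; pose A : R := 2 * 2 `^ s.
have ps0 : 0 < 2 `^ s :> R by rewrite powR_gt0.
have A0 : 0 < A by rewrite mulr_gt0.
have ps1 : 1 <= 2 `^ s :> R by rewrite -[leLHS](powRr0 2) ler_powR ?ler1n// ltW.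
have A2 : 2 <= A by rewrite ler_peMr.
(* [ka * ell] will be the radius of a small ball around [x], over which niceness bounds the integral
   by [2 * 2^s * Lam * ka], at most half of [c0]. *)
pose ka : R := Num.min 1 (c0 / (4 * 2 `^ s * Lam)).
have ka0 : 0 < ka by rewrite lt_min ltr01 divr_gt0// !mulr_gt0.
have ka1 : ka <= 1 by rewrite ge_min lexx.
have ka8 : 0 < (ka / 8) `^ (- s) by rewrite powR_gt0// divr_gt0.
(* With mass at most [th l^s] in the ball of radius [l], the shells outside the small ball account
   for the other half of [c0]. *)
pose th : R := c0 / (4 * A * (ka / 8) `^ (- s)).
have th0 : 0 < th by rewrite divr_gt0// !mulr_gt0.
exists th => // mu z l nm l0 zsupp mul.
pose U (j : nat) : R := l / 4 + l / 2 / 2 ^+ j.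
have U0 j : 0 < U j by rewrite addr_gt0 ?divr_gt0 ?exprn_gt0.
have US j : U j.+1 = U j - l / 2 / 2 ^+ j.+1.
  by rewrite /U exprS; field; rewrite expf_neq0.
have Ud j : U j.+1 <= U j by rewrite US gerBl !divr_ge0 ?exprn_ge0 ?ltW.
have Unincr i j : (i <= j)%N -> U j <= U i.
  by apply: (@homo_leq _ U (fun a b => b <= a)) => // a b c /[swap]; exact: le_trans.
pose V (j : nat) : R := fine (mu (l2ball z (U j))).
have VE j : mu (l2ball z (U j)) = (V j)%:E by rewrite fineK// nice_ball_fin_num.
pose V' : R := fine (mu (l2ball z (l / 4))).
have V'E : mu (l2ball z (l / 4)) = V'%:E.
  by rewrite fineK// (nice_ball_fin_num _ nm)// divr_gt0.
have V'0 : 0 < V'.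
  rewrite -lte_fin -V'E; apply: zsupp; split; first exact: open_l2ball.
  by apply: l2ball_center; rewrite divr_gt0.
have V'V j : V' <= V j.
  rewrite -lee_fin -V'E -VE le_measure_l2ball// /U lerDl.
  by rewrite !divr_ge0 ?exprn_ge0 ?ltW.
have VV j : V j.+1 <= V j by rewrite -lee_fin -!VE le_measure_l2ball.
have V0 j : 0 <= V j by rewrite (le_trans _ (V'V j))// ltW.
have V0th : V 0 <= th * l `^ s.
  rewrite -lee_fin -VE; apply: le_trans mul; apply: le_measure_l2ball.
  by rewrite /U expr0; lra.
(* The step from [U 0] to [U 1] is left out of the search: [T] is then at most [U 1 = l / 2], while
   the integral extends over the ball of radius [U 0 = 3/4 l]. *)
have ex : exists k, V k.+1 <= A * V k.+2.
  apply: contrapT => /forallNP H.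
  have H' k : A ^+ k * V' <= V 1.
    apply: (@le_trans _ _ (A ^+ k * V k.+1)).
      by rewrite ler_wpM2l ?exprn_ge0 ?(ltW A0).
    elim: k => [|k IH]; first by rewrite expr0 mul1r.
    apply: le_trans IH; rewrite exprSr -mulrA ler_wpM2l ?exprn_ge0 ?(ltW A0)//.
    by have /negP := H k; rewrite -ltNge => /ltW.
  have := H' (Num.truncn (V 1 / V')).+1; apply/negP; rewrite -ltNge.
  rewrite -ltr_pdivrMr//.
  apply: (@lt_le_trans _ _ (2 ^+ (Num.truncn (V 1 / V')).+1)); last first.
    by rewrite lerXn2r// nnegrE ltW.
  by apply: lt_trans (ltr_nat_pow2 _); exact: truncnS_gt.
have [k' kP kmin] := ex_minnP ex; pose k := k'.+1.
have Vdec j : (j <= k')%N -> A ^+ j * V j.+1 <= V 0.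
  elim: j => [_|j IH jk]; first by rewrite expr0 mul1r.
  apply: le_trans (IH (ltnW jk)); rewrite exprSr -mulrA ler_wpM2l ?exprn_ge0 ?(ltW A0)//.
  by rewrite leNgt; apply/negP => /ltW /kmin; rewrite leqNgt jk.
have Vdec' j : (j <= k)%N -> A ^+ j * V j <= A * V 0.
  case: j => [_|j jk]; first by rewrite expr0 mul1r ler_peMl//; lra.
  by rewrite exprS -mulrA ler_wpM2l ?(ltW A0)// Vdec.
pose ell : R := l / 2 / 2 ^+ k.+1.
have ell0 : 0 < ell by rewrite !divr_gt0 ?exprn_gt0.
have TE : U k - ell = U k.+1 by rewrite US.
exists (U k), ell; rewrite TE; split.
- by rewrite ell0/= -subr_gt0 TE.
- apply: (le_trans (Unincr 1%N k _)) => //.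
  by rewrite /U expr1; lra.
- by rewrite VE lte_fin (lt_le_trans V'0).
- by rewrite !VE -EFinM lee_fin.
move=> x xT.
pose e (j : nat) : R := l / 8 / 2 ^+ j.
have eE j : e j = U j.+1 - U j.+2.
  by rewrite /e /U !exprS; field; rewrite expf_neq0.
have e0 j : 0 < e j by rewrite /e !divr_gt0 ?exprn_gt0.
have ellE : ell = e k' by rewrite eE -TE /k; ring.
pose a := ka * ell.
have a0 : 0 < a by rewrite mulr_gt0.
(* [j] indexes the last ball containing [y] before the first that misses it. Then [x] lies in the
   ball of index [j + 2], so [|x - y| >= U (j + 1) - U (j + 2) = e j]. If no ball up to [k'] misses
   [y], the bound [|x - y| >= a] serves, since [ell = e k']. *)
have far y : l2ball z (U 0) y -> a <= l2norm (x - y) ->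
    exists j, [/\ (j < k)%N, l2ball z (U j) y & ka * e j <= l2norm (x - y)].
  move=> y0 axy.
  have [yk|yk] := pselect (l2ball z (U k') y).
    by exists k'; split => //; rewrite -ellE.
  have exm : exists m, (m <= k')%N && ~~ `[< l2ball z (U m) y >].
    by exists k'; rewrite leqnn/=; apply/asboolPn.
  have [[|m] /andP[mk /asboolPn ym] mmin] := ex_minnP exm; first by [].
  exists m; split; first exact: ltnW.
    apply: contrapT => ny; have := mmin m; rewrite ltnn => H.
    suff : false by []. apply: H; rewrite (ltnW mk)/=; exact/asboolPn.
  apply: (@le_trans _ _ (e m)); first by rewrite ler_piMl// ltW.
  move: ym; rewrite /l2ball/= => /negP; rewrite -leNgt => ym.
  move: xT; rewrite /l2ball/= => xT.
  have := Unincr m.+2 k; rewrite ltnS => /(_ mk) Umk.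
  have := ler_l2normD (y - x) (x - z); rewrite addrA subrK.
  rewrite (l2norm_distC y x) eE; lra.
pose f1 y : R := \1_(l2ball x a) y * (l2norm (x - y) `^ (- s) * l2norm (x - y)).
pose f2 y : R := \1_(l2ball z (U 0) `&` ~` l2ball x a) y * l2norm (x - y) `^ (- s).
have U0E : 3 / 4 * l = U 0 by rewrite /U expr0; lra.
rewrite U0E.
have mI : measurable (l2ball z (U 0) `&` ~` l2ball x a : set (borel_rV R d)).
  by apply: measurableI; [|apply: measurableC]; exact: measurable_l2ball.
have mf2 : measurable_fun setT (f2 : borel_rV R d -> R).
  by apply: measurable_funM; [exact: measurable_indic|exact: measurable_l2dist_powR].
pose b : R := 2 * A * (ka * l / 8) `^ (- s) * V 0.
have b0 : 0 <= b by rewrite !mulr_ge0 ?powR_ge0// ltW.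
have intf2 : (\int[mu]_y (f2 y)%:E <= b%:E)%E.
  apply: (@integral_le_geometric R _ (borel_rV R d) mu f2
    (fun j => if (j < k)%N then l2ball z (U j) else set0)
    (fun j => (ka * e j) `^ (- s))) => //.
  - by move=> y; rewrite mulr_ge0 ?powR_ge0.
  - by move=> j; case: ifP => _ //; exact: measurable_l2ball.
  - by move=> j; exact: powR_ge0.
  - move=> y; rewrite /f2 indicE; case: (boolP (y \in _)) => [|_]; last by rewrite mul0r ltxx.
    rewrite inE mul1r => -[yU yx] _.
    have /(far y yU)[j [jk yj kej]] : a <= l2norm (x - y).
      by rewrite l2norm_distC leNgt; exact/negP.
    exists j; first by rewrite jk.
    by apply: ger_powRN => //; [rewrite mulr_gt0|exact: ltW].
  - move=> j; case: ifPn => [jk|_]; last first.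
      by rewrite measure0 mule0 lee_fin divr_ge0 ?exprn_ge0.
    rewrite VE -EFinM lee_fin.
    have -> : ka * e j = ka * l / 8 * 2^-1 ^+ j by rewrite /e exprVn; ring.
    rewrite powRM ?divr_ge0 ?mulr_ge0 ?exprn_ge0 ?(ltW ka0) ?(ltW l0)//.
    have -> : (2^-1 ^+ j) `^ (- s) = (2 `^ s) ^+ j :> R.
      by rewrite exprVn powRVN ?exprn_ge0// powRX.
    have := Vdec' j (ltnW jk); rewrite /A exprMn.
    set P := (2 `^ s) ^+ j; set Q := _ `^ (- s) => H.
    rewrite ler_pdivlMr ?exprn_gt0// /b exprS.
    have -> : Q * P * V j * (2 * 2 ^+ j) = 2 * Q * (2 ^+ j * P * V j) by ring.
    have -> : 2 * A * Q * V 0 = 2 * Q * (A * V 0) by ring.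
    by rewrite ler_wpM2l// mulr_ge0// powR_ge0.
have intf1 := nice_integral_near s0 Lam0 nm x a0.
have mmin : measurable_fun setT (fun y : borel_rV R d => Num.min 1 (l2norm (x - y) / ell)).
  apply: measurable_minr => //; apply: measurable_funM => //; exact: measurable_l2dist.
apply: le_trans (integral_le_add _ _ mf2 _ _ _ _ _ intf1 intf2 (c := ell^-1)
  (f := fun y : borel_rV R d => \1_(l2ball z (U 0)) y *
       (l2norm (x - y) `^ (- s) * Num.min 1 (l2norm (x - y) / ell)))) _.
- apply: measurable_funM; first exact: measurable_indic_l2ball.
  by apply: measurable_funM => //; exact: measurable_l2dist_powR.
- apply: measurable_funM; first exact: measurable_indic_l2ball.
  by apply: measurable_funM; [exact: measurable_l2dist_powR|exact: measurable_l2dist].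
- move=> y; rewrite !mulr_ge0 ?powR_ge0// le_min ler01/= divr_ge0 ?l2norm_ge0//.
  exact: ltW.
- by move=> y; rewrite !mulr_ge0 ?powR_ge0 ?l2norm_ge0.
- by move=> y; rewrite mulr_ge0 ?powR_ge0.
- by rewrite invr_ge0 ltW.
- move=> y; rewrite /f1 /f2 !indicE.
  case: (boolP (y \in l2ball z (U 0))) => [yU|]; last first.
    rewrite mul0r => _; rewrite addr_ge0 ?mulr_ge0 ?invr_ge0 ?powR_ge0 ?l2norm_ge0//.
    exact: ltW.
  rewrite in_setI yU/= in_setC; case: (boolP (y \in l2ball x a)) => _.
    rewrite /= !mul1r mul0r addr0 mulrC [in leRHS]mulrC -mulrA.
    rewrite mulrC ler_wpM2l ?powR_ge0// ge_min; apply/orP; right; exact: lexx.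
  rewrite /= !mul1r mul0r mulr0 add0r -[leRHS]mulr1 ler_wpM2l ?powR_ge0//.
  by rewrite ge_min lexx.
rewrite lee_fin.
have -> : ell^-1 * (2 * 2 `^ s * Lam * a) = 2 * 2 `^ s * Lam * ka.
  by rewrite /a; field; rewrite gt_eqF.
have h1 : 2 * 2 `^ s * Lam * ka <= c0 / 2.
  apply: (@le_trans _ _ (2 * 2 `^ s * Lam * (c0 / (4 * 2 `^ s * Lam)))).
    by rewrite ler_wpM2l ?ge_min ?lexx ?orbT// !mulr_ge0 ?ltW.
  rewrite le_eqVlt; apply/orP; left; apply/eqP; field.
  by rewrite !gt_eqF.
have h2 : b <= c0 / 2.
  rewrite /b; have -> : ka * l / 8 = ka / 8 * l by ring.
  rewrite (powRM (- s) (ltW _) (ltW l0)) ?divr_gt0//.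
  apply: (@le_trans _ _ (2 * A * ((ka / 8) `^ (- s) * l `^ (- s)) * (th * l `^ s))).
    by rewrite ler_wpM2l// !mulr_ge0 ?powR_ge0// ltW.
  have ls0 : 0 < l `^ s by rewrite powR_gt0.
  rewrite (powRN l) /th le_eqVlt; apply/orP; left; apply/eqP; field.
  by rewrite !gt_eqF.
lra.
Qed.

End BumpRadius.

Section ProductIntegral.
Context {R : realType} {dp : measure_display} {T : measurableType dp}.
Variable m : {sigma_finite_measure set T -> \bar R}.
Implicit Types (f g : T -> R).

Lemma integrable_fineK f : m.-integrable setT (EFin \o f) ->
  (\int[m]_x (f x)%:E = (fine (\int[m]_x (f x)%:E))%:E)%E.
Proof. by move=> mf; rewrite fineK//; exact: integrable_fin_num mf. Qed.

Lemma integrable_tensor f g :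
  m.-integrable setT (EFin \o f) -> m.-integrable setT (EFin \o g) ->
  (m \x m)%E.-integrable setT (fun z => (f z.1 * g z.2)%:E).
Proof.
move=> fi gi.
have mf : measurable_fun setT f by apply/measurable_EFinP; exact: measurable_int fi.
have mg : measurable_fun setT g by apply/measurable_EFinP; exact: measurable_int gi.
apply/integrable12ltyP => /=.
  apply/measurable_EFinP; apply: measurable_funM.
    exact: measurableT_comp mf measurable_fst.
  exact: measurableT_comp mg measurable_snd.
under eq_integral => x _.
  under eq_integral => y _ do rewrite normrM EFinM.
  rewrite ge0_integralZl_EFin//; last first.
    by apply/measurable_EFinP; apply: measurableT_comp mg; exact: normr_measurable.
  over.
have /integrableP[_] := gi; rewrite /= => g1.
have /integrableP[_] := fi; rewrite /= => f1.
have g1f : (\int[m]_y `|g y|%:E)%E \is a fin_num.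
  by rewrite ge0_fin_numE ?integral_ge0//.
rewrite -(fineK g1f) ge0_integralZr//; last 2 first.
- by apply/measurable_EFinP; apply: measurableT_comp mf; exact: normr_measurable.
- by rewrite lee_fin fine_ge0// integral_ge0.
by rewrite lte_mul_pinfty ?integral_ge0// ?ltry// ge0_fin_numE ?integral_ge0.
Qed.

Lemma integral_tensor f g :
  m.-integrable setT (EFin \o f) -> m.-integrable setT (EFin \o g) ->
  fine (\int[(m \x m)%E]_z (f z.1 * g z.2)%:E)%E =
    fine (\int[m]_x (f x)%:E)%E * fine (\int[m]_x (g x)%:E)%E.
Proof.
move=> fi gi; rewrite -(integral12_prod_meas1 (integrable_tensor fi gi)) /fubini_F/=.
under eq_integral => x _.
  under eq_integral => y _ do rewrite EFinM.
  rewrite integralZl// (integrable_fineK gi) -EFinM mulrC EFinM.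
  over.
by rewrite integralZl//= (integrable_fineK fi) -EFinM/= mulrC.
Qed.

Lemma integral_product_sym_le (h : T * T -> R) (A : set T) (w : R) :
  measurable A -> measurable_fun setT h -> (forall z, 0 <= h z) ->
  (forall x, A x -> (\int[m]_y (h (x, y))%:E <= w%:E)%E) ->
  (\int[(m \x m)%E]_z (\1_A z.1 * h z + \1_A z.2 * h (z.2, z.1))%:E
    <= 2%:E * (w%:E * m A))%E.
Proof.
move=> mA mh h0 hw.
have mA0 : measurable_fun setT (\1_A : T -> R) by exact: measurable_indic.
have mA1 : measurable_fun setT (fun z : T * T => \1_A z.1 : R).
  exact: (measurableT_comp mA0 measurable_fst).
have mA2 : measurable_fun setT (fun z : T * T => \1_A z.2 : R).
  exact: (measurableT_comp mA0 measurable_snd).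
have mh' : measurable_fun setT (fun z : T * T => h (z.2, z.1)).
  by apply: (measurableT_comp mh); apply: measurable_fun_pair.
under eq_integral do rewrite EFinD.
rewrite ge0_integralD//; first last.
- by apply/measurable_EFinP; apply: measurable_funM.
- by move=> z _; rewrite lee_fin mulr_ge0.
- by apply/measurable_EFinP; apply: measurable_funM.
- by move=> z _; rewrite lee_fin mulr_ge0.
have inner x : (\int[m]_y (\1_A x * h (x, y))%:E <= (w * \1_A x)%:E)%E.
  rewrite indicE; case: (boolP (x \in A)) => [xA|_].
    by rewrite mulr1; under eq_integral do rewrite mul1r; apply: hw; rewrite inE in xA.
  by rewrite mulr0; under eq_integral do rewrite mul0r; rewrite integral0.
have key : (\int[m]_x \int[m]_y (\1_A x * h (x, y))%:E <= w%:E * m A)%E.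
  (* The sign of [w] is known only through a point of [A]. *)
  have [->|/set0P[x0 Ax0]] := eqVneq A set0.
    under eq_integral => x _.
      under eq_integral => y _ do rewrite indicE in_set0 mul0r.
      rewrite integral0.
      over.
    by rewrite integral0 measure0 mule0.
  have w0 : 0 <= w.
    by rewrite -lee_fin; apply: le_trans (hw x0 Ax0); apply: integral_ge0 => y _; rewrite lee_fin.
  apply: (@le_trans _ _ (\int[m]_x (w * \1_A x)%:E)%E); last first.
    by rewrite integral_Zindic.
  apply: le_integral_nonmeas => x //.
  by apply: integral_ge0 => y _; rewrite lee_fin mulr_ge0.
rewrite -[2%:E]/((1 + 1)%:E) EFinD ge0_muleDl// mul1e leeD//.
- rewrite fubini_tonelli1//.
    by apply/measurable_EFinP; apply: measurable_funM.
  by move=> z; rewrite lee_fin mulr_ge0.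
- rewrite fubini_tonelli2//.
    by apply/measurable_EFinP; apply: measurable_funM.
  by move=> z; rewrite lee_fin mulr_ge0.
Qed.

End ProductIntegral.

Lemma indic_in {R : pzRingType} {T : Type} (A : set T) x : A x -> \1_A x = 1 :> R.
Proof. by move=> Ax; rewrite indicE mem_set. Qed.

Section Bump.
Context {R : realType} {d : nat}.
Variables (z : 'rV[R]_d) (T ell : R).
Hypothesis ell0 : 0 < ell.
Implicit Types x y : 'rV[R]_d.

Definition bump x : R := Num.min 1 (Num.max 0 ((T - l2norm (x - z)) / ell)).

Lemma bump_ge0 x : 0 <= bump x.
Proof. by rewrite le_min ler01 le_max lexx. Qed.

Lemma bump_le1 x : bump x <= 1. Proof. by rewrite ge_min lexx. Qed.

Lemma bump_eq0 x : T <= l2norm (x - z) -> bump x = 0.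
Proof.
move=> h; rewrite /bump max_l; first by rewrite min_r.
by rewrite pmulr_lle0 ?invr_gt0//; lra.
Qed.

Lemma bump_eq1 x : l2norm (x - z) <= T - ell -> bump x = 1.
Proof.
move=> h; rewrite /bump min_l// le_max; apply/orP; right.
by rewrite ler_pdivlMr//; lra.
Qed.

Lemma bump_dist x y : `|bump x - bump y| <= Num.min 1 (l2norm (x - y) / ell).
Proof.
have := ler_l2dist (x - z) (y - z).
have -> : x - z - (y - z) = x - y by rewrite opprB addrA subrK.
move=> h; rewrite le_min; apply/andP; split.
  have := bump_ge0 x; have := bump_ge0 y; have := bump_le1 x; have := bump_le1 y.
  rewrite ler_norml; lra.
rewrite ler_pdivlMr//.
have {}h : `|(T - l2norm (x - z)) - (T - l2norm (y - z))| <= l2norm (x - y).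
  have -> : T - l2norm (x - z) - (T - l2norm (y - z)) =
    l2norm (y - z) - l2norm (x - z) by ring.
  by rewrite distrC.
rewrite /bump; set u := T - _ in h *; set v := T - _ in h *.
have E a : Num.min 1 (Num.max 0 (a / ell)) * ell = Num.min ell (Num.max 0 a).
  rewrite minr_pMl ?(ltW ell0)// maxr_pMl ?(ltW ell0)// mul1r mul0r divfK//.
  by rewrite gt_eqF.
have D (a c : R) : `|a - c| * ell = `|a * ell - c * ell|.
  by rewrite -mulrBl normrM (gtr0_norm ell0).
rewrite D !E; apply: le_trans h.
have := ler_norm (u - v); have := ler_norm (v - u); rewrite (distrC v) => h1 h2.
rewrite ler_norml /Num.min /Num.max.
case: (ltP 0 u) => ?; case: (ltP 0 v) => ?; rewrite ?(lt_gtF ell0);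
  by case: (ltP ell u) => ?; case: (ltP ell v) => ?; apply/andP; split; move: ell0; lra.
Qed.

Lemma continuous_bump : continuous bump.
Proof.
move=> x.
have -> : bump = (cst 1 : 'rV[R]_d -> R^o) \min ((cst 0 : 'rV[R]_d -> R^o) \max
  (fun x => (T - l2norm (x - z)) / ell)) by [].
apply: continuous_min; first exact: cst_continuous.
apply: continuous_max; first exact: cst_continuous.
apply: continuousM; last exact: cst_continuous.
by apply: continuousB; [exact: cst_continuous|exact: continuous_l2dist].
Qed.

End Bump.

Section CorePointwise.
Context {R : realType} {d : nat}.
Variables (s : R) (i : 'I_d).

(* Symmetrizing in [x] and [y] leaves [psi y f x (kt y - K (x - y))].  On the
   core ball the singularity of [K] is cancelled by the Lipschitz bound on [f];
   away from it [kt] approximates [K (x - .)]. *)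
Lemma core_pointwise (f psi kt W2 : 'rV[R]_d -> R) (z : 'rV[R]_d) (T b ell : R) :
  T <= b ->
  (forall x, 0 <= f x <= 1) -> (forall x, f x != 0 -> l2ball z T x) ->
  (forall x y, `|f x - f y| <= Num.min 1 (l2norm (x - y) / ell)) ->
  (forall x, 0 <= psi x <= 1) -> (forall x, l2ball z b x -> psi x = 1) ->
  (forall y, 0 <= W2 y) ->
  (forall y, l2ball z b y -> `|kt y| <= W2 y) ->
  (forall x y, l2ball z T x -> ~ l2ball z b y -> psi y != 0 ->
      `|kt y - riesz_kernel s (x - y) 0 i| <= W2 y) ->
  let W := fun p : 'rV[R]_d * 'rV[R]_d =>
    \1_(l2ball z b) p.2 * (l2norm (p.1 - p.2) `^ (- s) *
      Num.min 1 (l2norm (p.1 - p.2) / ell)) + W2 p.2 in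
  forall p : 'rV[R]_d * 'rV[R]_d,
  `|riesz_kernel s (p.1 - p.2) 0 i * (2^-1 * (f p.2 * psi p.1 - psi p.2 * f p.1)) +
    2^-1 * (f p.1 * (psi p.2 * kt p.2) + f p.2 * (psi p.1 * kt p.1))|
  <= \1_(l2ball z T) p.1 * W p + \1_(l2ball z T) p.2 * W (p.2, p.1).
Proof.
move=> Tb f01 fT fl psi01 psi1 W20 ktW ktK W [x y]; rewrite /W /= {W}.
set K := riesz_kernel s (x - y) 0 i.
have KN : riesz_kernel s (y - x) 0 i = - K.
  by rewrite /K -riesz_kernelN opprB.
set m := l2norm (x - y) `^ (- s) * Num.min 1 (l2norm (x - y) / ell).
have m0 : 0 <= m.
  rewrite mulr_ge0 ?powR_ge0//; apply: le_trans (fl x y); exact: normr_ge0.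
have Km : `|K * (f y - f x)| <= m.
  rewrite normrM ler_pM ?normr_ge0//; first exact: riesz_kernel_le.
  by rewrite distrC.
have mC : l2norm (y - x) `^ (- s) * Num.min 1 (l2norm (y - x) / ell) = m.
  by rewrite /m (l2norm_distC y).
rewrite mC.
have f0 u : ~ l2ball z b u -> f u = 0.
  move=> nb; apply/eqP; apply: contrapT => /negP /fT Tu; apply: nb.
  exact: le_l2ball Tb _ Tu.
have side u v (k : R) : ~ l2ball z b v -> psi v != 0 -> f u != 0 ->
    `|kt v - k| <= W2 v -> `|2^-1 * (f u * (psi v * (kt v - k)))| <= W2 v.
  move=> _ _ _ h; rewrite !normrM.
  rewrite [`|f u|]ger0_norm ?[`|psi v|]ger0_norm//;
    [|by case/andP: (psi01 v)|by case/andP: (f01 u)].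
  rewrite (ger0_norm (_ : 0 <= 2^-1 :> R)) ?invr_ge0//.
  have /andP[? ?] := f01 u; have /andP[? ?] := psi01 v.
  have h1 : psi v * `|kt v - k| <= W2 v.
    by apply: le_trans h; rewrite ler_piMl.
  have h2 : f u * (psi v * `|kt v - k|) <= W2 v.
    by apply: le_trans h1; rewrite ler_piMl// mulr_ge0.
  have : 0 <= f u * (psi v * `|kt v - k|) by rewrite !mulr_ge0.
  lra.
have pos A B : 0 <= \1_(l2ball z T) A * (\1_(l2ball z b) B * m + W2 B).
  by rewrite mulr_ge0// addr_ge0 ?W20// mulr_ge0.
have [xb|xb] := pselect (l2ball z b x); have [yb|yb] := pselect (l2ball z b y).
- rewrite (psi1 x xb) (psi1 y yb) !mul1r !mulr1.
  rewrite (indic_in xb) (indic_in yb) !mul1r.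
  have -> : K * (2^-1 * (f y - f x)) + 2^-1 * (f x * kt y + f y * kt x) =
    2^-1 * (K * (f y - f x) + f x * kt y + f y * kt x) by ring.
  have cx : f x * `|kt y| <= \1_(l2ball z T) x * W2 y.
    have [->|/fT Tx] := eqVneq (f x) 0; first by rewrite mul0r mulr_ge0.
    rewrite (indic_in Tx) mul1r; have /andP[? ?] := f01 x.
    by apply: le_trans (ktW y yb); rewrite ler_piMl.
  have cy : f y * `|kt x| <= \1_(l2ball z T) y * W2 x.
    have [->|/fT Ty] := eqVneq (f y) 0; first by rewrite mul0r mulr_ge0.
    rewrite (indic_in Ty) mul1r; have /andP[? ?] := f01 y.
    by apply: le_trans (ktW x xb); rewrite ler_piMl.
  have ck : `|K * (f y - f x)| <= (\1_(l2ball z T) x + \1_(l2ball z T) y) * m.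
    have [fx|/fT Tx] := eqVneq (f x) 0; have [fy|/fT Ty] := eqVneq (f y) 0.
    + by rewrite fx fy subr0 mulr0 normr0 mulr_ge0// addr_ge0.
    + by apply: (le_trans Km); rewrite ler_peMl// (indic_in Ty) lerDr.
    + by apply: (le_trans Km); rewrite ler_peMl// (indic_in Tx) lerDl.
    + by apply: (le_trans Km); rewrite ler_peMl// (indic_in Tx) lerDl.
  rewrite normrM (ger0_norm (_ : 0 <= 2^-1 :> R)) ?invr_ge0//.
  have := ler_normD (K * (f y - f x) + f x * kt y) (f y * kt x).
  have := ler_normD (K * (f y - f x)) (f x * kt y).
  rewrite (normrM (f x)) (normrM (f y)).
  have fx0 : 0 <= f x by case/andP: (f01 x).
  have fy0 : 0 <= f y by case/andP: (f01 y).
  rewrite (ger0_norm fx0) (ger0_norm fy0).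
  have p1 : 0 <= \1_(l2ball z T) x * W2 y by rewrite mulr_ge0.
  have p2 : 0 <= \1_(l2ball z T) y * W2 x by rewrite mulr_ge0.
  have p3 : 0 <= \1_(l2ball z T) x * m by rewrite mulr_ge0.
  have p4 : 0 <= \1_(l2ball z T) y * m by rewrite mulr_ge0.
  lra.
- rewrite (f0 y yb) !mul0r addr0 sub0r.
  have -> : K * (2^-1 * - (psi y * f x)) + 2^-1 * (f x * (psi y * kt y)) =
    2^-1 * (f x * (psi y * (kt y - K))) by ring.
  apply: (@le_trans _ _ (\1_(l2ball z T) x * (\1_(l2ball z b) y * m + W2 y)));
    last by rewrite lerDl.
  have [->|py] := eqVneq (psi y) 0; first by rewrite mul0r !mulr0 normr0.
  have [->|fx] := eqVneq (f x) 0; first by rewrite mul0r !mulr0 normr0.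
  rewrite (indic_in (fT _ fx)) mul1r.
  apply: (@le_trans _ _ (W2 y)); last by rewrite lerDr mulr_ge0.
  by apply: side => //; apply: ktK => //; exact: fT.
- rewrite (f0 x xb) mulr0 mul0r subr0 add0r.
  have -> : K * (2^-1 * (f y * psi x)) + 2^-1 * (f y * (psi x * kt x)) =
    2^-1 * (f y * (psi x * (kt x - - K))) by ring.
  apply: (@le_trans _ _ (\1_(l2ball z T) y * (\1_(l2ball z b) x * m + W2 x)));
    last by rewrite lerDr.
  have [->|py] := eqVneq (psi x) 0; first by rewrite mul0r !mulr0 normr0.
  have [->|fx] := eqVneq (f y) 0; first by rewrite mul0r !mulr0 normr0.
  rewrite (indic_in (fT _ fx)) mul1r.
  apply: (@le_trans _ _ (W2 x)); last by rewrite lerDr mulr_ge0.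
  by apply: side => //; rewrite -KN; apply: ktK => //; exact: fT.
- rewrite (f0 x xb) (f0 y yb) !mul0r mulr0 subrr !mulr0 addr0 mulr0 addr0 normr0.
  exact: addr_ge0.
Qed.

End CorePointwise.

Section CoreIntegral.
Context {R : realType} {d : nat}.
Variables (s : R) (i : 'I_d) (m : {sigma_finite_measure set (borel_rV R d) -> \bar R}).
Local Notation B := (borel_rV R d).

Lemma measurable_prod_diff (j : 'I_d) :
  measurable_fun setT (fun p : B * B => (p.1 - p.2 : 'rV[R]_d) 0 j).
Proof.
have -> : (fun p : B * B => (p.1 - p.2 : 'rV[R]_d) 0 j) =
    (fun p : B * B => (p.1 : 'rV[R]_d) 0 j - (p.2 : 'rV[R]_d) 0 j).
  by apply/funext => p; rewrite !mxE.
apply: measurable_funB.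
  exact: (measurableT_comp (@measurable_coord R d j) measurable_fst).
exact: (measurableT_comp (@measurable_coord R d j) measurable_snd).
Qed.

Lemma measurable_prod_l2dist :
  measurable_fun setT (fun p : B * B => l2norm (p.1 - p.2 : 'rV[R]_d)).
Proof. by apply: measurable_l2norm => j; exact: measurable_prod_diff. Qed.

Lemma measurable_prod_kernel :
  measurable_fun setT (fun p : B * B => riesz_kernel s (p.1 - p.2 : 'rV[R]_d) 0 i).
Proof.
have -> : (fun p : B * B => riesz_kernel s (p.1 - p.2 : 'rV[R]_d) 0 i) =
    (fun p : B * B => (p.1 - p.2 : 'rV[R]_d) 0 i *
       l2norm (p.1 - p.2 : 'rV[R]_d) `^ (- (s + 1))).
  by apply/funext => p; rewrite riesz_kernelE.
apply: measurable_funM; first exact: measurable_prod_diff.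
apply: (measurableT_comp (measurable_powR _)); exact: measurable_prod_l2dist.
Qed.

(** The pairing integrand [P] is singular, so its integrability is a conclusion. [Q] is a
    symmetrized tensor product, integrable with integral the product of the two one-variable
    integrals, and [P + Q] is dominated by the symmetric majorant of [core_pointwise]. Then
    [P = (P + Q) - Q] is integrable, and the estimate is the bound on [P + Q]. *)
Lemma core_integral (f psi kt W2 : 'rV[R]_d -> R) (z : 'rV[R]_d) (T b ell w : R) :
  T <= b ->
  measurable_fun setT (f : B -> R) -> measurable_fun setT (psi : B -> R) ->
  measurable_fun setT (kt : B -> R) -> measurable_fun setT (W2 : B -> R) ->
  m.-integrable setT (EFin \o f) ->
  m.-integrable setT (EFin \o (fun x => psi x * kt x)) ->
  m (l2ball z T) \is a fin_num ->
  (forall x, 0 <= f x <= 1) -> (forall x, f x != 0 -> l2ball z T x) ->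
  (forall x y, `|f x - f y| <= Num.min 1 (l2norm (x - y) / ell)) ->
  (forall x, 0 <= psi x <= 1) -> (forall x, l2ball z b x -> psi x = 1) ->
  (forall y, 0 <= W2 y) ->
  (forall y, l2ball z b y -> `|kt y| <= W2 y) ->
  (forall x y, l2ball z T x -> ~ l2ball z b y -> psi y != 0 ->
      `|kt y - riesz_kernel s (x - y) 0 i| <= W2 y) ->
  0 <= w ->
  (forall x, l2ball z T x ->
    (\int[m]_y (\1_(l2ball z b) y * (l2norm (x - y) `^ (- s) *
      Num.min 1 (l2norm (x - y) / ell)) + W2 y)%:E <= w%:E)%E) ->
  let P := fun p : B * B =>
    riesz_kernel s (p.1 - p.2) 0 i * (2^-1 * (f p.2 * psi p.1 - psi p.2 * f p.1)) in
  (m \x m)%E.-integrable setT (EFin \o P) /\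
  `|fine (\int[(m \x m)%E]_p (P p)%:E)%E +
    fine (\int[m]_x (f x)%:E)%E * fine (\int[m]_x (psi x * kt x)%:E)%E|
    <= 2 * (w * fine (m (l2ball z T))).
Proof.
move=> Tb mf mpsi mkt mW2 fi gi mfin f01 fT fl psi01 psi1 W20 ktW ktK w0 Ww P.
pose g x := psi x * kt x.
pose Q (p : B * B) := 2^-1 * (f p.1 * g p.2 + f p.2 * g p.1).
pose W (p : B * B) := \1_(l2ball z b) p.2 * (l2norm (p.1 - p.2) `^ (- s) *
      Num.min 1 (l2norm (p.1 - p.2) / ell)) + W2 p.2.
have m1 (h : B -> R) : measurable_fun setT h -> measurable_fun setT (fun p : B * B => h p.1).
  by move=> mh; exact: (measurableT_comp mh measurable_fst).
have m2 (h : B -> R) : measurable_fun setT h -> measurable_fun setT (fun p : B * B => h p.2).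
  by move=> mh; exact: (measurableT_comp mh measurable_snd).
have mP : measurable_fun setT P.
  apply: measurable_funM; first exact: measurable_prod_kernel.
  apply: measurable_funM => //; apply: measurable_funB; apply: measurable_funM.
  - exact: m2.
  - exact: m1.
  - exact: m2.
  - exact: m1.
have mW : measurable_fun setT W.
  apply: measurable_funD; last exact: m2.
  apply: measurable_funM; first by apply: (m2 (\1_(l2ball z b))); exact: measurable_indic_l2ball.
  apply: measurable_funM.
    apply: (measurableT_comp (measurable_powR _)); exact: measurable_prod_l2dist.
  apply: measurable_minr => //; apply: measurable_funM => //; exact: measurable_prod_l2dist.
have W0 p : 0 <= W p.
  rewrite addr_ge0// !mulr_ge0 ?powR_ge0//; apply: le_trans (fl p.1 p.2).
  exact: normr_ge0.
have Q1 := integrable_tensor fi gi.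
have Q2 := integrable_tensor gi fi.
have Qi : (m \x m)%E.-integrable setT (EFin \o Q).
  have -> : EFin \o Q = (fun p => (2^-1)%:E *
      ((f p.1 * g p.2)%:E + (g p.1 * f p.2)%:E))%E.
    by apply/funext => p; rewrite /Q /= -EFinD -EFinM (mulrC (f p.2)).
  by apply: integrableZl => //; exact: integrableD.
have QE : fine (\int[(m \x m)%E]_p (Q p)%:E)%E =
    fine (\int[m]_x (f x)%:E)%E * fine (\int[m]_x (g x)%:E)%E.
  transitivity (fine (\int[(m \x m)%E]_p ((2^-1)%:E *
      ((f p.1 * g p.2)%:E + (g p.1 * f p.2)%:E)))%E).
    congr fine; apply: eq_integral => p _.
    by rewrite /Q -EFinD -EFinM (mulrC (f p.2)).
  rewrite integralZl//; last exact: integrableD.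
  rewrite integralD// fineM//; last first.
    by rewrite fin_numD !integrable_fin_num.
  rewrite fineD ?integrable_fin_num// /= !integral_tensor//; lra.
pose N p := P p + Q p.
have NW p : `|N p| <= \1_(l2ball z T) p.1 * W p + \1_(l2ball z T) p.2 * W (p.2, p.1).
  exact: core_pointwise.
have mQ : measurable_fun setT Q by apply/measurable_EFinP; exact: measurable_int Qi.
have mN : measurable_fun setT N by exact: measurable_funD.
have intN : (\int[(m \x m)%E]_p `|N p|%:E <= (2 * (w * fine (m (l2ball z T))))%:E)%E.
  apply: (@le_trans _ _ (\int[(m \x m)%E]_p (\1_(l2ball z T) p.1 * W p +
     \1_(l2ball z T) p.2 * W (p.2, p.1))%:E)%E).
    by apply: le_integral_nonmeas => p //; rewrite lee_fin.
  rewrite !EFinM fineK//; apply: integral_product_sym_le => //.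
  exact: measurable_l2ball.
have Ni : (m \x m)%E.-integrable setT (EFin \o N).
  apply/integrableP; split; first exact/measurable_EFinP.
  by apply: (le_lt_trans intN); rewrite ltry.
have PNQ : EFin \o P = ((EFin \o N) \- (EFin \o Q))%E.
  by apply/funext => p; rewrite /= /N -EFinB addrK.
have Pi : (m \x m)%E.-integrable setT (EFin \o P).
  by rewrite PNQ; exact: integrableB.
split => //.
rewrite -QE -fineD ?integrable_fin_num// -integralD//.
apply: integral_abs_le => //.
by rewrite mulr_ge0// mulr_ge0// fine_ge0.
Qed.

End CoreIntegral.

(** * Comparison of the kernels and decay at infinity *)

Section KernelCompare.
Context {R : realType} {d : nat}.
Variables (s : R) (i : 'I_d).
Hypothesis s0 : 0 < s.
Implicit Types x y z : 'rV[R]_d.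

(** Here [z] is a grid point and [z'] a support point close to it. Within distance [e] of [z] the
    two kernels are not compared but bounded separately, half a power of the distance being traded
    for [e^(1/2)]. Beyond [e] the Riesz kernel is first moved from [x] to [z] and then smoothed,
    which gives the two terms of [C2]. *)
Lemma kernel_compare (z z' : 'rV[R]_d) (T l e tau : R) :
  0 < l -> T <= l / 2 -> l <= tau -> 2 * l <= e -> l2norm (z' - z) < l ->
  let C1 := (7 `^ s + 1) * e `^ 2^-1 in
  let C2 := (s + 2) * (2 * l) * (e / 7) `^ (- (s + 1)) +
            (s + 1) / 2 * tau ^+ 2 * e `^ (- (s + 2)) in
  let W y := C1 * Num.max (l2norm (z - y)) l `^ (- (s + 2^-1)) + C2 in
  (forall y, l2ball z' (3 / 4 * l) y -> `|smooth_kernel s tau (z - y) i| <= W y) /\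
  (forall x y, l2ball z' T x -> ~ l2ball z' (3 / 4 * l) y ->
    `|smooth_kernel s tau (z - y) i - riesz_kernel s (x - y) 0 i| <= W y).
Proof.
move=> l0 Tl lt le zz C1 C2 W.
have e0 : 0 < e by lra.
have C20 : 0 <= C2.
  by rewrite addr_ge0// !mulr_ge0 ?powR_ge0 ?sqr_ge0//; move: s0 l0; lra.
have q0 : 0 <= s + 2^-1 by move: s0; lra.
have near y : let M := Num.max (l2norm (z - y)) l in M <= e ->
    [/\ 0 < M, `|smooth_kernel s tau (z - y) i| <= e `^ 2^-1 * M `^ (- (s + 2^-1))
      & M `^ (- s) <= e `^ 2^-1 * M `^ (- (s + 2^-1))].
  move=> M Me; have M0 : 0 < M by rewrite lt_max l0 orbT.
  have Ms : M `^ (- s) <= e `^ 2^-1 * M `^ (- (s + 2^-1)).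
    have -> : - s = 2^-1 + - (s + 2^-1) by lra.
    rewrite [leLHS]powRD_gt0// ler_wpM2r ?powR_ge0//.
    by rewrite ge0_ler_powR ?invr_ge0// nnegrE ltW.
  split => //; apply: le_trans Ms; apply: smooth_kernel_le => //.
  have n0 := l2norm_ge0 (z - y); have t2 := sqr_ge0 tau.
  rewrite /M /Num.max; case: ltP => _; last by rewrite lerDl.
  have : l ^+ 2 <= tau ^+ 2 by rewrite lerXn2r ?nnegrE//; lra.
  have := sqr_ge0 (l2norm (z - y)); lra.
have zy y : l2norm (z - y) <= l2norm (y - z') + l2norm (z' - z).
  have := ler_l2normD (y - z') (z' - z); rewrite addrA subrK.
  by rewrite (l2norm_distC z y).
have W0 y : C1 * Num.max (l2norm (z - y)) l `^ (- (s + 2^-1)) =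
   7 `^ s * (e `^ 2^-1 * Num.max (l2norm (z - y)) l `^ (- (s + 2^-1))) +
   e `^ 2^-1 * Num.max (l2norm (z - y)) l `^ (- (s + 2^-1)).
  by rewrite /C1; ring.
have P0 y : 0 <= e `^ 2^-1 * Num.max (l2norm (z - y)) l `^ (- (s + 2^-1)).
  by rewrite mulr_ge0 ?powR_ge0.
have P70 y : 0 <= 7 `^ s * (e `^ 2^-1 * Num.max (l2norm (z - y)) l `^ (- (s + 2^-1))).
  by rewrite mulr_ge0 ?powR_ge0 ?P0.
split => [y|x y].
  rewrite /l2ball/= => yz; have Me : Num.max (l2norm (z - y)) l <= e.
    by rewrite ge_max; have := zy y; move=> ?; apply/andP; split; lra.
  have [M0 h _] := near y Me; apply: (le_trans h); rewrite /W W0.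
  have := P70 y; have := C20; lra.
rewrite /l2ball/= => xz /negP; rewrite -leNgt => yz.
set M := Num.max (l2norm (z - y)) l.
have xy : l2norm (y - z') - l2norm (x - z') <= l2norm (x - y).
  have := ler_l2normD (y - x) (x - z'); rewrite addrA subrK (l2norm_distC y x); lra.
(* With [u = |y - z'| >= 3/4 l] one has [M <= u + l] and [|x - y| >= u - l / 2]; the ratio of these
   bounds is largest at [u = 3/4 l], where it is 7. *)
have M7 : M / 7 <= l2norm (x - y).
  by rewrite ler_pdivrMr// ge_max; have := zy y => ?; apply/andP; split; lra.
have M0 : 0 < M by rewrite lt_max l0 orbT.
have M70 : 0 < M / 7 by rewrite divr_gt0.
have [Me|eM] := leP M e.
  have [_ h1 h2] := near y Me.
  have h3 : `|riesz_kernel s (x - y) 0 i| <= 7 `^ s * (e `^ 2^-1 * M `^ (- (s + 2^-1))).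
    apply: (le_trans (riesz_kernel_le _ _ _)).
    apply: (le_trans (ger_powRN M70 M7 (ltW s0))).
    rewrite powRM ?invr_ge0 ?(ltW M0)// powRVN// mulrC.
    by rewrite ler_wpM2l ?powR_ge0.
  apply: (le_trans (ler_normB _ _)); rewrite /W W0 -/M.
  lra.
have eM' : e <= l2norm (z - y).
  by move: eM; rewrite lt_max => /orP[/ltW//|]; lra.
have h1 := riesz_smooth_kernel_dist s0 tau i e0 eM'.
have h2 : `|riesz_kernel s (z - y) 0 i - riesz_kernel s (x - y) 0 i| <=
   (s + 2) * (2 * l) * (e / 7) `^ (- (s + 1)).
  have e70 : 0 < e / 7 by rewrite divr_gt0.
  have e7y : e / 7 <= l2norm (x - y).
    by apply: le_trans M7; rewrite ler_pM2r// ltW.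
  have e7z : e / 7 <= l2norm (z - y) by apply: le_trans eM'; lra.
  apply: (le_trans (riesz_kernel_lip s0 i e70 e7z e7y)).
  rewrite ler_wpM2r ?powR_ge0// ler_wpM2l//; first by move: s0; lra.
  have -> : z - y - (x - y) = z - x by rewrite opprB addrA subrK.
  have := ler_l2normD (z - z') (z' - x); rewrite addrA subrK.
  rewrite (l2norm_distC z z') (l2norm_distC z' x); lra.
have -> : smooth_kernel s tau (z - y) i - riesz_kernel s (x - y) 0 i =
   (riesz_kernel s (z - y) 0 i - riesz_kernel s (x - y) 0 i) -
   (riesz_kernel s (z - y) 0 i - smooth_kernel s tau (z - y) i) by ring.
apply: (le_trans (ler_normB _ _)).
have := P70 y; have := P0 y; rewrite /W W0 /C2; lra.
Qed.

End KernelCompare.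

Section Tail.
Context {R : realType} {d : nat}.
Variables (s Lam : R) (i : 'I_d) (mu : {measure set (borel_rV R d) -> \bar R}).
Hypotheses (s0 : 0 < s) (Lam0 : 0 < Lam) (nm : nice s Lam mu).
Local Notation B := (borel_rV R d).

Lemma measurable_kernel_r (x : 'rV[R]_d) :
  measurable_fun setT (fun y : B => riesz_kernel s (x - y) 0 i).
Proof.
have -> : (fun y : B => riesz_kernel s (x - y) 0 i) =
    (fun y : B => (x 0 i - (y : 'rV[R]_d) 0 i) * l2norm (x - y) `^ (- (s + 1))).
  by apply/funext => y; rewrite riesz_kernelE !mxE.
apply: measurable_funM; last exact: measurable_l2dist_powR.
by apply: measurable_funB => //; exact: measurable_coord.
Qed.

(* As [f] has mean zero, the transform decays one power faster than the kernel. *)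
Lemma riesz_tail (f psi : 'rV[R]_d -> R) (x0 : 'rV[R]_d) (r rho Cw : R) :
  0 < r -> 6 * r <= rho -> 0 <= Cw ->
  mu.-integrable setT (EFin \o (f : B -> R)) -> (\int[mu]_x (f x)%:E = 0)%E ->
  (\int[mu]_x `|f x|%:E <= Cw%:E)%E ->
  (forall y, f y != 0 -> l2ball x0 (3 * r) y) ->
  (forall x, 0 <= psi x <= 1) -> (forall x, l2ball x0 rho x -> psi x = 1) ->
  `|fine (\int[mu]_x (riesz_transform s mu f x 0 i * (1 - psi x))%:E)%E| <=
    (s + 2) * 3 * 2 `^ (s + 1) * Cw * (2 * 2 `^ s * Lam) * (r / rho).
Proof.
move=> r0 rho6 Cw0 fi f0 fC fB psi01 psi1.
have rho0 : 0 < rho by lra.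
have s2 : 0 <= s + 2 by move: s0; lra.
pose C := (s + 2) * (3 * r) * 2 `^ (s + 1) * Cw.
have C0 : 0 <= C by rewrite !mulr_ge0 ?powR_ge0 ?(ltW r0).
have mf : measurable_fun setT (f : B -> R) by apply/measurable_EFinP; exact: measurable_int fi.
have key x : rho <= l2norm (x0 - x) ->
    `|riesz_transform s mu f x 0 i| <= C * l2norm (x0 - x) `^ (- (s + 1)).
  move=> xrho; rewrite mxE.
  pose k := riesz_kernel s (x - x0) 0 i.
  pose c := (s + 2) * (3 * r) * (l2norm (x0 - x) / 2) `^ (- (s + 1)).
  have c0 : 0 <= c by rewrite !mulr_ge0 ?powR_ge0 ?(ltW r0).
  pose D (y : B) := (riesz_kernel s (x - y) 0 i - k) * f y.
  have Dle y : `|D y| <= c * `|f y|.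
    rewrite /D normrM; have [->|/fB] := eqVneq (f y) 0; first by rewrite normr0 !mulr0.
    rewrite /l2ball/= => y3; rewrite ler_wpM2r//.
    (* As [rho >= 6 r], the support of [f] reaches at most half of the way from [x0] to [x]; the
       factor [2^(s+1)] in the constant comes from this halving. *)
    have n0 : 0 < l2norm (x0 - x) / 2 by lra.
    have h1 : l2norm (x0 - x) / 2 <= l2norm (x - x0) by rewrite (l2norm_distC x); lra.
    have h2 : l2norm (x0 - x) / 2 <= l2norm (x - y).
      have := ler_l2normD (x - y) (y - x0); rewrite addrA subrK (l2norm_distC x x0); lra.
    apply: (le_trans (riesz_kernel_lip s0 i n0 h2 h1)).
    rewrite ler_wpM2r ?powR_ge0// ler_wpM2l//.
    have -> : x - y - (x - x0) = x0 - y by rewrite opprB addrC addrA subrK.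
    by rewrite l2norm_distC ltW.
  have mD : measurable_fun setT D.
    apply: measurable_funM => //; apply: measurable_funB => //.
    exact: measurable_kernel_r.
  have fai : mu.-integrable setT (fun y => (c * `|f y|)%:E).
    have -> : (fun y : B => (c * `|f y|)%:E) = (fun y => c%:E * `|(EFin \o f) y|)%E.
      by apply/funext => y.
    by apply: integrableZl => //; exact: integrable_abse.
  have Di : mu.-integrable setT (EFin \o D).
    apply: le_integrable fai => //; first exact/measurable_EFinP.
    by move=> y _; rewrite /= lee_fin (ger0_norm (mulr_ge0 c0 (normr_ge0 _))).
  have kfi : mu.-integrable setT (fun y => k%:E * (f y)%:E)%E by exact: integrableZl.
  have -> : (\int[mu]_y (riesz_kernel s (x - y) 0 i * f y)%:E = \int[mu]_y (D y)%:E)%E.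
    transitivity (\int[mu]_y ((D y)%:E + k%:E * (f y)%:E))%E.
      by apply: eq_integral => y _; rewrite -EFinM -EFinD /D; congr EFin; ring.
    by rewrite integralD// integralZl// f0 mule0 adde0.
  have -> : C * l2norm (x0 - x) `^ (- (s + 1)) = c * Cw.
    rewrite /C /c powRM ?l2norm_ge0 ?invr_ge0// powRVN//; ring.
  apply: integral_abs_le; first by rewrite mulr_ge0.
  apply: (@le_trans _ _ (\int[mu]_y (c * `|f y|)%:E)%E).
    by apply: le_integral_nonmeas => y; rewrite ?lee_fin.
  under eq_integral do rewrite EFinM.
  rewrite ge0_integralZl_EFin//; last first.
    by apply/measurable_EFinP; apply: measurableT_comp mf; exact: normr_measurable.
  by rewrite [leRHS]EFinM lee_wpmul2l// lee_fin.
have -> : (s + 2) * 3 * 2 `^ (s + 1) * Cw * (2 * 2 `^ s * Lam) * (r / rho) =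
   C * (2 * 2 `^ s * Lam / rho).
  by rewrite /C; field; rewrite gt_eqF.
have B0 : 0 <= 2 * 2 `^ s * Lam / rho.
  by rewrite divr_ge0 ?mulr_ge0 ?powR_ge0 ?(ltW Lam0) ?(ltW rho0).
apply: integral_abs_le; first by rewrite mulr_ge0.
pose h (x : B) := \1_(~` l2ball x0 rho) x * l2norm (x0 - x) `^ (- (s + 1)).
apply: (@le_trans _ _ (\int[mu]_x (C * h x)%:E)%E).
  apply: le_integral_nonmeas => x; rewrite lee_fin// /h normrM.
  have [xb|xb] := pselect (l2ball x0 rho x).
    by rewrite (psi1 x xb) subrr normr0 mulr0 (mulr_ge0 C0)// mulr_ge0 ?powR_ge0.
  rewrite (@indic_in _ _ (~` l2ball x0 rho))// mul1r.
  have xrho : rho <= l2norm (x0 - x) by rewrite l2norm_distC leNgt; exact/negP.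
  apply: le_trans (key x xrho); rewrite ler_piMr//.
  by have := psi01 x; rewrite ler_norml; lra.
have mh : measurable_fun setT h.
  apply: measurable_funM; last exact: measurable_l2dist_powR.
  by apply: measurable_indic; apply: measurableC; exact: measurable_l2ball.
under eq_integral do rewrite EFinM.
rewrite ge0_integralZl_EFin//; last 2 first.
- by move=> x _; rewrite lee_fin mulr_ge0 ?powR_ge0.
- exact/measurable_EFinP.
by rewrite [leRHS]EFinM lee_wpmul2l ?lee_fin//; exact: nice_integral_far.
Qed.

End Tail.

(** * The discrete divergence theorem *)

Section DivergenceLower.
Context {R : realType} {d : nat}.
Variable s : R.
Hypothesis s0 : 0 < s.
Implicit Types (x y : 'rV[R]_d).
Let p := (s + 1) / 2.

Lemma l2norm_shift x (i : 'I_d) h :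
  l2norm (x + h *: delta_mx 0 i) ^+ 2 = l2norm x ^+ 2 + 2 * x 0 i * h + h ^+ 2.
Proof.
rewrite !sqr_l2norm (bigD1 i)//= [in RHS](bigD1 i)//= !mxE !eqxx/= mulr1.
rewrite (eq_bigr (fun j => x 0 j ^+ 2)); first by ring.
by move=> j ji; rewrite !mxE eqxx (negbTE ji)/= mulr0 addr0.
Qed.

(** The derivative of the [i]-th component along the [i]-th axis is [D^(-(p+1)) (D - 2 p x_i^2)].
    The errors are kept proportional to [D] and to powers of the scale-invariant ratio [h / t], so
    that they can be absorbed uniformly in [x]. *)
Lemma smooth_kernel_shift_lower x (i : 'I_d) (h t D : R) : 0 < t -> 0 < h -> h / t <= 1 / 4 ->
  D = l2norm x ^+ 2 + t ^+ 2 ->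
  h * D `^ (- (p + 1)) * (D - 2 * p * x 0 i ^+ 2 * (1 - 2 * (h / t)) `^ (- (p + 1))
     - 5 / 2 * p * (h / t) * D)
  <= smooth_kernel s t (x + h *: delta_mx 0 i) i - smooth_kernel s t x i.
Proof.
move=> t0 h0 e4 DE; set e := h / t in e4 *.
have p0 : 0 < p by rewrite /p; move: s0; lra.
have e0 : 0 < e by rewrite divr_gt0.
have hE : h = e * t by rewrite /e divfK// gt_eqF.
rewrite /smooth_kernel l2norm_shift -/p !mxE !eqxx/= mulr1.
clearbody p.
set u := x 0 i.
have u2 : u ^+ 2 <= l2norm x ^+ 2.
  rewrite sqr_l2norm (bigD1 i)//= lerDl sumr_ge0// => j _; exact: sqr_ge0.
have t20 : 0 < t ^+ 2 by rewrite exprn_gt0.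
have D0 : 0 < D by rewrite DE ltr_wpDl ?sqr_ge0.
have tD : t ^+ 2 <= D by rewrite DE lerDr sqr_ge0.
have uD : u ^+ 2 + t ^+ 2 <= D by rewrite DE lerD2r.
set v := 2 * u * h + h ^+ 2.
have -> : l2norm x ^+ 2 + 2 * u * h + h ^+ 2 + t ^+ 2 = D + v by rewrite DE /v; ring.
rewrite -DE.
(* Since [2 |u| t <= u^2 + t^2 <= D], the shift changes [D] by at most [2 e D]. *)
have uh : `|u| * h <= e * D / 2.
  rewrite hE; have := sqr_ge0 (`|u| - t); rewrite sqrrB real_normK ?num_real// => Hs.
  have : `|u| * t <= D / 2 by lra.
  move=> /(ler_wpM2l (ltW e0)); lra.
have h2 : h ^+ 2 <= e * D.
  rewrite hE exprMn expr2 -mulrA ler_wpM2l ?(ltW e0)//.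
  apply: le_trans tD; rewrite ler_piMl ?(ltW t20)//; lra.
have vle : `|v| <= 2 * e * D.
  apply: (le_trans (ler_normD _ _)); rewrite !normrM (gtr0_norm h0) -?expr2.
  rewrite (ger0_norm (_ : 0 <= 2 :> R))//; lra.
have Dv : (1 - 2 * e) * D <= D + v.
  by move: vle; rewrite ler_norml; lra.
have q0 : 0 < 1 - 2 * e by lra.
have Dv0 : 0 < D + v by apply: lt_le_trans Dv; rewrite mulr_gt0.
have T1 := powRN_tangent D0 Dv0 (ltW p0).
have T2 := powRN_tangent Dv0 D0 (ltW p0).
have E1 : D `^ (- p) = D `^ (- (p + 1)) * D.
  by rewrite opprD powRB1_gt0// divfK// gt_eqF.
have E2 : - p - 1 = - (p + 1) by ring.
rewrite E2 in T1 T2.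
have Q1 : (D + v) `^ (- (p + 1)) <= D `^ (- (p + 1)) * (1 - 2 * e) `^ (- (p + 1)).
  rewrite mulrC -powRM ?(ltW q0) ?(ltW D0)//; apply: ger_powRN => //; first by rewrite mulr_gt0.
  lra.
have Qge1 : 1 <= (1 - 2 * e) `^ (- (p + 1)).
  rewrite -[leLHS](congr1 (@^~ (- (p + 1))) (@powR1 R)) /=; apply: ger_powRN => //; lra.
set A := D `^ (- (p + 1)) in E1 T1 Q1 *.
set Q := (1 - 2 * e) `^ _ in Q1 Qge1 *.
have A0 : 0 < A by rewrite powR_gt0.
set B := (D + v) `^ (- (p + 1)) in T2 Q1.
have B0 : 0 < B by rewrite powR_gt0.
set X := (D + v) `^ (- p) in T1 T2 *.
rewrite E1 in T1 T2 *.
have X1 : A * (D - 2 * p * e * D) <= X.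
  have : p * A * v <= p * A * (2 * e * D).
    apply: ler_wpM2l; first by rewrite mulr_ge0 ?ltW.
    by move: vle; rewrite ler_norml; lra.
  lra.
have X2 : - (2 * p * u ^+ 2 * Q * (A * h)) - p * e * D / 2 * (A * h) <= u * (X - A * D).
  have pAh : 0 <= p * A * h by rewrite !mulr_ge0 ?ltW.
  (* The sign of [u] decides which tangent serves: the one at [D] bounds [X - A * D] from below, the
     one at [D + v] from above. The latter costs the factor [Q], which controls the variation of
     [D^(-(p+1))] along the shift. *)
  have [u0|u0] := leP 0 u.
    have H : - (p * A * v) <= X - A * D by lra.
    have := ler_wpM2l u0 H; rewrite (ger0_norm u0) in uh.
    have h1 : p * A * h * (u * h) <= p * A * h * (e * D / 2) by apply: ler_wpM2l.
    have h3 : p * A * h * (2 * u ^+ 2) <= p * A * h * (2 * u ^+ 2) * Q.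
      by rewrite ler_peMr// mulr_ge0// mulr_ge0 ?sqr_ge0.
    rewrite /v; lra.
  have H : X - A * D <= - (p * B * v) by lra.
  have := ler_wpM2l (_ : 0 <= - u) H; rewrite oppr_ge0 => /(_ (ltW u0)).
  have h1 : p * (2 * u ^+ 2) * h * B <= p * (2 * u ^+ 2) * h * (A * Q).
    by rewrite ler_wpM2l// mulr_ge0 ?(ltW h0)// mulr_ge0 ?(ltW p0)// mulr_ge0 ?sqr_ge0.
  have h3 : 0 <= p * B * (- u * h ^+ 2).
    by rewrite !mulr_ge0 ?sqr_ge0 ?oppr_ge0 ?ltW.
  have h4 : 0 <= p * e * D / 2 * (A * h).
    have Ah : 0 <= A * h by exact: mulr_ge0 (ltW A0) (ltW h0).
    by rewrite (mulr_ge0 _ Ah)// divr_ge0// (mulr_ge0 (mulr_ge0 (ltW p0) (ltW e0)) (ltW D0)).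
  rewrite /v; lra.
have X3 := ler_wpM2l (ltW h0) X1.
lra.
Qed.

(** The first summand bounds [(s + 1) (Q - 1)] per unit of [h / t], using that [1 - 2 h / t >= 1/2];
    the second collects the remaining error of each of the [d] coordinates. *)
Definition div_error_cst : R :=
  (s + 1) * (2 * (p + 1) * 2 `^ (p + 2)) + 5 / 2 * p * d%:R.

(** As [2 p = s + 1], the principal parts add up to [d D - (s + 1) |x|^2 = d t^2 + (d - 1 - s)
    |x|^2]. This is where the threshold [d - 1] originates: for [s <= d - 1] both coefficients are
    nonnegative. *)
Lemma smooth_kernel_div_lower x (h t D : R) : 0 < t -> 0 < h -> h / t <= 1 / 4 ->
  D = l2norm x ^+ 2 + t ^+ 2 ->
  h * D `^ (- (p + 1)) *
    (d%:R * t ^+ 2 + (d%:R - 1 - s) * l2norm x ^+ 2 - div_error_cst * (h / t) * D)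
  <= \sum_(i < d) (smooth_kernel s t (x + h *: delta_mx 0 i) i - smooth_kernel s t x i).
Proof.
move=> t0 h0 e4 DE.
apply: le_trans (ler_sum _ (fun i _ => smooth_kernel_shift_lower i t0 h0 e4 DE)).
rewrite -mulr_sumr.
set e := h / t; set Q := (1 - 2 * e) `^ _.
have p0 : 0 < p by rewrite /p; move: s0; lra.
have e0 : 0 < e by rewrite divr_gt0.
have D0 : 0 <= D by rewrite DE addr_ge0 ?sqr_ge0.
apply: ler_wpM2l; first by rewrite mulr_ge0 ?powR_ge0// ltW.
rewrite !sumrB !sumr_const card_ord -mulr_suml -mulr_sumr -sqr_l2norm.
have E : 2 * p = s + 1 by rewrite /p; field.
rewrite /div_error_cst; clearbody p.
have q0 : 0 < 1 - 2 * e by rewrite /e; lra.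
have Q1 : Q - 1 <= 2 * (p + 1) * 2 `^ (p + 2) * e.
  have p10 : 0 <= p + 1 by lra.
  have := powRN_tangent q0 ltr01 p10; rewrite powR1 -/Q => H.
  apply: (le_trans H).
  have -> : - (p + 1) - 1 = - (p + 2) by ring.
  have : (1 - 2 * e) `^ (- (p + 2)) <= 2^-1 `^ (- (p + 2)).
    by apply: ger_powRN => //; rewrite /e; lra.
  rewrite powRVN// => H'.
  have : 2 * (p + 1) * e * (1 - 2 * e) `^ (- (p + 2)) <= 2 * (p + 1) * e * 2 `^ (p + 2).
    by rewrite ler_wpM2l// (mulr_ge0 _ (ltW e0))// mulr_ge0.
  lra.
have s10 : 0 <= s + 1 by move: s0; lra.
have p10 : 0 <= 2 * (p + 1) by lra.
pose P := 2 * (p + 1) * 2 `^ (p + 2).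
have P0 : 0 <= P by apply: mulr_ge0 => //; exact: powR_ge0.
rewrite -/P in Q1 *; clearbody P Q e.
set n := l2norm x ^+ 2 in DE *; have n0 : 0 <= n by exact: sqr_ge0.
have nD : n <= D by rewrite DE lerDl sqr_ge0.
clearbody n.
have H1 : (s + 1) * n * (Q - 1) <= (s + 1) * n * (P * e).
  by apply: ler_wpM2l => //; exact: mulr_ge0.
have H2 : (s + 1) * (P * e) * n <= (s + 1) * (P * e) * D.
  by apply: ler_wpM2l => //; apply: mulr_ge0 => //; exact: mulr_ge0 (ltW e0).
have H : 0 <= (s + 1) * (P * e) * D - (s + 1) * n * (Q - 1).
  rewrite subr_ge0; apply: le_trans H1 _; apply: le_trans H2.
  by rewrite le_eqVlt mulrAC eqxx.
rewrite E -(mulr_natl D d) -(mulr_natl (5 / 2 * p * e * D) d) -subr_ge0; apply: (le_trans H).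
rewrite le_eqVlt; apply/orP; left; apply/eqP.
rewrite {2}DE; ring.
Qed.

End DivergenceLower.

(** * Grids, tent weights and summation by parts *)

Section GridCount.
Context {R : realType}.

Lemma grid_count (n : nat) (h rho y : R) : h = 6 / n.+2%:R -> 0 < h -> h <= rho ->
  rho <= 1 / 4 -> `|y| <= 2 ->
  rho <= \sum_(k < n.+2) h * (`|h * k%:R - 3 - y| <= rho)%R%:R.
Proof.
move=> hE h0 hr r4 y2.
have N0 : 0 < n.+2%:R :> R by rewrite ltr0n.
have hN : h * n.+2%:R = 6 by rewrite hE divfK// gt_eqF.
have [y2a y2b] : - 2 <= y /\ y <= 2 by move: y2; rewrite ler_norml => /andP.
(* The indices from [a] to [a + m - 1] give points within [rho] of [y]. Truncation loses less than
   one step, and [h <= rho] still leaves [m h >= rho]. *)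
pose a := (Num.truncn ((y + 3 - rho) / h)).+1.
pose m := Num.truncn (2 * rho / h).
have a1 : y + 3 - rho < h * a%:R.
  by rewrite [ltRHS]mulrC -ltr_pdivrMr//; exact: truncnS_gt.
have a2 : h * a%:R <= y + 3 - rho + h.
  rewrite /a -natr1 mulrDr mulr1 lerD2r mulrC -ler_pdivlMr//.
  by rewrite truncn_le divr_ge0 ?(ltW h0)//; lra.
have m1 : h * m%:R <= 2 * rho.
  rewrite mulrC -ler_pdivlMr// truncn_le.
  by rewrite divr_ge0 ?(ltW h0)//; lra.
have m2 : rho <= h * m%:R.
  have : 2 * rho < h * m.+1%:R by rewrite [ltRHS]mulrC -ltr_pdivrMr//; exact: truncnS_gt.
  rewrite -natr1; lra.
have amN : (a + m <= n.+2)%N.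
  by rewrite -(ler_nat R) natrD -(ler_pM2l h0) hN; lra.
pose f (k : nat) : R := h * (`|h * k%:R - 3 - y| <= rho)%R%:R.
have f0 k : 0 <= f k by rewrite mulr_ge0 ?(ltW h0).
rewrite -[leRHS](big_mkord xpredT f).
rewrite (big_cat_nat (leq0n a) (leq_trans (leq_addr m a) amN))/=.
rewrite (big_cat_nat (leq_addr m a) amN)/=.
apply: (@le_trans _ _ (\sum_(a <= k < a + m) f k)); last first.
  have A1 : 0 <= \sum_(0 <= k < a) f k by apply: sumr_ge0.
  have A2 : 0 <= \sum_(a + m <= k < n.+2) f k by apply: sumr_ge0.
  lra.
apply: (@le_trans _ _ (\sum_(a <= k < a + m) h)).
  by rewrite sumr_const_nat addKn -mulr_natr.
apply: ler_sum_nat => k /andP[ak kam].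
have k1 : h * a%:R <= h * k%:R by rewrite ler_pM2l// ler_nat.
have k2 : h * k%:R <= h * a%:R + h * m%:R - h.
  rewrite -mulrDr -natrD lerBrDr -[X in _ + X](mulr1 h) -mulrDr natr1.
  by rewrite ler_pM2l// ler_nat.
have H : `|h * k%:R - 3 - y| <= rho by rewrite ler_norml; apply/andP; split; lra.
by rewrite /f H mulr1.
Qed.

End GridCount.

Lemma l2norm_delta {R : realType} {d : nat} (i : 'I_d) :
  l2norm (delta_mx 0 i : 'rV[R]_d) = 1.
Proof.
rewrite /l2norm (bigD1 i)//= !mxE !eqxx/= big1 ?addr0 ?expr1n ?sqrtr1// => j ji.
by rewrite !mxE eqxx (negbTE ji) expr0n.
Qed.

Section Grid.
Context {R : realType} {d : nat}.
Variable n : nat.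
Implicit Types (z : {ffun 'I_d -> 'I_n.+2}) (i : 'I_d).
Let h : R := 6 / n.+2%:R.

Definition grid_pos z : 'rV[R]_d := \row_i (h * (z i)%:R - 3).

Definition grid_unit i : {ffun 'I_d -> 'I_n.+2} := [ffun j => if j == i then 1 else 0].

(** Slope 1 and radius 2 inside the box [[-3, 3)^d] of the grid: a margin remains for the cyclic
    wrap, and the value is at least 1/2 up to radius 3/2. *)
Definition tent (u : 'rV[R]_d) : R := Num.max 0 (2 - l2norm u).

Lemma tent_ge0 u : 0 <= tent u. Proof. by rewrite le_max lexx. Qed.

Lemma tent_le2 u : tent u <= 2.
Proof. by rewrite ge_max ler0n/= gerBl l2norm_ge0. Qed.

Lemma tent_eq0 u : 2 <= l2norm u -> tent u = 0.
Proof. by move=> u2; rewrite /tent max_l// subr_le0. Qed.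

Lemma tent_dist u v : `|tent u - tent v| <= l2norm (u - v).
Proof.
apply: le_trans (ler_l2dist u v); rewrite /tent.
have := ler_norm (l2norm u - l2norm v); have := ler_norm (l2norm v - l2norm u).
rewrite (distrC (l2norm v)) ler_norml /Num.max.
by case: (ltP 0 (2 - l2norm u)) => ?; case: (ltP 0 (2 - l2norm v)) => ? ? ?;
  apply/andP; split; lra.
Qed.

Lemma grid_h0 : 0 < h. Proof. by rewrite divr_gt0// ltr0n. Qed.

Lemma grid_pos_add z i : ((z i).+1 < n.+2)%N ->
  grid_pos (z + grid_unit i) = grid_pos z + h *: delta_mx 0 i.
Proof.
move=> zi; apply/rowP => j; rewrite !mxE !ffunE eqxx/=.
have [->|ji] := eqVneq j i; last by rewrite /= addn0 modn_small// mulr0 addr0.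
rewrite /= addn1 modn_small// -natr1; ring.
Qed.

(* [grid_unit] adds cyclically in each coordinate; the tent vanishes wherever
   the grid wraps around. *)
Lemma tent_wrap z i : (n.+2 <= (z i).+1)%N -> h <= 1 ->
  tent (grid_pos z) = 0 /\ tent (grid_pos (z + grid_unit i)) = 0.
Proof.
move=> zi h1; have hN : h * n.+2%:R = 6 by rewrite /h divfK// pnatr_eq0.
have zE : z i = n.+1 :> nat by apply/eqP; rewrite eqn_leq -ltnS ltn_ord -ltnS.
split; apply: tent_eq0; apply: le_trans (coord_le_l2norm _ i); rewrite !mxE.
  apply: le_trans (ler_norm _); rewrite zE; move: hN; rewrite -natr1; lra.
rewrite !ffunE eqxx /= zE addn1 modnn mulr0 sub0r normrN ger0_norm//; lra.
Qed.

Lemma tent_grid_step z i : h <= 1 ->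
  `|tent (grid_pos z) - tent (grid_pos (z + grid_unit i))| <= h.
Proof.
move=> h1; have [zi|zi] := ltnP (z i).+1 n.+2; last first.
  by have [-> ->] := tent_wrap zi h1; rewrite subrr normr0 ltW// grid_h0.
apply: le_trans (tent_dist _ _) _; rewrite grid_pos_add// l2norm_distC addrAC subrr add0r.
by rewrite l2normZ (gtr0_norm grid_h0) l2norm_delta mulr1.
Qed.

(** The shift by [grid_unit i] is a bijection of the cyclic grid, so there are no boundary terms,
    and it is a true translation by [h] wherever the tent does not vanish. *)
Lemma grid_sum_by_parts (g : 'rV[R]_d -> R) i : h <= 1 ->
  \sum_(z : {ffun 'I_d -> 'I_n.+2})
    (tent (grid_pos (z - grid_unit i)) - tent (grid_pos z)) * g (grid_pos z) =
  \sum_(z : {ffun 'I_d -> 'I_n.+2}) tent (grid_pos z) *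
    (g (grid_pos z + h *: delta_mx 0 i) - g (grid_pos z)).
Proof.
move=> h1.
under eq_bigr do rewrite mulrBl.
under [RHS]eq_bigr do rewrite mulrBr.
rewrite !sumrB; congr (_ - _).
rewrite (reindex_inj (addIr (grid_unit i))) /=; apply: eq_bigr => z _.
rewrite addrK; have [zi|zi] := ltnP (z i).+1 n.+2; first by rewrite grid_pos_add.
by have [-> _] := tent_wrap zi h1; rewrite !mul0r.
Qed.

(** The indicator of a box is a product over coordinates, so by distributivity the count is a
    product of one-dimensional counts. *)
Lemma grid_box (y : 'rV[R]_d) (rho : R) : h <= rho -> rho <= 1 / 4 -> l2norm y <= 2 ->
  rho ^+ d <= \sum_(z : {ffun 'I_d -> 'I_n.+2}) h ^+ d *
    [forall i, `|grid_pos z 0 i - y 0 i| <= rho]%R%:R.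
Proof.
move=> hr r4 y2.
have h0 := grid_h0.
apply: (@le_trans _ _ (\prod_(i < d) \sum_(k < n.+2) h * (`|h * k%:R - 3 - y 0 i| <= rho)%R%:R)).
  rewrite -[d in leLHS]card_ord -prodr_const; apply: ler_prod => i _.
  apply/andP; split; first by apply: le_trans hr; exact: ltW.
  apply: (@grid_count R n) => //; exact: le_trans (coord_le_l2norm _ _) y2.
rewrite bigA_distr_bigA/=; apply: ler_sum => z _.
rewrite big_split/= prodr_const card_ord ler_wpM2l ?exprn_ge0 ?(ltW h0)//.
case: (boolP [forall _, _]) => [/forallP H|/forallPn[i Hi]].
  by rewrite big1// => i _; have := H i; rewrite mxE => ->.
by move: Hi; rewrite mxE (bigD1 i)//= => /negbTE ->; rewrite mul0r.
Qed.

End Grid.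

Section DivergenceGrid.
Context {R : realType} {d : nat}.
Variable s : R.
Hypotheses (s0 : 0 < s) (sd : s <= d%:R - 1).
Let p := (s + 1) / 2.

(** [c1] bounds the divergence below near the origin and [kap] is the admissible discretization
    error. The weights are [h^d] times slopes of the tent, which are at most 1, and
    [h^d = 6^d / #|G|]. After summation by parts the sum is a Riemann sum of the tent times the
    divergence, from which only the grid points in a box around [y] are retained. *)
Lemma divergence_grid_le (tau : R) (rho c1 kap : R) :
  0 < tau -> 0 < kap -> 0 < rho -> rho <= 1 / 4 -> d%:R * rho <= 1 / 4 -> 0 <= c1 ->
  (forall x : 'rV[R]_d, (forall i, `|x 0 i| <= rho) ->
     c1 <= (l2norm x ^+ 2 + tau ^+ 2) `^ (- (p + 1)) *
       (d%:R * tau ^+ 2 + (d%:R - 1 - s) * l2norm x ^+ 2)) ->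
  exists (G : finType) (P : G -> 'rV[R]_d) (w : G -> 'I_d -> R),
  [/\ (0 < #|G|)%N, forall i, \sum_z w z i = 0,
     forall z i, `|w z i| <= 6 ^+ d / #|G|%:R,
     forall z i, w z i != 0 -> l2norm (P z) <= 9 / 4 &
     forall y, c1 * rho ^+ d / 2 * (l2norm y <= 5 / 4)%R%:R - kap <=
       \sum_z \sum_i w z i * smooth_kernel s tau (P z - y) i].
Proof.
move=> t0 k0 r0 r4 dr4 c10 Hc.
pose C := @div_error_cst R d s.
have p0 : 0 < p by move: s0; rewrite /p; lra.
have C0 : 0 < C.
  have s10 : 0 < s + 1 by move: s0; lra.
  have p10 : 0 < p + 1 by move: p0; lra.
  have P0 : 0 < 2 `^ (p + 2) :> R by rewrite powR_gt0.
  have dp : 0 <= p * d%:R by apply: mulr_ge0; rewrite ?ler0n ?ltW.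
  rewrite /C /div_error_cst -/p; apply: ltr_pwDl.
    by rewrite (mulr_gt0 s10)// (mulr_gt0 _ P0)// mulr_gt0.
  by move: dp; lra.
(* The last entry balances [kap] against the total error
   [2 * 6^d * C * (h / tau) * tau^(-(s+1))]. *)
pose b := Num.min (Num.min (1 / 4) rho)
  (Num.min (tau / 4) (tau * (kap / (2 * 6 ^+ d * C * tau `^ (- (s + 1)))))).
have X0 : 0 < 2 * 6 ^+ d * C * tau `^ (- (s + 1)).
  by rewrite !mulr_gt0 ?exprn_gt0 ?powR_gt0.
have b0 : 0 < b.
  by rewrite !lt_min r0 !divr_gt0//= mulr_gt0// divr_gt0.
pose n := Num.truncn (6 / b).
pose h : R := 6 / n.+2%:R.
have h0 : 0 < h by rewrite divr_gt0// ltr0n.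
have hb : h <= b.
  rewrite ler_pdivrMr ?ltr0n// mulrC -ler_pdivrMr//; apply: ltW.
  apply: lt_trans (truncnS_gt _) _; by rewrite ltr_nat.
have [h4 hr ht hk] : [/\ h <= 1 / 4, h <= rho, h <= tau / 4 &
    h <= tau * (kap / (2 * 6 ^+ d * C * tau `^ (- (s + 1))))].
  by move: hb; rewrite !le_min => /andP[/andP[-> ->] /andP[-> ->]].
have h1 : h <= 1 by lra.
pose G : finType := {ffun 'I_d -> 'I_n.+2}.
pose P (z : G) := @grid_pos R d n z.
pose w (z : G) (i : 'I_d) : R :=
  h ^+ d / h * (tent (@grid_pos R d n (z - @grid_unit d n i)) - tent (@grid_pos R d n z)).
have cG : #|G|%:R = n.+2%:R ^+ d :> R by rewrite card_ffun !card_ord natrX.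
have hd : h ^+ d = 6 ^+ d / #|G|%:R by rewrite cG /h expr_div_n.
exists G, P, w; split.
- by rewrite -(ltr_nat R) cG exprn_gt0 ?ltr0n.
- move=> i; rewrite -mulr_sumr; have := grid_sum_by_parts (fun=> 1) i h1.
  under eq_bigr do rewrite mulr1.
  move=> ->; under eq_bigr do rewrite subrr mulr0.
  by rewrite big1// mulr0.
- move=> z i; rewrite -hd normrM ger0_norm ?divr_ge0 ?exprn_ge0 ?(ltW h0)//.
  have := tent_grid_step (z - @grid_unit d n i) i h1; rewrite subrK => H.
  apply: le_trans (ler_wpM2l _ H) _; first by rewrite divr_ge0 ?exprn_ge0 ?(ltW h0).
  by rewrite divfK// gt_eqF.
(* The radius 9/4 is the tent radius 2 plus one mesh step, which is at most 1/4. *)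
- move=> z i wz; rewrite leNgt; apply/negP => zP.
  move: wz; rewrite /w (tent_eq0 (_ : 2 <= l2norm (@grid_pos R d n z))) ?subr0; last first.
    by apply: ltW; apply: lt_trans zP; lra.
  suff -> : tent (@grid_pos R d n (z - @grid_unit d n i)) = 0 by rewrite mulr0 eqxx.
  set z' := z - _; have [zi|zi] := ltnP (z' i).+1 n.+2; last first.
    by have [] := @tent_wrap R d n z' i zi h1.
  apply: tent_eq0; move: zP; have := @grid_pos_add R d n z' i zi.
  rewrite subrK /P => ->; have := ler_l2normD (@grid_pos R d n z') (h *: delta_mx 0 i).
  rewrite l2normZ (gtr0_norm h0) l2norm_delta; lra.
move=> y.
pose D (z : G) := l2norm (P z - y) ^+ 2 + tau ^+ 2.
have D0 z : 0 < D z by rewrite ltr_wpDl ?sqr_ge0 ?exprn_gt0.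
pose A (z : G) := D z `^ (- (p + 1)).
have A0 z : 0 <= A z by exact: powR_ge0.
pose M (z : G) := d%:R * tau ^+ 2 + (d%:R - 1 - s) * l2norm (P z - y) ^+ 2.
have M0 z : 0 <= M z.
  by rewrite addr_ge0// mulr_ge0 ?sqr_ge0 ?ler0n// subr_ge0.
have SE : \sum_z \sum_i w z i * smooth_kernel s tau (P z - y) i =
   \sum_z h ^+ d / h * (tent (P z) * \sum_i (smooth_kernel s tau (P z - y + h *: delta_mx 0 i) i
      - smooth_kernel s tau (P z - y) i)).
  rewrite exchange_big/=.
  under [RHS]eq_bigr do rewrite !mulr_sumr.
  rewrite [RHS]exchange_big/=; apply: eq_bigr => i _.
  under eq_bigr do rewrite /w -mulrA.
  rewrite -!mulr_sumr; congr (_ * _).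
  rewrite (grid_sum_by_parts (fun u => smooth_kernel s tau (u - y) i) i h1).
  by apply: eq_bigr => z _; rewrite addrAC.
rewrite SE {SE}.
pose e := h / tau.
have e4 : e <= 1 / 4 by rewrite ler_pdivrMr//; lra.
have e0 : 0 < e by rewrite divr_gt0.
have term z : h ^+ d * (tent (P z) * (A z * M z)) - h ^+ d * (2 * C * e * tau `^ (- (s + 1))) <=
   h ^+ d / h * (tent (P z) * \sum_i (smooth_kernel s tau (P z - y + h *: delta_mx 0 i) i
      - smooth_kernel s tau (P z - y) i)).
  have := smooth_kernel_div_lower s0 t0 h0 e4 (erefl (D z)).
  rewrite -/C -/p -/(A z) -/(M z) => H.
  have AD : A z * D z <= tau `^ (- (s + 1)).
    rewrite /A opprD powRB1_gt0// divfK ?gt_eqF//.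
    have -> : tau `^ (- (s + 1)) = (tau ^+ 2) `^ (- p).
      by rewrite powR_sqr ?(ltW t0)//; congr (_ `^ _); rewrite /p; field.
    apply: ger_powRN; rewrite ?exprn_gt0 ?(ltW p0)//.
    by rewrite lerDr sqr_ge0.
  have T0 := tent_ge0 (P z); have T2 := tent_le2 (P z).
  have hd0 : 0 <= h ^+ d by rewrite exprn_ge0 ?(ltW h0).
  have Q0 : 0 <= A z * (C * e * D z).
    exact: mulr_ge0 (A0 z) (mulr_ge0 (mulr_ge0 (ltW C0) (ltW e0)) (ltW (D0 z))).
  have H2 : tent (P z) * (A z * (C * e * D z)) <= 2 * C * e * tau `^ (- (s + 1)).
    apply: (@le_trans _ _ (2 * (A z * (C * e * D z)))); first by rewrite ler_wpM2r.
    have Ce : 0 <= 2 * C * e by rewrite (mulr_ge0 _ (ltW e0))// mulr_ge0// ltW.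
    have := ler_wpM2l Ce AD; lra.
  have H3 := ler_wpM2l T0 H.
  have H4 : 0 <= h ^+ d / h by rewrite divr_ge0 ?(ltW h0).
  apply: le_trans (ler_wpM2l H4 H3).
  have -> : h ^+ d / h * (tent (P z) * (h * A z * (M z - C * (h / tau) * D z))) =
     h ^+ d * (tent (P z) * (A z * M z)) - h ^+ d * (tent (P z) * (A z * (C * e * D z))).
    by rewrite /e; field; rewrite !gt_eqF.
  by rewrite lerD2l lerN2 ler_wpM2l.
apply: le_trans (ler_sum _ (fun z _ => term z)).
have sc (k : R) : \sum_(z : G) k = #|G|%:R * k by rewrite sumr_const mulr_natl.
rewrite sumrB sc lerB//; last first.
  rewrite mulrA hd [#|_|%:R * _]mulrC divfK; last by rewrite cG expf_neq0// pnatr_eq0.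
  have -> : 6 ^+ d * (2 * C * e * tau `^ (- (s + 1))) =
    e * (2 * 6 ^+ d * C * tau `^ (- (s + 1))) by ring.
  by rewrite -ler_pdivlMr// ler_pdivrMr// mulrC.
have nn z : 0 <= h ^+ d * (tent (P z) * (A z * M z)).
  by rewrite mulr_ge0 ?exprn_ge0 ?(ltW h0)// mulr_ge0 ?tent_ge0// mulr_ge0.
have [y54|_] := boolP (l2norm y <= 5 / 4); last by rewrite mulr0 sumr_ge0.
rewrite mulr1.
have y2 : l2norm y <= 2 by lra.
have := grid_box hr r4 y2 => /(ler_wpM2l (_ : 0 <= c1 / 2)) H.
have -> : c1 * rho ^+ d / 2 = c1 / 2 * rho ^+ d by ring.
apply: le_trans (H _) _; first by rewrite divr_ge0.
rewrite mulr_sumr; apply: ler_sum => z _.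
case: forallP => [box|_]; last by rewrite !mulr0.
rewrite mulr1 mulrC ler_wpM2l ?exprn_ge0 ?(ltW h0)//.
have cM : c1 <= A z * M z by apply: Hc => i; have := box i; rewrite !mxE.
(* Retained points have norm at most [1/4 + 5/4]. This is the source of the 2 in the denominator of
   the lower bound. *)
have T12 : 1 / 2 <= tent (P z).
  rewrite /tent le_max; apply/orP; right.
  have : l2norm (P z - y) <= 1 / 4.
    apply: le_trans (l2norm_le_sum _) _; apply: le_trans dr4.
    rewrite -[d in d%:R](card_ord d) -sum1_card natr_sum mulr_suml.
    by apply: ler_sum => i _; rewrite mul1r; have := box i; rewrite !mxE.
  have := ler_l2normD (P z - y) y; rewrite subrK; lra.
apply: (@le_trans _ _ (1 / 2 * (A z * M z))); first by lra.
by rewrite ler_wpM2r// mulr_ge0.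
Qed.

End DivergenceGrid.

Section DivergenceGridUniform.
Context {R : realType} {d : nat}.
Variable s : R.
Hypotheses (s0 : 0 < s) (sd : s <= d%:R - 1).

(* For [s < d - 1] the divergence stays positive off the origin as [tau -> 0];
   for [s = d - 1] it concentrates at scale [tau], and its integral over the box
   of that radius is still bounded below. *)
Lemma divergence_grid : exists2 c : R, 0 < c & forall tau kap : R,
  0 < tau -> tau <= 1 / 4 -> 0 < kap ->
  exists (G : finType) (P : G -> 'rV[R]_d) (w : G -> 'I_d -> R),
  [/\ (0 < #|G|)%N, forall i, \sum_z w z i = 0,
     forall z i, `|w z i| <= 6 ^+ d / #|G|%:R,
     forall z i, w z i != 0 -> l2norm (P z) <= 9 / 4 &
     forall y, c * (l2norm y <= 5 / 4)%R%:R - kap <=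
       \sum_z \sum_i w z i * smooth_kernel s tau (P z - y) i].
Proof.
have d1 : 1 < d%:R :> R by move: s0 sd; lra.
have d0 : 0 < d%:R :> R by lra.
have d01 : (d%:R : R)^-1 <= 1 by rewrite invf_le1 ?ltW.
have box (x : 'rV[R]_d) (rho : R) : (forall i, `|x 0 i| <= rho) -> l2norm x <= d%:R * rho.
  move=> H; apply: le_trans (l2norm_le_sum _) _.
  rewrite -[d in d%:R](card_ord d) -sum1_card natr_sum mulr_suml.
  by apply: ler_sum => i _; rewrite mul1r.
have Dle (x : 'rV[R]_d) (rho : R) : (forall i, `|x 0 i| <= rho) ->
   l2norm x ^+ 2 <= (d%:R * rho) ^+ 2.
  move=> /box H; rewrite lerXn2r ?nnegrE ?l2norm_ge0//.
  exact: le_trans (l2norm_ge0 _) H.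
have [sE|sN] := eqVneq s (d%:R - 1).
  (* On the box of radius [tau / d] one has [|x| <= tau], hence [D <= 2 tau^2]. As [s + 3 = d + 2],
     the divergence is at least [a tau^(-d)] there, and the factor [(tau / d)^d] of the box cancels
     the power of [tau]. *)
  pose a : R := d%:R * 2 `^ (- ((s + 1) / 2 + 1)).
  have a0 : 0 < a by rewrite mulr_gt0// powR_gt0.
  exists (a * (d%:R^-1) ^+ d / 2).
    by rewrite divr_gt0// mulr_gt0// exprn_gt0// invr_gt0.
  move=> tau kap t0 t4 k0.
  have [|||||G [P [w [H1 H2 H3 H4 H5]]]] := @divergence_grid_le R d s s0 sd tau (tau / d%:R)
    (a * tau ^- d) kap t0 k0.
  - by rewrite divr_gt0.
  - by apply: le_trans t4; rewrite ler_piMr// ltW.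
  - by rewrite mulrC divfK// gt_eqF.
  - by rewrite mulr_ge0 ?(ltW a0)// invr_ge0 exprn_ge0// ltW.
  - move=> x xr; have D2 : l2norm x ^+ 2 + tau ^+ 2 <= 2 * tau ^+ 2.
      by have := Dle x _ xr; rewrite mulrC divfK ?gt_eqF//; lra.
    have t20 : 0 < tau ^+ 2 by rewrite exprn_gt0.
    have D0 : 0 < l2norm x ^+ 2 + tau ^+ 2 by rewrite ltr_wpDl ?sqr_ge0.
    have q0 : 0 <= (s + 1) / 2 + 1 by move: s0; lra.
    apply: (@le_trans _ _ ((2 * tau ^+ 2) `^ (- ((s + 1) / 2 + 1)) * (d%:R * tau ^+ 2))).
      rewrite powRM ?(ltW t20)// powR_sqr ?(ltW t0)//.
      have -> : 2 * - ((s + 1) / 2 + 1) = - (d.+2)%:R :> R.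
        by rewrite sE -[d.+2]addn2 natrD; field.
      rewrite (powR_invn _ (ltW t0)) /a.
      have -> : tau ^+ d.+2 = tau ^+ d * tau ^+ 2 by rewrite -exprD addn2.
      rewrite le_eqVlt; apply/orP; left; apply/eqP; field.
      by rewrite expf_neq0 gt_eqF.
    have sq := sqr_ge0 (l2norm x).
    apply: ler_pM; rewrite ?powR_ge0 ?mulr_ge0 ?(ltW d0) ?(ltW t0)//.
      exact: ger_powRN.
    by rewrite sE; lra.
  exists G, P, w; split => // y.
  have -> : a * d%:R^-1 ^+ d = a * tau ^- d * (tau / d%:R) ^+ d; last exact: H5.
  by rewrite exprMn; field; rewrite !expf_neq0// gt_eqF.
have sd' : 0 < d%:R - 1 - s by rewrite subr_gt0 lt_neqAle sN.
(* On this box [|x|] and [tau] are at most 1/4, so [D <= 1] and its negative powers are at least 1,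
   whatever [tau] is. *)
pose rho : R := 1 / 4 / d%:R.
have r0 : 0 < rho by rewrite divr_gt0.
exists ((d%:R - 1 - s) * rho ^+ d / 2).
  by rewrite divr_gt0// mulr_gt0// exprn_gt0.
move=> tau kap t0 t4 k0.
have dr : d%:R * rho = 1 / 4 by rewrite /rho mulrC divfK// gt_eqF.
apply: divergence_grid_le => //.
- by rewrite /rho ler_piMr.
- by rewrite dr.
- exact: ltW.
- move=> x xr; have x4 := Dle x _ xr; rewrite dr in x4.
  have t20 : 0 < tau ^+ 2 by rewrite exprn_gt0.
  have t16 : tau ^+ 2 <= (1 / 4) ^+ 2 by rewrite lerXn2r ?nnegrE ?(ltW t0).
  set D := l2norm x ^+ 2 + tau ^+ 2.
  have D0 : 0 < D by rewrite ltr_wpDl ?sqr_ge0.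
  have D1 : D <= 1 by rewrite /D; lra.
  have p0 : 0 <= (s + 1) / 2 by move: s0; lra.
  have DD : 1 <= D `^ (- ((s + 1) / 2 + 1)) * D.
    rewrite opprD powRB1_gt0// divfK ?gt_eqF//.
    by have := ger_powRN D0 D1 p0; rewrite powR1.
  apply: (@le_trans _ _ (D `^ (- ((s + 1) / 2 + 1)) * ((d%:R - 1 - s) * D))).
    rewrite mulrCA -[leLHS]mulr1 ler_wpM2l// ltW//.
  rewrite ler_wpM2l ?powR_ge0//.
  have : (1 + s) * tau ^+ 2 >= 0 by rewrite mulr_ge0 ?(ltW t20)//; move: s0; lra.
  rewrite /D; lra.
Qed.

End DivergenceGridUniform.

(** * Energies of translated grids *)

Section Averaging.
Context {R : realType} {d : nat}.

(** The comparison of the sum with the integral of [t^(-a)]. The induction step is the concavity of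
    [t^(1-a)], in the form [u^(1-a) <= (1 - a) u + a], an instance of Young's inequality. *)
Lemma powR_sum_le (a : R) (n : nat) : 0 < a -> a < 1 ->
  \sum_(0 <= j < n) j.+1%:R `^ (- a) <= n%:R `^ (1 - a) / (1 - a).
Proof.
move=> a0 a1; have b0 : 0 < 1 - a by lra.
elim: n => [|n IH]; first by rewrite big_nil divr_ge0 ?powR_ge0 ?ltW.
rewrite big_nat_recr//=; apply: le_trans (lerD IH (lexx _)) _.
rewrite ler_pdivlMr// mulrDl divfK ?gt_eqF//.
have N0 : 0 < n.+1%:R :> R by rewrite ltr0n.
have [->|n0] := posnP n.
  rewrite powR0 ?gt_eqF// add0r !powR1; lra.
have n0' : 0 < n%:R :> R by rewrite ltr0n.
pose u : R := n%:R / n.+1%:R.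
have u0 : 0 < u by rewrite divr_gt0.
have U : u `^ (1 - a) <= (1 - a) * u + a.
  have := @conjugate_powR R (u `^ (1 - a)) 1 (1 - a)^-1 a^-1 (powR_ge0 _ _) ler01.
  rewrite !invr_gt0 !invrK => /(_ b0 a0); rewrite subrK => /(_ erefl).
  by rewrite mulr1 -powRrM divff ?gt_eqF// powRr1 ?(ltW u0)// powR1 mul1r mulrC.
have E1 : n%:R `^ (1 - a) = u `^ (1 - a) * n.+1%:R `^ (1 - a) :> R.
  by rewrite -powRM ?(ltW u0) ?(ltW N0)// /u divfK// gt_eqF.
have E2 : n.+1%:R `^ (- a) = n.+1%:R `^ (1 - a) / n.+1%:R :> R.
  by rewrite -powRB1_gt0//; congr (_ `^ _); ring.
rewrite E1 E2; set X := n.+1%:R `^ (1 - a).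
have X0 : 0 <= X by exact: powR_ge0.
have := ler_wpM2r X0 U.
have -> : ((1 - a) * u + a) * X = X - X / n.+1%:R * (1 - a).
  by rewrite /u -natr1; field; rewrite natr1 gt_eqF.
by rewrite lerBrDr.
Qed.

(** With truncated subtraction [(k - M) + (M - k)] is [|k - M|]; the two sides of [M] are each
    bounded by the full sum. *)
Lemma sum_dist_le (g : nat -> R) (M m : nat) : (forall j, 0 <= g j) ->
  (forall i j, (i <= j)%N -> g j <= g i) ->
  \sum_(0 <= k < m) g ((k - M) + (M - k))%N <= 2 * \sum_(0 <= j < m) g j.
Proof.
move=> g0 gd.
have half (q M' : nat) : (q <= m)%N -> (q <= M')%N ->
    \sum_(0 <= k < q) g ((k - M') + (M' - k))%N <= \sum_(0 <= j < m) g j.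
  move=> qm qM; apply: (@le_trans _ _ (\sum_(0 <= j < q) g j)); last first.
    by rewrite (big_cat_nat (leq0n q) qm)/= lerDl sumr_ge0.
  rewrite [leRHS]big_nat_rev/=; apply: ler_sum_nat => k /andP[_ kq]; apply: gd.
  by rewrite add0n (leq_trans _ (leq_addl _ _))// (leq_trans (leq_sub2r _ qM)) ?leq_sub2l.
have pos : 0 <= \sum_(0 <= j < m) g j by apply: sumr_ge0.
have [mM|Mm] := leqP m M.
  by apply: le_trans (half m M (leqnn m) mM) _; lra.
rewrite (big_cat_nat (leq0n M) (ltnW Mm))/=.
have H1 := half M M (ltnW Mm) (leqnn M).
have H2 : \sum_(M <= k < m) g ((k - M) + (M - k))%N <= \sum_(0 <= j < m) g j.
  rewrite -{1}[M]add0n big_addn.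
  apply: (@le_trans _ _ (\sum_(0 <= j < m - M) g j)).
    by apply: ler_sum_nat => k _; apply: gd; rewrite addnK leq_addr.
  by rewrite [leRHS](big_cat_nat (leq0n (m - M)%N) (leq_subr M m))/= lerDl sumr_ge0.
lra.
Qed.

Lemma sum_max_powR_le (a Y : R) (m : nat) : 0 < a -> a < 1 ->
  \sum_(k < m) Num.max `|k%:R - Y| 1 `^ (- a) <=
    2 * 4 `^ a / (1 - a) * m%:R `^ (1 - a).
Proof.
move=> a0 a1; pose M := Num.truncn Y.
have term (k : nat) : Num.max `|k%:R - Y| 1 `^ (- a) <=
    4 `^ a * ((k - M) + (M - k)).+1%:R `^ (- a).
  have e : ((k - M) + (M - k)).+1%:R / 4 <= Num.max `|k%:R - Y| 1 :> R.
    rewrite ler_pdivrMr//.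
    have h1 : 1 <= Num.max `|k%:R - Y| 1 by rewrite le_max lexx orbT.
    have h2 : `|k%:R - Y| <= Num.max `|k%:R - Y| 1 by rewrite le_max lexx.
    suff : ((k - M) + (M - k))%:R <= `|k%:R - Y| + 1 by rewrite -natr1; lra.
    (* A negative [Y] truncates to 0, and then [|k - M| = k <= |k - Y|]. *)
    have [Y0|Y0] := leP 0 Y; last first.
      have -> : M = 0%N by apply/eqP; rewrite /M truncn_floor leNgt Y0.
      rewrite subn0 sub0n addn0; have := ler_norm (k%:R - Y); lra.
    have /andP[m1 m2] := truncn_itv Y0; rewrite -/M -natr1 in m1 m2.
    have [kM|Mk] := leqP k M.
      rewrite (_ : (k - M)%N = 0%N) ?add0n; last by apply/eqP; rewrite subn_eq0.
      by rewrite natrB//; have := ler_norm (- (k%:R - Y)); rewrite normrN; lra.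
    rewrite (_ : (M - k)%N = 0%N) ?addn0; last by apply/eqP; rewrite subn_eq0 ltnW.
    by rewrite natrB ?(ltnW Mk)//; have := ler_norm (k%:R - Y); lra.
  have n0 : 0 < ((k - M) + (M - k)).+1%:R :> R by rewrite ltr0n.
  apply: le_trans (ger_powRN _ e (ltW a0)) _; first by rewrite divr_gt0.
  by rewrite powRM ?invr_ge0 ?(ltW n0)// powRVN// mulrC.
rewrite -(big_mkord xpredT (fun k => Num.max `|k%:R - Y| 1 `^ (- a))).
apply: le_trans (ler_sum_nat (fun k _ => term k)) _.
rewrite -mulr_sumr.
have H : \sum_(0 <= k < m) ((k - M) + (M - k)).+1%:R `^ (- a) <=
    2 * \sum_(0 <= j < m) j.+1%:R `^ (- a) :> R.
  apply: (sum_dist_le (g := fun j => j.+1%:R `^ (- a))) => [j|i j ij].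
    exact: powR_ge0.
  by apply: ger_powRN; rewrite ?ltr0n ?ler_nat ?(ltW a0).
have S := powR_sum_le m a0 a1.
have a40 : 0 <= 4 `^ a :> R by exact: powR_ge0.
apply: le_trans (ler_wpM2l a40 H) _.
have -> : 2 * 4 `^ a / (1 - a) * m%:R `^ (1 - a) =
  4 `^ a * (2 * (m%:R `^ (1 - a) / (1 - a))) by ring.
by rewrite ler_wpM2l// ler_wpM2l.
Qed.

Lemma sum_shift_powR_le (a b y : R) (m : nat) : 0 < a -> a < 1 -> 0 < b -> (0 < m)%N ->
  \sum_(k < m) Num.max `|b * k%:R / m%:R - y| (b / m%:R) `^ (- a) <=
    2 * 4 `^ a * b `^ (- a) / (1 - a) * m%:R.
Proof.
move=> a0 a1 b0 m0; have M0 : 0 < m%:R :> R by rewrite ltr0n.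
have bm : 0 < b / m%:R by rewrite divr_gt0.
have -> : \sum_(k < m) Num.max `|b * k%:R / m%:R - y| (b / m%:R) `^ (- a) =
   (b / m%:R) `^ (- a) * \sum_(k < m) Num.max `|k%:R - y / (b / m%:R)| 1 `^ (- a).
  rewrite mulr_sumr; apply: eq_bigr => k _.
  rewrite -powRM ?(ltW bm)//.
  congr (_ `^ _); rewrite maxr_pMr ?(ltW bm)// mulr1; congr Num.max.
  rewrite -[b / m%:R in RHS]gtr0_norm// -normrM; congr (`|_|).
  by rewrite gtr0_norm//; field; rewrite !gt_eqF.
apply: le_trans (ler_wpM2l (powR_ge0 _ _) (sum_max_powR_le _ _ a0 a1)) _.
rewrite powRM ?invr_ge0 ?(ltW b0) ?(ltW M0)// powRVN ?(ltW M0)//.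
have E : m%:R `^ a * m%:R `^ (1 - a) = m%:R :> R.
  by rewrite -powRD_gt0// (_ : a + (1 - a) = 1) ?powRr1 ?(ltW M0)//; ring.
have -> : b `^ (- a) * m%:R `^ a * (2 * 4 `^ a / (1 - a) * m%:R `^ (1 - a)) =
  2 * 4 `^ a * b `^ (- a) / (1 - a) * (m%:R `^ a * m%:R `^ (1 - a)) by ring.
by rewrite E.
Qed.

(** Each coordinate is bounded by the norm, so the power [-sigma] of the norm is at most the product
    of the powers [-sigma / d] of the coordinates, and the sum over the grid factors. Since
    [sigma / d < 1], each one-dimensional sum is of order [m]; the condition [b / m <= lam] allows
    truncating every coordinate at the mesh size. *)
Lemma sum_translate_le (sigma b : R) : 0 < sigma -> sigma < d%:R -> 0 < b ->
  exists2 C : R, 0 < C & forall (m : nat) (lam : R) (y : 'rV[R]_d), (0 < m)%N ->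
  b / m%:R <= lam ->
  \sum_(t : {ffun 'I_d -> 'I_m})
    Num.max (l2norm ((\row_i (b * (t i)%:R / m%:R)) - y)) lam `^ (- sigma) <=
  C * m%:R ^+ d.
Proof.
move=> s0 sd b0; have d0 : 0 < d%:R :> R by apply: lt_trans sd.
pose a := sigma / d%:R.
have a0 : 0 < a by rewrite divr_gt0.
have a1 : a < 1 by rewrite ltr_pdivrMr// mul1r.
pose c := 2 * 4 `^ a * b `^ (- a) / (1 - a).
have c0 : 0 < c by rewrite !mulr_gt0 ?powR_gt0 ?invr_gt0//; lra.
exists (c ^+ d); first by rewrite exprn_gt0.
move=> m lam y m0 blam; have M0 : 0 < m%:R :> R by rewrite ltr0n.
have bm : 0 < b / m%:R by rewrite divr_gt0.
have l0 := lt_le_trans bm blam.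
apply: (@le_trans _ _ (\sum_(t : {ffun 'I_d -> 'I_m})
    \prod_(i < d) Num.max `|b * (t i)%:R / m%:R - y 0 i| (b / m%:R) `^ (- a))).
  apply: ler_sum => t _; set u := _ - y.
  have n0 : 0 < Num.max (l2norm u) lam by rewrite lt_max l0 orbT.
  have -> : Num.max (l2norm u) lam `^ (- sigma) =
     \prod_(i < d) Num.max (l2norm u) lam `^ (- a).
    rewrite prodr_const card_ord -powR_mulrn ?powR_ge0// -powRrM; congr (_ `^ _).
    by rewrite /a mulNr divfK// gt_eqF.
  apply: ler_prod => i _; rewrite powR_ge0/=; apply: ger_powRN (ltW a0).
    by rewrite lt_max bm orbT.
  rewrite ge_max !le_max blam orbT andbT; apply/orP; left.
  by have := coord_le_l2norm u i; rewrite !mxE.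
rewrite -(bigA_distr_bigA (fun (i : 'I_d) (k : 'I_m) =>
  Num.max `|b * k%:R / m%:R - y 0 i| (b / m%:R) `^ (- a))).
rewrite -exprMn -[d in leRHS]card_ord -prodr_const; apply: ler_prod => i _.
by rewrite sumr_ge0 ?sum_shift_powR_le// => k _; exact: powR_ge0.
Qed.

End Averaging.

(** * Truncated Riesz potentials *)

Section Energy.
Context {R : realType} {d : nat}.
Variables (s Lam : R) (mu : {measure set (borel_rV R d) -> \bar R}).
Hypotheses (s0 : 0 < s) (Lam0 : 0 < Lam) (nm : nice s Lam mu).
Local Notation B := (borel_rV R d).
Implicit Types (q x y : 'rV[R]_d).

Lemma smooth_kernel_scale (r t : R) (u : 'rV[R]_d) i : 0 < r ->
  smooth_kernel s (r * t) (r *: u) i = r `^ (- s) * smooth_kernel s t u i.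
Proof.
move=> r0; rewrite /smooth_kernel l2normZ (gtr0_norm r0) !mxE !exprMn -mulrDr.
rewrite powRM ?addr_ge0 ?sqr_ge0// powR_sqr ?(ltW r0)//.
have -> : 2 * - ((s + 1) / 2) = - s - 1 by field.
by rewrite powRB1_gt0//; field; rewrite gt_eqF.
Qed.

Lemma measurable_smooth_kernel q t i :
  measurable_fun setT (fun y : B => smooth_kernel s t (q - y) i).
Proof.
have -> : (fun y : B => smooth_kernel s t (q - y) i) = (fun y : B =>
    (q 0 i - (y : 'rV[R]_d) 0 i) * (l2norm (q - y) ^+ 2 + t ^+ 2) `^ (- ((s + 1) / 2))).
  by apply/funext => y; rewrite /smooth_kernel !mxE.
apply: measurable_funM.
  by apply: measurable_funB => //; exact: measurable_coord.
apply: (measurableT_comp (measurable_powR _)).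
apply: measurable_funD => //; apply: measurable_funX; exact: measurable_l2dist.
Qed.

(** The integrand of the Riesz potential of order [sigma] at the single point [q], localized to [D]
    and made bounded by truncation at distance [l]. *)
Definition energy_density (D : set 'rV[R]_d) q (l sigma : R) y : R :=
  \1_D y * Num.max (l2norm (q - y)) l `^ (- sigma).

Definition energy D q l sigma : R :=
  fine (\int[mu]_y (energy_density D q l sigma y)%:E)%E.

Lemma energy_density_ge0 D q l sigma y : 0 <= energy_density D q l sigma y.
Proof. by rewrite mulr_ge0 ?powR_ge0. Qed.

Lemma measurable_energy_density x Rad q l sigma :
  measurable_fun setT (energy_density (l2ball x Rad) q l sigma : B -> R).
Proof.
apply: measurable_funM; first exact: measurable_indic_l2ball.
apply: (measurableT_comp (measurable_powR _)).
by apply: measurable_maxr => //; exact: measurable_l2dist.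
Qed.

Lemma energyE x Rad q l sigma : 0 < Rad -> 0 < l -> 0 <= sigma ->
  (\int[mu]_y (energy_density (l2ball x Rad) q l sigma y)%:E =
    (energy (l2ball x Rad) q l sigma)%:E)%E.
Proof.
move=> R0 l0 sg0; rewrite fineK// ge0_fin_numE; last first.
  by apply: integral_ge0 => y _; rewrite lee_fin energy_density_ge0.
apply: (@le_lt_trans _ _ (\int[mu]_y (l `^ (- sigma) * \1_(l2ball x Rad) y)%:E)%E).
  apply: le_integral_nonmeas => y; rewrite lee_fin ?energy_density_ge0//.
  rewrite /energy_density mulrC ler_wpM2r//; apply: ger_powRN => //.
  by rewrite le_max lexx orbT.
rewrite integral_Zindic ?powR_ge0//; last exact: measurable_l2ball.
apply: (@le_lt_trans _ _ ((l `^ (- sigma))%:E * (Lam * Rad `^ s)%:E)%E); last first.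
  by rewrite -EFinM ltry.
by rewrite lee_wpmul2l ?lee_fin ?powR_ge0//; exact: nm.
Qed.

Lemma energy_ge0 D q l sigma : 0 <= energy D q l sigma.
Proof.
by rewrite fine_ge0// integral_ge0// => y _; rewrite lee_fin energy_density_ge0.
Qed.

(** Every point of the small ball is within [2 l] of [q]. When [sigma > s], an energy bound thus
    makes the density [mu(B(z, l)) / l^s] of order [l^(sigma - s)]. *)
Lemma energy_mass x Rad q z l sigma : 0 < Rad -> 0 < l -> 0 <= sigma ->
  l2norm (z - q) < l -> l2ball z l `<=` l2ball x Rad ->
  (mu (l2ball z l) <= ((2 * l) `^ sigma * energy (l2ball x Rad) q l sigma)%:E)%E.
Proof.
move=> R0 l0 sg0 zq sub.
have l20 : 0 < 2 * l by rewrite mulr_gt0.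
have P0 : 0 < (2 * l) `^ sigma by rewrite powR_gt0.
rewrite EFinM -energyE//.
have mfin := nice_ball_fin_num z nm l0.
rewrite -[leLHS]fineK// -lee_pdivrMl// -EFinM mulrC.
apply: (@le_trans _ _ (\int[mu]_y ((2 * l) `^ (- sigma) * \1_(l2ball z l) y)%:E)%E).
  rewrite integral_Zindic ?powR_ge0//; last exact: measurable_l2ball.
  by rewrite powRN EFinM fineK// muleC.
apply: le_integral_nonmeas => y; rewrite lee_fin; first by rewrite mulr_ge0 ?powR_ge0.
have [yz|yz] := pselect (l2ball z l y); last first.
  rewrite indicE memNset// mulr0; exact: energy_density_ge0.
rewrite /energy_density (indic_in yz) (indic_in (sub _ yz)) mulr1 mul1r.
apply: ger_powRN => //; first by rewrite lt_max l0 orbT.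
rewrite ge_max; move: yz; rewrite /l2ball/= => yz.
have := ler_l2normD (q - z) (z - y); rewrite addrA subrK (l2norm_distC q z) (l2norm_distC z y).
by move=> h; apply/andP; split; lra.
Qed.

End Energy.

Section Translate.
Context {R : realType} {d : nat}.

(* As [sigma < d], the average over the translates of a fine grid is bounded
   uniformly, and some translate is no worse than the average. *)
Lemma exists_translate (s Lam b sigma : R) : 0 < sigma -> sigma < d%:R -> 0 < b ->
  exists2 C : R, 0 < C & forall mu : {measure set (borel_rV R d) -> \bar R},
  nice s Lam mu -> forall (G : finType) (P : G -> 'rV[R]_d) x (r Rad lam : R),
  0 < r -> 0 < Rad -> 0 < lam ->
  exists2 v : 'rV[R]_d, (forall i, 0 <= v 0 i <= b) &
    \sum_z energy mu (l2ball x Rad) (x + r *: (P z + v)) (lam * r) sigma <=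
      #|G|%:R * (C * (r `^ (- sigma) * (Lam * Rad `^ s))).
Proof.
move=> sg0 sgd b0; have [C C0 HC] := @sum_translate_le R d sigma b sg0 sgd b0.
exists C => // mu nm G P x r Rad lam r0 R0 l0.
(* This brings the mesh [b / m] of the translates below the truncation scale. *)
pose m := (Num.truncn (b / lam)).+1.
have M0 : 0 < m%:R :> R by rewrite ltr0n.
have bml : b / m%:R <= lam.
  rewrite ler_pdivrMr// mulrC -ler_pdivrMr//; apply: ltW; exact: truncnS_gt.
pose T (t : {ffun 'I_d -> 'I_m}) : 'rV[R]_d := \row_i (b * (t i)%:R / m%:R).
pose K := C * (r `^ (- sigma) * (Lam * Rad `^ s)).
pose e t := \sum_z energy mu (l2ball x Rad) (x + r *: (P z + T t)) (lam * r) sigma.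
have lr0 : 0 < lam * r by rewrite mulr_gt0.
have one z : \sum_t energy mu (l2ball x Rad) (x + r *: (P z + T t)) (lam * r) sigma <=
    m%:R ^+ d * K.
  rewrite -lee_fin -sumEFin.
  under eq_bigr do rewrite -(energyE nm _ _ R0 lr0 (ltW sg0)).
  rewrite -ge0_integral_sum//; last 2 first.
  - by move=> t; apply/measurable_EFinP; exact: measurable_energy_density.
  - by move=> t y _; rewrite lee_fin energy_density_ge0.
  apply: (@le_trans _ _ (\int[mu]_y
      ((r `^ (- sigma) * (C * m%:R ^+ d)) * \1_(l2ball x Rad) y)%:E)%E).
    apply: le_integral_nonmeas => y.
      by rewrite sume_ge0// => t _; rewrite lee_fin energy_density_ge0.
    rewrite sumEFin lee_fin -mulr_sumr mulrC ler_wpM2r//.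
    (* After rescaling by [r] around [x], the sum over the translates is the one bounded by [HC],
       uniformly in the target point [u]. *)
    pose u := r^-1 *: (y - x) - P z.
    apply: le_trans (ler_wpM2l (powR_ge0 r (- sigma)) (HC m lam u (ltn0Sn _) bml)).
    rewrite mulr_sumr; apply: ler_sum => t _.
    have E : Num.max (l2norm (x + r *: (P z + T t) - y)) (lam * r) =
       r * Num.max (l2norm (T t - u)) lam.
      rewrite maxr_pMr ?(ltW r0)// [lam * r]mulrC; congr (Num.max _ _).
      rewrite -[r in RHS]gtr0_norm// -l2normZ; congr l2norm.
      rewrite /u; apply/rowP => i; rewrite !mxE.
      by field; rewrite !gt_eqF.
    have mx0 : 0 <= Num.max (l2norm (T t - u)) lam by rewrite le_max (ltW l0) orbT.
    by rewrite E powRM ?(ltW r0).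
  have CC : 0 <= r `^ (- sigma) * (C * m%:R ^+ d).
    by rewrite mulr_ge0 ?powR_ge0// mulr_ge0 ?(ltW C0)// exprn_ge0// ltW.
  rewrite integral_Zindic//; last exact: measurable_l2ball.
  apply: (@le_trans _ _ ((r `^ (- sigma) * (C * m%:R ^+ d))%:E * (Lam * Rad `^ s)%:E)%E).
    by rewrite lee_wpmul2l ?lee_fin//; exact: nm.
  by rewrite -EFinM lee_fin le_eqVlt /K; apply/orP; left; apply/eqP; ring.
have tot : \sum_t e t <= m%:R ^+ d * (#|G|%:R * K).
  rewrite exchange_big/=; apply: (@le_trans _ _ (\sum_(z : G) m%:R ^+ d * K)).
    by apply: ler_sum => z _; exact: one.
  have sc (k : R) : \sum_(z : G) k = #|G|%:R * k by rewrite sumr_const mulr_natl.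
  by rewrite sc le_eqVlt; apply/orP; left; apply/eqP; ring.
have [t et] : exists t, e t <= #|G|%:R * K.
  apply: contrapT => /forallNP H.
  have : \sum_(t : {ffun 'I_d -> 'I_m}) (#|G|%:R * K) < \sum_t e t.
    apply: ltr_sum.
    - by apply/hasP; exists [ffun=> ord0]; rewrite ?mem_index_enum.
    - by move=> t _; rewrite ltNge; apply/negP; exact: H.
  have sc (k : R) : \sum_(t : {ffun 'I_d -> 'I_m}) k = m%:R ^+ d * k.
    by rewrite sumr_const card_ffun !card_ord -natrX mulr_natl.
  by rewrite sc ltNge tot.
exists (T t) => // i; rewrite mxE; apply/andP; split.
  by rewrite divr_ge0 ?mulr_ge0 ?(ltW b0) ?ler0n.
by rewrite ler_pdivrMr// ler_wpM2l ?(ltW b0)// ler_nat ltnW.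
Qed.

End Translate.

(** * Reflectionlessness against weighted bumps *)

Section BumpPairing.
Context {R : realType} {d : nat}.
Variables (s Lam : R) (mu : {measure set (borel_rV R d) -> \bar R}).
Hypotheses (s0 : 0 < s) (Lam0 : 0 < Lam) (nm : nice s Lam mu).
Local Notation B := (borel_rV R d).
Let m := nice_sigma_finite_measure nm.

Definition pairing_kernel (i : 'I_d) (f psi : 'rV[R]_d -> R) (p : B * B) : R :=
  riesz_kernel s (p.1 - p.2) 0 i * (2^-1 * (f p.2 * psi p.1 - psi p.2 * f p.1)).

Lemma integrable_indic_ball (x : 'rV[R]_d) (r k : R) : 0 < r ->
  mu.-integrable setT (fun y : B => (k * \1_(l2ball x r) y)%:E).
Proof.
move=> r0; apply/integrableP; split.
  apply/measurable_EFinP; apply: measurable_funM => //; exact: measurable_indic_l2ball.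
under eq_integral do rewrite abse_EFin normrM (ger0_norm (_ : 0 <= \1_(l2ball x r) _))//.
rewrite integral_Zindic//; last exact: measurable_l2ball.
by rewrite lte_mul_pinfty ?lee_fin// (le_lt_trans (nm _ r0)) ?ltry.
Qed.

Lemma integrable_smooth_kernel (psi : 'rV[R]_d -> R) q x Rad t i : 0 < t -> 0 < Rad ->
  measurable_fun setT (psi : B -> R) -> (forall x, 0 <= psi x <= 1) ->
  (forall y, ~ l2ball x Rad y -> psi y = 0) ->
  mu.-integrable setT (fun y : B => (psi y * smooth_kernel s t (q - y) i)%:E).
Proof.
move=> t0 R0 mpsi psi01 psi0.
apply: (@le_integrable _ _ _ mu setT _ _ _ _ _ (integrable_indic_ball x (t `^ (- s)) R0)) => //.
  apply/measurable_EFinP; apply: measurable_funM => //; exact: measurable_smooth_kernel.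
move=> y _; rewrite /= lee_fin (ger0_norm (mulr_ge0 (powR_ge0 _ _) _))// normrM.
have /andP[p0 p1] := psi01 y.
have [xy|xy] := pselect (l2ball x Rad y); last first.
  by rewrite (psi0 y xy) normr0 mul0r mulr_ge0 ?powR_ge0.
rewrite (indic_in xy) mulr1 (ger0_norm p0).
apply: le_trans (_ : `|smooth_kernel s t (q - y) i| <= _).
  by rewrite ler_piMl.
by apply: smooth_kernel_le => //; rewrite lerDr sqr_ge0.
Qed.

(** [q] is a grid point and [z] a support point near it. In [w], [c0] is the self-interaction of the
    bump, the energy term covers the distances up to [e] from [q], and the last term the comparison
    of kernels beyond [e]. The error is proportional to [I], as the later normalization demands. *)
Lemma bump_pairing (psi : 'rV[R]_d -> R) (q z x : 'rV[R]_d) (l e tau rho Rad c0 T ell : R) :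
  0 < l -> l <= tau -> 2 * l <= e -> 0 <= c0 -> 0 < Rad ->
  measurable_fun setT (psi : B -> R) -> (forall y, 0 <= psi y <= 1) ->
  (forall y, l2ball x rho y -> psi y = 1) -> (forall y, ~ l2ball x Rad y -> psi y = 0) ->
  rho <= Rad -> l2norm (z - q) < l -> l2ball z l `<=` l2ball x rho ->
  0 < ell < T -> T <= l / 2 -> (0 < mu (l2ball z (T - ell)))%E ->
  (mu (l2ball z T) <= (2 * 2 `^ s)%:E * mu (l2ball z (T - ell)))%E ->
  (forall x, l2ball z T x ->
    (\int[mu]_y (\1_(l2ball z (3 / 4 * l)) y *
       (l2norm (x - y) `^ (- s) * Num.min 1 (l2norm (x - y) / ell)))%:E
      <= c0%:E)%E) ->
  let w := c0 + ((7 `^ s + 1) * e `^ 2^-1 * energy mu (l2ball x Rad) q l (s + 2^-1) +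
    ((s + 2) * (2 * l) * (e / 7) `^ (- (s + 1)) +
            (s + 1) / 2 * tau ^+ 2 * e `^ (- (s + 2))) * (Lam * Rad `^ s)) in
  exists f : 'rV[R]_d -> R, let I := fine (\int[mu]_y (f y)%:E)%E in
  [/\ exists2 L, 0 <= L & forall y y', `|f y - f y'| <= L * l2norm (y - y'),
    (forall y, 0 <= f y <= 1) /\ (forall y, f y != 0 -> l2ball z l y),
    mu.-integrable setT (EFin \o (f : B -> R)) /\ 0 < I,
    forall i, (m \x m)%E.-integrable setT (EFin \o pairing_kernel i f psi) &
    forall i, `|fine (\int[(m \x m)%E]_p (pairing_kernel i f psi p)%:E)%E +
      I * fine (\int[mu]_y (psi y * smooth_kernel s tau (q - y) i)%:E)%E| <=
      2 * (2 * 2 `^ s) * w * I].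
Proof.
move=> l0 lt le c00 R0 mpsi psi01 psi1 psi0 rR zq zx /andP[ell0 eT] Tl muT mudb near w.
pose f := bump z T ell; exists f => I.
have T0 : 0 < T by apply: lt_trans eT.
have mf : measurable_fun setT (f : B -> R).
  by apply: continuous_measurable_rV; exact: continuous_bump.
have f01 y : 0 <= f y <= 1 by rewrite bump_ge0 bump_le1.
have fT y : f y != 0 -> l2ball z T y.
  move=> fy; rewrite /l2ball/= ltNge; apply/negP => /(bump_eq0 ell0) fy0.
  by rewrite /f fy0 eqxx in fy.
have fi : mu.-integrable setT (EFin \o (f : B -> R)).
  apply: (@le_integrable _ _ _ mu setT _ _ _ _ _ (integrable_indic_ball z 1 T0)) => //.
    exact/measurable_EFinP.
  move=> y _; rewrite /= lee_fin mul1r (ger0_norm (_ : 0 <= \1_(l2ball z T) y))//.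
  have /andP[y0 y1] := f01 y; rewrite ger0_norm//.
  by have [->//|/fT yT] := eqVneq (f y) 0; rewrite (indic_in yT).
have Te0 : 0 < T - ell by rewrite subr_gt0.
have IE : (\int[mu]_y (f y)%:E = I%:E)%E by rewrite /I fineK//; exact: integrable_fin_num.
have VI : (mu (l2ball z (T - ell)) <= I%:E)%E.
  rewrite -IE; apply: (@le_trans _ _ (\int[mu]_y (1 * \1_(l2ball z (T - ell)) y)%:E)%E).
    by rewrite integral_Zindic ?mul1e//; exact: measurable_l2ball.
  apply: le_integral_nonmeas => y; rewrite lee_fin mul1r//.
  have [yT|yT] := pselect (l2ball z (T - ell) y).
    rewrite (indic_in yT) /f (bump_eq1 ell0)//; exact: ltW.
  by rewrite indicE memNset//; case/andP: (f01 y).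
have I0 : 0 < I by rewrite -lte_fin; apply: lt_le_trans VI.
(* The doubling condition converts an error proportional to the mass of [B(z, T)] into one
   proportional to [I]. *)
have VA : fine (mu (l2ball z T)) <= 2 * 2 `^ s * I.
  rewrite -lee_fin fineK ?(nice_ball_fin_num z nm)//; apply: (le_trans mudb).
  by rewrite [leRHS]EFinM lee_wpmul2l// lee_fin mulr_ge0 ?powR_ge0.
pose C1 := (7 `^ s + 1) * e `^ 2^-1.
pose C2 := (s + 2) * (2 * l) * (e / 7) `^ (- (s + 1)) +
            (s + 1) / 2 * tau ^+ 2 * e `^ (- (s + 2)).
have C10 : 0 <= C1 by rewrite mulr_ge0 ?addr_ge0 ?powR_ge0.
have C20 : 0 <= C2.
  by rewrite addr_ge0// !mulr_ge0 ?powR_ge0 ?sqr_ge0//; move: s0 l0; lra.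
pose W2 y := C1 * energy_density (l2ball x Rad) q l (s + 2^-1) y + C2 * \1_(l2ball x Rad) y.
have W20 y : 0 <= W2 y.
  by rewrite (addr_ge0 (mulr_ge0 C10 (energy_density_ge0 _ _ _ _ _)))// mulr_ge0.
have med := @measurable_energy_density R d x Rad q l (s + 2^-1).
have mW2 : measurable_fun setT (W2 : B -> R).
  apply: measurable_funD; apply: measurable_funM => //; exact: measurable_indic_l2ball.
have q0 : 0 <= s + 2^-1 by move: s0; lra.
have intW2 : (\int[mu]_y (W2 y)%:E <=
    (C1 * energy mu (l2ball x Rad) q l (s + 2^-1) + C2 * (Lam * Rad `^ s))%:E)%E.
  apply: (@integral_le_add _ _ _ mu W2 (energy_density (l2ball x Rad) q l (s + 2^-1))
    (fun y => C2 * \1_(l2ball x Rad) y) C1) => //.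
  - by apply: measurable_funM => //; exact: measurable_indic_l2ball.
  - by move=> y; exact: energy_density_ge0.
  - by move=> y; exact: mulr_ge0.
  - by rewrite -(energyE nm).
  - rewrite integral_Zindic//; last exact: measurable_l2ball.
    by rewrite [leRHS]EFinM lee_wpmul2l ?lee_fin//; exact: nm.
have cmp i := @kernel_compare R d s i s0 q z T l e tau l0 Tl lt le zq.
have tau0 : 0 < tau by apply: lt_le_trans lt.
have w0 : 0 <= w.
  rewrite addr_ge0// addr_ge0 ?mulr_ge0 ?energy_ge0 ?powR_ge0// ?addr_ge0 ?powR_ge0//.
  exact: ltW.
have lT : T <= 3 / 4 * l by lra.
have b34 : l2ball z (3 / 4 * l) `<=` l2ball z l by apply: le_l2ball; lra.
have W2E y : l2ball x Rad y ->
    W2 y = C1 * Num.max (l2norm (q - y)) l `^ (- (s + 2^-1)) + C2.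
  by move=> yR; rewrite /W2 /energy_density (indic_in yR) mul1r mulr1.
have inR y : l2ball z l y -> l2ball x Rad y.
  by move=> /zx; exact: le_l2ball.
have core i : (m \x m)%E.-integrable setT (EFin \o pairing_kernel i f psi) /\
    `|fine (\int[(m \x m)%E]_p (pairing_kernel i f psi p)%:E)%E +
      I * fine (\int[mu]_y (psi y * smooth_kernel s tau (q - y) i)%:E)%E| <=
    2 * (w * fine (m (l2ball z T))).
  have [cmp1 cmp2] := cmp i.
  apply: (@core_integral R d s i m f psi _ W2 z T (3 / 4 * l) ell w) => //.
  - exact: measurable_smooth_kernel.
  - exact: (@integrable_smooth_kernel psi q x Rad tau i tau0 R0 mpsi psi01 psi0).
  - exact: (nice_ball_fin_num z nm T0).
  - exact: (bump_dist z T ell0).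
  - by move=> y /b34 /zx; exact: psi1.
  - by move=> y yb; rewrite W2E; [exact: cmp1|exact/inR/b34].
  - move=> u y uT yb py; rewrite W2E; first exact: cmp2.
    by apply: contrapT => /psi0 py0; rewrite py0 eqxx in py.
  - move=> u uT; rewrite -[w]/(c0 + _) -[c0 in leRHS]mul1r.
    apply: (integral_le_add _ _ mW2 _ _ W20 ler01 _ (near u uT) intW2).
    + apply: measurable_funD => //; apply: measurable_funM; first exact: measurable_indic_l2ball.
      apply: measurable_funM; first exact: measurable_l2dist_powR.
      apply: measurable_minr => //; apply: measurable_funM => //; exact: measurable_l2dist.
    + apply: measurable_funM; first exact: measurable_indic_l2ball.
      apply: measurable_funM; first exact: measurable_l2dist_powR.
      apply: measurable_minr => //; apply: measurable_funM => //; exact: measurable_l2dist.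
    + move=> y; rewrite addr_ge0 ?W20// !mulr_ge0 ?powR_ge0// le_min ler01/=.
      by rewrite divr_ge0 ?l2norm_ge0 ?(ltW ell0).
    + move=> y; rewrite !mulr_ge0 ?powR_ge0// le_min ler01/=.
      by rewrite divr_ge0 ?l2norm_ge0 ?(ltW ell0).
    + by move=> y; rewrite mul1r.
split.
- exists ell^-1 => [|y y']; first by rewrite invr_ge0 ltW.
  by apply: le_trans (bump_dist z T ell0 y y') _; rewrite ge_min mulrC lexx orbT.
- split => // y /fT; apply: le_l2ball; lra.
- by [].
- by move=> i; have [] := core i.
- move=> i; have [_ h] := core i; apply: (le_trans h).
  have -> : 2 * (2 * 2 `^ s) * w * I = 2 * (w * (2 * 2 `^ s * I)) by ring.
  by rewrite ler_wpM2l// ler_wpM2l.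
Qed.

End BumpPairing.

Section FluxBound.
Context {R : realType} {d : nat}.
Variables (s Lam : R) (mu : {measure set (borel_rV R d) -> \bar R}).
Hypotheses (s0 : 0 < s) (Lam0 : 0 < Lam) (nm : nice s Lam mu).
Hypothesis refl : reflectionless s mu.
Local Notation B := (borel_rV R d).
Let m := nice_sigma_finite_measure nm.

(* The test function is [\sum_z w z * F z / \int F z], whose mean is [\sum_z w z]. *)
Lemma flux_bound (i : 'I_d) (G : finType) (w err J : G -> R)
    (F : G -> 'rV[R]_d -> R) (x : 'rV[R]_d) (r rho Rad Cw : R) :
  0 < r -> 6 * r <= rho -> rho < Rad -> 0 <= Cw ->
  \sum_z w z = 0 -> \sum_z `|w z| <= Cw -> (forall z, 0 <= err z) ->
  (forall z, w z != 0 ->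
    [/\ exists2 L, 0 <= L & forall y y', `|F z y - F z y'| <= L * l2norm (y - y'),
      (forall y, 0 <= F z y) /\ (forall y, F z y != 0 -> l2ball x (3 * r) y),
      mu.-integrable setT (EFin \o (F z : B -> R)) /\
        0 < fine (\int[mu]_y (F z y)%:E)%E,
      (m \x m)%E.-integrable setT (EFin \o pairing_kernel s i (F z) (bump x Rad (Rad - rho))) &
      `|fine (\int[(m \x m)%E]_p (pairing_kernel s i (F z) (bump x Rad (Rad - rho)) p)%:E)%E +
        fine (\int[mu]_y (F z y)%:E)%E * J z| <= err z * fine (\int[mu]_y (F z y)%:E)%E]) ->
  `|\sum_z w z * J z| <= (s + 2) * 3 * 2 `^ (s + 1) * Cw * (2 * 2 `^ s * Lam) * (r / rho) +
    \sum_z `|w z| * err z.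
Proof.
move=> r0 r6 rR Cw0 sw0 swC err0 HF.
pose psi := bump x Rad (Rad - rho).
have dR0 : 0 < Rad - rho by rewrite subr_gt0.
have psi1 y : l2ball x rho y -> psi y = 1.
  by rewrite /l2ball/= => yr; apply: bump_eq1 => //; rewrite opprB addrCA subrr addr0 ltW.
have psi01 y : 0 <= psi y <= 1 by rewrite bump_ge0 bump_le1.
pose I z := fine (\int[mu]_y (F z y)%:E)%E.
have I0 z : w z != 0 -> 0 < I z by move=> /HF[_ _ []].
(* Nothing is known about [F z] where the weight vanishes, so sums that involve it are restricted to
   [act]. *)
pose act z := w z != 0.
pose c z := w z / I z.
pose f y := \sum_(z | act z) c z * F z y.
have fB y : f y != 0 -> l2ball x (3 * r) y.
  move=> fy; apply: contrapT => nb; move: fy; rewrite /f big1 ?eqxx// => z wz.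
  have [_ [_ h] _ _ _] := HF z wz.
  have [->|/h//] := eqVneq (F z y) 0; by rewrite mulr0.
have fL : exists L, forall y y', `|f y - f y'| <= L * l2norm (y - y').
  have /choice[L HL] : forall z, exists L, w z != 0 -> forall y y',
      `|F z y - F z y'| <= L * l2norm (y - y').
    move=> z; have [wz|wz] := eqVneq (w z) 0; first by exists 0.
    by have [[L _ HL] _ _ _ _] := HF z wz; exists L.
  exists (\sum_(z | act z) `|c z| * L z) => y y'.
  rewrite /f -sumrB mulr_suml; apply: le_trans (ler_norm_sum _ _ _) _.
  apply: ler_sum => z wz; rewrite -mulrBr normrM -mulrA ler_wpM2l//.
  exact: HL.
have fLip0 : Lip0 f.
  have [L HL] := fL; apply: (Lip0_of_ball HL (x := x) (r := 3 * r)) => y y3.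
  apply/eqP; apply: contrapT => /negP/fB; rewrite /l2ball/= => y3'.
  by have := lt_trans y3 y3'; rewrite ltxx.
have c0 z : w z = 0 -> c z = 0 by move=> wz; rewrite /c wz mul0r.
have int_c z : mu.-integrable setT (fun y : B => (c z * F z y)%:E).
  have [/c0 cz|wz] := eqVneq (w z) 0.
    apply: eq_integrable (integrable0 _ _) => // y _ /=.
    by rewrite cz mul0r.
  have [_ _ [Fi _] _ _] := HF z wz.
  have -> : (fun y : B => (c z * F z y)%:E) = (fun y => (c z)%:E * (EFin \o F z) y)%E by [].
  exact: integrableZl.
have fE : EFin \o (f : B -> R) = (fun y => \sum_(z | act z) (c z * F z y)%:E)%E.
  by apply/funext => y; rewrite /= sumEFin.
have fi : mu.-integrable setT (EFin \o (f : B -> R)).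
  by rewrite fE; apply: integrable_sum => // z; exact: int_c.
have IE z : w z != 0 -> (\int[mu]_y (F z y)%:E = (I z)%:E)%E.
  by move=> wz; have [_ _ [Fi _] _ _] := HF z wz; rewrite fineK//; exact: integrable_fin_num Fi.
have cI z : w z != 0 -> c z * I z = w z.
  by move=> wz; rewrite divfK// gt_eqF// I0.
have sumP (g : G -> R) : (forall z, w z = 0 -> g z = 0) -> \sum_z g z = \sum_(z | act z) g z.
  move=> g0; rewrite [LHS](bigID act)/= [X in _ + X]big1 ?addr0// => z.
  by rewrite /act negbK => /eqP/g0.
have f0 : (\int[mu]_y (f y)%:E = 0)%E.
  transitivity (\int[mu]_y \sum_(z | act z) (c z * F z y)%:E)%E.
    by apply: eq_integral => y _; rewrite sumEFin.
  rewrite integral_sum//.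
  transitivity (\sum_(z | act z) (w z)%:E)%E.
    apply: eq_bigr => z wz; under eq_integral do rewrite EFinM.
    have [_ _ [Fi _] _ _] := HF z wz.
    by rewrite integralZl// IE// -EFinM cI.
  by rewrite sumEFin -sumP// sw0.
have fC : (\int[mu]_y `|f y|%:E <= Cw%:E)%E.
  apply: (@le_trans _ _ (\int[mu]_y \sum_(z | act z) (`|c z| * F z y)%:E)%E).
    apply: le_integral_nonmeas => y; first by rewrite lee_fin.
    rewrite sumEFin lee_fin; apply: le_trans (ler_norm_sum _ _ _) _.
    apply: ler_sum => z wz; have [_ [F0 _] _ _ _] := HF z wz.
    by rewrite normrM (ger0_norm (F0 y)).
  rewrite integral_sum//; last first.
    move=> z; have [/c0 cz|wz] := eqVneq (w z) 0.
      apply: eq_integrable (integrable0 _ _) => // y _ /=.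
      by rewrite cz normr0 mul0r.
    have [_ _ [Fi _] _ _] := HF z wz.
    have -> : (fun y : B => (`|c z| * F z y)%:E) = (fun y => (`|c z|)%:E * (EFin \o F z) y)%E by [].
    exact: integrableZl.
  apply: (@le_trans _ _ (\sum_(z | act z) (`|w z|)%:E)%E).
    apply: lee_sum => z wz; under eq_integral do rewrite EFinM.
    have [_ _ [Fi _] _ _] := HF z wz.
    rewrite integralZl// IE// -EFinM lee_fin -(cI z wz) [leRHS]normrM.
    by rewrite (gtr0_norm (I0 z wz)).
  by rewrite sumEFin lee_fin -sumP// => z ->; rewrite normr0.
have cut : cutoff_for f psi.
  split; first by apply: (Lip0_of_ball (x := x) (r := Rad) (L := (Rad - rho)^-1));
    [move=> y y'; apply: le_trans (bump_dist x Rad dR0 y y') _; rewrite ge_min mulrC lexx orbT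
    |move=> y yR; exact/(bump_eq0 dR0)/ltW].
  exists (l2ball x rho); last exact: psi1.
  split; first exact: open_l2ball.
  apply: (@subset_trans _ [set y | l2norm (y - x) <= 3 * r]); last first.
    by move=> y; rewrite /l2ball/= => /le_lt_trans; apply; lra.
  rewrite [X in _ `<=` X](iffLR (closure_id _) (@closed_l2ball_closed R d x (3 * r))).
  by apply: closureS => y /fB; rewrite /l2ball/= => /ltW.
have := refl fLip0 f0 cut => /rowP /(_ i); rewrite !mxE => pair0.
have tail := riesz_tail i s0 Lam0 nm r0 r6 Cw0 fi f0 fC fB psi01 psi1.
set tl := fine (\int[mu]_y _)%E in pair0 tail.
pose Pz z := fine (\int[(m \x m)%E]_p (pairing_kernel s i (F z) psi p)%:E)%E.
have pairE : fine (\int[(mu \x mu)%E]_p (pairing_kernel s i f psi p)%:E)%E =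
    \sum_(z | act z) c z * Pz z.
  rewrite -[(mu \x mu)%E]/((m \x m)%E).
  transitivity (fine (\int[(m \x m)%E]_p \sum_(z | act z) ((c z)%:E *
      (EFin \o pairing_kernel s i (F z) psi) p))%E).
    congr fine; apply: eq_integral => p _.
    under eq_bigr do rewrite /= -EFinM.
    rewrite sumEFin; congr EFin; rewrite /pairing_kernel /f !mulr_suml mulr_sumr -sumrB.
    by rewrite !mulr_sumr; apply: eq_bigr => z _; ring.
  rewrite integral_sum//; last first.
    move=> z; have [/c0 cz|wz] := eqVneq (w z) 0.
      apply: eq_integrable (integrable0 _ _) => // p _ /=.
      by rewrite cz mul0e.
    by have [_ _ _ Pi _] := HF z wz; exact: integrableZl.
  transitivity (fine (\sum_(z | act z) (c z * Pz z)%:E)%E); last by rewrite sumEFin.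
  congr fine; apply: eq_bigr => z wz; have [_ _ _ Pi _] := HF z wz.
  by rewrite integralZl// [RHS]EFinM fineK//; exact: integrable_fin_num Pi.
have {}pair0 : \sum_(z | act z) c z * Pz z + tl = 0 by rewrite -pairE.
rewrite (sumP (fun z => w z * J z)); last by move=> z ->; rewrite mul0r.
rewrite (sumP (fun z => `|w z| * err z)); last by move=> z ->; rewrite normr0 mul0r.
(* Reflectionlessness says that the sum of [c z * Pz z] is [- tl], so the pairings are traded for
   the tail, and only the approximation errors [Pz z + I z * J z] remain. *)
have -> : \sum_(z | act z) w z * J z = \sum_(z | act z) c z * (Pz z + I z * J z) + tl.
  transitivity (\sum_(z | act z) (c z * (Pz z + I z * J z) - c z * Pz z)).
    by apply: eq_bigr => z wz; rewrite -[in LHS](cI z wz); ring.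
  by rewrite sumrB; congr (_ + _); move: pair0; lra.
apply: le_trans (ler_normD _ _) _; rewrite addrC; apply: lerD => //.
apply: le_trans (ler_norm_sum _ _ _) _; apply: ler_sum => z wz.
have [_ _ _ _ He] := HF z wz; rewrite normrM.
apply: le_trans (ler_wpM2l (normr_ge0 _) He) _; rewrite -/(I z).
have -> : `|w z| = `|c z| * I z.
  by rewrite -(cI z wz) [LHS]normrM (gtr0_norm (I0 z wz)).
by rewrite le_eqVlt; apply/orP; left; apply/eqP; ring.
Qed.

End FluxBound.

Section FluxLower.
Context {R : realType} {d : nat}.
Variables (s Lam : R) (mu : {measure set (borel_rV R d) -> \bar R}).
Hypotheses (s0 : 0 < s) (Lam0 : 0 < Lam) (nm : nice s Lam mu).
Local Notation B := (borel_rV R d).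

(** Under the rescaling [u = (y - x) / r - v] the integrand becomes the grid sum bounded below by
    hypothesis. At least [c - kap] is gained on [B(x, r)], where [|u| <= 1 + 1/4], and at most [kap]
    is lost elsewhere in [B(x, Rad)]; homogeneity of the kernel yields [r^(-s)]. *)
Lemma flux_lower (G : finType) (P : G -> 'rV[R]_d) (w : G -> 'I_d -> R)
    (psi : 'rV[R]_d -> R) (x v : 'rV[R]_d) (c kap tau r Rad : R) :
  0 < r -> 0 < tau -> r <= Rad -> 0 <= c -> 0 <= kap -> l2norm v <= 1 / 4 ->
  (forall y, c * (l2norm y <= 5 / 4)%R%:R - kap <=
       \sum_z \sum_i w z i * smooth_kernel s tau (P z - y) i) ->
  measurable_fun setT (psi : B -> R) -> (forall y, 0 <= psi y <= 1) ->
  (forall y, l2ball x r y -> psi y = 1) -> (forall y, ~ l2ball x Rad y -> psi y = 0) ->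
  r `^ (- s) * (c * fine (mu (l2ball x r)) - kap * fine (mu (l2ball x Rad))) <=
  \sum_i \sum_z w z i *
    fine (\int[mu]_y (psi y * smooth_kernel s (r * tau) (x + r *: (P z + v) - y) i)%:E)%E.
Proof.
move=> r0 t0 rR c0 k0 v4 Sl mpsi psi01 psi1 psi0.
have R0 : 0 < Rad by apply: lt_le_trans rR.
have rt0 : 0 < r * tau by rewrite mulr_gt0.
pose g i z y := w z i * (psi y * smooth_kernel s (r * tau) (x + r *: (P z + v) - y) i).
have ki i z : mu.-integrable setT (fun y : B =>
    (psi y * smooth_kernel s (r * tau) (x + r *: (P z + v) - y) i)%:E).
  exact: (integrable_smooth_kernel s0 nm _ i rt0 R0 mpsi psi01 psi0).
have gi i z : mu.-integrable setT (EFin \o (g i z : B -> R)).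
  have -> : EFin \o (g i z : B -> R) = (fun y => (w z i)%:E *
      (psi y * smooth_kernel s (r * tau) (x + r *: (P z + v) - y) i)%:E)%E by [].
  exact: integrableZl (ki i z).
have sgi i : mu.-integrable setT (fun y => \sum_z (g i z y)%:E)%E.
  by apply: (@integrable_sum _ _ _ mu setT _ _ _ _ (fun z => EFin \o (g i z : B -> R))) => // z;
    exact: gi.
have -> : \sum_i \sum_z w z i *
    fine (\int[mu]_y (psi y * smooth_kernel s (r * tau) (x + r *: (P z + v) - y) i)%:E)%E =
  fine (\int[mu]_y (\sum_i \sum_z (g i z y)%:E))%E.
  rewrite integral_sum//.
  transitivity (fine (\sum_i (\sum_z w z i *
    fine (\int[mu]_y (psi y * smooth_kernel s (r * tau) (x + r *: (P z + v) - y) i)%:E)%E)%:E)%E).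
    by rewrite sumEFin.
  congr fine; apply: eq_bigr => i _; rewrite integral_sum//; last by move=> z; exact: (gi i z).
  rewrite -sumEFin; apply: eq_bigr => z _; rewrite /g EFinM.
  under eq_integral do rewrite EFinM.
  by rewrite integralZl// fineK//; exact: integrable_fin_num (ki i z).
have mfin y t : 0 < t -> mu (l2ball y t) \is a fin_num by exact: (nice_ball_fin_num _ nm).
have ci y t k : 0 < t -> mu.-integrable setT (fun u : B => (k * \1_(l2ball y t) u)%:E).
  by move=> ?; exact: (integrable_indic_ball nm).
have rs0 : 0 <= r `^ (- s) by exact: powR_ge0.
have E : (\int[mu]_y ((r `^ (- s) * c) * \1_(l2ball x r) y -
     (r `^ (- s) * kap) * \1_(l2ball x Rad) y)%:E =
   (r `^ (- s) * (c * fine (mu (l2ball x r)) - kap * fine (mu (l2ball x Rad))))%:E)%E.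
  under eq_integral do rewrite EFinB.
  rewrite integralB//; [|exact: ci..].
  rewrite !integral_Zindic ?mulr_ge0//; [|exact: measurable_l2ball..].
  rewrite -(fineK (mfin x r r0)) -(fineK (mfin x Rad R0)) -!EFinM -EFinB.
  by congr EFin; rewrite /=; ring.
rewrite -lee_fin -E fineK; last first.
  by apply: integrable_fin_num => //; apply: integrable_sum => // i; exact: sgi.
apply: le_integral => //.
- have -> : (fun y : B => ((r `^ (- s) * c) * \1_(l2ball x r) y -
     (r `^ (- s) * kap) * \1_(l2ball x Rad) y)%:E) =
     ((fun y : B => ((r `^ (- s) * c) * \1_(l2ball x r) y)%:E) \-
      (fun y : B => ((r `^ (- s) * kap) * \1_(l2ball x Rad) y)%:E))%E by [].
  by apply: integrableB => //; exact: ci.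
- by apply: integrable_sum => // i; exact: sgi.
move=> y _; under eq_bigr do rewrite sumEFin.
rewrite sumEFin lee_fin.
pose u := r^-1 *: (y - x) - v.
have -> : \sum_i \sum_z g i z y = psi y * (r `^ (- s) *
    \sum_z \sum_i w z i * smooth_kernel s tau (P z - u) i).
  rewrite exchange_big/= !mulr_sumr; apply: eq_bigr => z _.
  rewrite !mulr_sumr; apply: eq_bigr => i _; rewrite /g.
  have -> : x + r *: (P z + v) - y = r *: (P z - u).
    by rewrite /u; apply/rowP => j; rewrite !mxE; field; rewrite gt_eqF.
  by rewrite (smooth_kernel_scale _ _ _ _ r0); ring.
have [yR|yR] := pselect (l2ball x Rad y); last first.
  rewrite (psi0 y yR) mul0r (indicE _ (l2ball x Rad)) memNset// mulr0 subr0.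
  have yr : ~ l2ball x r y by move=> /(le_l2ball rR).
  by rewrite indicE memNset// mulr0.
rewrite (indic_in yR) mulr1; have /andP[p0 p1] := psi01 y.
have Su := Sl u; set S := \sum_z _ in Su *.
have [yr|yr] := pselect (l2ball x r y).
  rewrite (indic_in yr) (psi1 y yr) mul1r mulr1 -mulrBr ler_wpM2l//.
  have u54 : l2norm u <= 5 / 4.
    apply: le_trans (_ : l2norm (r^-1 *: (y - x)) + l2norm v <= _).
      by rewrite -(l2normN v); exact: ler_l2normD.
    have : l2norm (r^-1 *: (y - x)) <= 1.
      rewrite l2normZ gtr0_norm ?invr_gt0// mulrC ler_pdivrMr// mul1r.
      exact: ltW.
    lra.
  by move: Su; rewrite u54 mulr1.
rewrite indicE memNset// mulr0 sub0r.
have : - kap <= S.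
  by apply: le_trans Su; rewrite lerBrDr addNr mulr_ge0.
move=> /(ler_wpM2l rs0); rewrite mulrN => H.
(* The cutoff takes values in [[0, 1]], so it cannot deepen a negative value. *)
have [S0|S0] := leP 0 (r `^ (- s) * S).
  apply: (@le_trans _ _ 0); last by rewrite mulr_ge0.
  by rewrite oppr_le0 mulr_ge0.
apply: le_trans H _; rewrite -[leLHS]mul1r ler_wnM2r// ltW//.
Qed.

End FluxLower.

(** * The flux through the grid *)

Section PorousAtScale.
Context {R : realType} {d : nat}.
Variables (s Lam : R) (mu : {measure set (borel_rV R d) -> \bar R}).
Hypotheses (s0 : 0 < s) (Lam0 : 0 < Lam) (nm : nice s Lam mu) (refl : reflectionless s mu).
Local Notation B := (borel_rV R d).

(** Each coordinate of the reflectionless identity is tested with its own weights [w ^~ i], but a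
    single family of bumps, one near each relevant grid point, serves all coordinates. The energy
    hypothesis supplies the low density under which a bump exists. *)
Lemma flux_upper (G : finType) (P : G -> 'rV[R]_d) (w : G -> 'I_d -> R)
    (x v : 'rV[R]_d) (c0 th lam e tau r rho Rad : R) :
  0 < r -> 0 < lam -> lam <= r / 20 -> lam <= tau -> 2 * lam <= e -> 0 < c0 ->
  6 * r <= rho -> rho < Rad -> (0 < #|G|)%N -> l2norm v <= 1 / 4 ->
  (forall i, \sum_z w z i = 0) -> (forall z i, `|w z i| <= 6 ^+ d / #|G|%:R) ->
  (forall z i, w z i != 0 -> l2norm (P z) <= 9 / 4) ->
  (forall q, l2norm (q - x) <= 5 / 2 * r -> exists2 z, measure_supp mu z & l2norm (z - q) < lam) ->
  (forall (z : 'rV[R]_d) l, 0 < l ->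
    measure_supp mu z -> (mu (l2ball z l) <= (th * l `^ s)%:E)%E ->
    exists T ell, [/\ 0 < ell < T, T <= l / 2,
    (0 < mu (l2ball z (T - ell)))%E,
    (mu (l2ball z T) <= (2 * 2 `^ s)%:E * mu (l2ball z (T - ell)))%E &
    forall x, l2ball z T x ->
    (\int[mu]_y (\1_(l2ball z (3 / 4 * l)) y *
       (l2norm (x - y) `^ (- s) * Num.min 1 (l2norm (x - y) / ell)))%:E
      <= c0%:E)%E]) ->
  (forall z, (2 * lam) `^ (s + 2^-1) *
     energy mu (l2ball x Rad) (x + r *: (P z + v)) lam (s + 2^-1) <= th * lam `^ s) ->
  forall (psi : 'rV[R]_d -> R) (W : G -> R), psi = bump x Rad (Rad - rho) ->
  (forall z, W z = c0 + ((7 `^ s + 1) * e `^ 2^-1 *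
      energy mu (l2ball x Rad) (x + r *: (P z + v)) lam (s + 2^-1) +
    ((s + 2) * (2 * lam) * (e / 7) `^ (- (s + 1)) +
            (s + 1) / 2 * tau ^+ 2 * e `^ (- (s + 2))) * (Lam * Rad `^ s))) ->
  \sum_i \sum_z w z i *
    fine (\int[mu]_y (psi y * smooth_kernel s tau (x + r *: (P z + v) - y) i)%:E)%E <=
  d%:R * ((s + 2) * 3 * 2 `^ (s + 1) * 6 ^+ d * (2 * 2 `^ s * Lam) * (r / rho) +
    6 ^+ d / #|G|%:R * \sum_z (2 * (2 * 2 `^ s) * W z)).
Proof.
move=> r0 l0 lr lt le c00 r6 rR G0 v4 sw wC wP supp Hth en psi W psiE WE.
have G0' : 0 < #|G|%:R :> R by rewrite ltr0n.
have R0 : 0 < Rad by lra.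
have dR0 : 0 < Rad - rho by rewrite subr_gt0.
have sg0 : 0 < s + 2^-1 by move: s0; lra.
have tau0 : 0 < tau by apply: lt_le_trans lt.
pose q z := x + r *: (P z + v).
have psi1 y : l2ball x rho y -> psi y = 1.
  by rewrite /l2ball/= => yr; rewrite psiE; apply: bump_eq1 => //;
    rewrite opprB addrCA subrr addr0 ltW.
have psi0 y : ~ l2ball x Rad y -> psi y = 0.
  by move=> yR; rewrite psiE; apply: (bump_eq0 dR0); rewrite leNgt; exact/negP.
have psi01 y : 0 <= psi y <= 1 by rewrite psiE bump_ge0 bump_le1.
have mpsi : measurable_fun setT (psi : B -> R).
  by rewrite psiE; apply: continuous_measurable_rV; exact: continuous_bump.
have W0 z : 0 <= W z.
  rewrite WE addr_ge0 ?(ltW c00)// addr_ge0//.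
    by rewrite mulr_ge0 ?energy_ge0// mulr_ge0 ?powR_ge0// addr_ge0 ?powR_ge0.
  have LR : 0 <= Lam * Rad `^ s by rewrite mulr_ge0 ?powR_ge0 ?ltW.
  rewrite (mulr_ge0 _ LR)// addr_ge0// !mulr_ge0 ?powR_ge0 ?sqr_ge0//; move: s0 l0 tau0; lra.
pose m := nice_sigma_finite_measure nm.
have /choice[F HF] : forall z, exists f : 'rV[R]_d -> R, forall i, w z i != 0 ->
    [/\ exists2 L, 0 <= L & forall y y', `|f y - f y'| <= L * l2norm (y - y'),
      (forall y, 0 <= f y) /\ (forall y, f y != 0 -> l2ball x (3 * r) y),
      mu.-integrable setT (EFin \o (f : B -> R)) /\
        0 < fine (\int[mu]_y (f y)%:E)%E,
      (m \x m)%E.-integrable setT (EFin \o pairing_kernel s i f psi) &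
      `|fine (\int[(m \x m)%E]_p (pairing_kernel s i f psi p)%:E)%E +
        fine (\int[mu]_y (f y)%:E)%E *
          fine (\int[mu]_y (psi y * smooth_kernel s tau (q z - y) i)%:E)%E| <=
        2 * (2 * 2 `^ s) * W z * fine (\int[mu]_y (f y)%:E)%E].
  (* Grid points beyond 9/4 carry no weight, so any function serves. The others are within
     [(9/4 + 1/4) r] of [x]; passing to a support point and then to its ball adds at most
     [2 r / 20], which stays within [3 r]. *)
  move=> z; have [Pz|Pz] := leP (l2norm (P z)) (9 / 4); last first.
    by exists (fun=> 0) => i /wP Pz'; move: (lt_le_trans Pz Pz'); rewrite ltxx.
  have qx : l2norm (q z - x) <= 5 / 2 * r.
    rewrite /q addrAC subrr add0r l2normZ gtr0_norm// mulrC ler_pM2r//.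
    apply: le_trans (ler_l2normD _ _) _; lra.
  have [z' z's z'q] := supp _ qx.
  have z'x : l2norm (z' - x) <= 5 / 2 * r + r / 20.
    have := ler_l2normD (z' - q z) (q z - x); rewrite addrA subrK; lra.
  have sub3 : l2ball z' lam `<=` l2ball x (3 * r).
    move=> y; rewrite /l2ball/= => yz'.
    have := ler_l2normD (y - z') (z' - x); rewrite addrA subrK; lra.
  have subrho : l2ball z' lam `<=` l2ball x rho.
    by apply: subset_trans sub3 _; apply: le_l2ball; lra.
  have subR : l2ball z' lam `<=` l2ball x Rad.
    by apply: subset_trans subrho _; apply: le_l2ball; lra.
  have mass : (mu (l2ball z' lam) <= (th * lam `^ s)%:E)%E.
    apply: le_trans (energy_mass nm R0 l0 (ltW sg0) z'q subR) _.
    by rewrite lee_fin; exact: en.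
  have [T [ell [eT Tl muT mudb near]]] := Hth z' lam l0 z's mass.
  have [f [fL [f01 fB] [fi fI] fp fe]] := bump_pairing s0 Lam0 nm l0 lt le (ltW c00) R0
    mpsi psi01 psi1 psi0 (ltW rR) z'q subrho eT Tl muT mudb near.
  exists f => i _; split => //; last by rewrite WE; exact: fe.
  split; first by move=> y; case/andP: (f01 y).
  by move=> y /fB; exact: sub3.
rewrite psiE in HF *.
have sd (k : R) : d%:R * k = \sum_(i < d) k by rewrite sumr_const card_ord mulr_natl.
rewrite sd; apply: ler_sum => i _; apply: le_trans (ler_norm _) _.
have C0 : 0 <= 6 ^+ d :> R by rewrite exprn_ge0.
have sc (k : R) : \sum_(z : G) k = #|G|%:R * k by rewrite sumr_const mulr_natl.
have swC : \sum_z `|w z i| <= 6 ^+ d.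
  apply: le_trans (ler_sum _ (fun z _ => wC z i)) _.
  by rewrite sc mulrC divfK// gt_eqF.
have err0 z : 0 <= 2 * (2 * 2 `^ s) * W z by rewrite !mulr_ge0 ?powR_ge0.
have FB := @flux_bound R d s Lam mu s0 Lam0 nm refl i G (w ^~ i)
  (fun z => 2 * (2 * 2 `^ s) * W z)
  (fun z => fine (\int[mu]_y (bump x Rad (Rad - rho) y * smooth_kernel s tau (q z - y) i)%:E)%E)
  F x r rho Rad (6 ^+ d) r0 r6 rR C0 (sw i) swC err0 (fun z => HF z i).
apply: le_trans FB _.
rewrite lerD2l mulr_sumr; apply: ler_sum => z _.
by rewrite ler_wpM2r.
Qed.

End PorousAtScale.

(** * Choice of the constants and conclusion *)

Theorem proposition9p2 (R : realType) (d : nat) (s Lam : R)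
    (s_gt0 : 0 < s) (s_le : s <= d%:R - 1) (Lam_gt0 : 0 < Lam) :
  forall eps : R, 0 < eps ->
  exists2 lam : R, 0 < lam &
  forall mu : {measure set (borel_rV R d) -> \bar R},
    locally_finite mu -> nice s Lam mu -> reflectionless s mu ->
  forall (x : 'rV[R]_d) (r : R), 0 < r ->
    ((eps * r `^ s)%:E < mu (l2ball x r))%E ->
  exists y : 'rV[R]_d,
    l2ball y (lam * r) `<=` l2ball x (3 * r) /\
    l2ball y (lam * r) `&` measure_supp mu = set0.
Proof.
move=> eps eps0.
have [c c0 Hc] := divergence_grid s_gt0 s_le.
have d0 : 0 < d%:R :> R by lra.
pose sg := s + 2^-1.
have sg0 : 0 < sg by rewrite /sg; lra.
have sgd : sg < d%:R by rewrite /sg; lra.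
pose b : R := 1 / 4 / d%:R.
have b0 : 0 < b by rewrite divr_gt0.
have [CE CE0 HCE] := exists_translate s Lam sg0 sgd b0.
(* The unit of the error budget. The lower bound keeps [7 de], one unit being lost to [kap]; the
   upper bound spends five, on the tail, the bumps, the energy, the displacement to support points
   and the smoothing. *)
pose de := c * eps / 8.
have de0 : 0 < de by rewrite divr_gt0// mulr_gt0.
have deE : 8 * de = c * eps by rewrite /de; field.
clearbody de.
have P2 : 0 < 2 `^ s :> R by rewrite powR_gt0.
have P21 : 0 < 2 `^ (s + 1) :> R by rewrite powR_gt0.
have C6 : 0 < 6 ^+ d :> R by rewrite exprn_gt0.
pose Ct := (s + 2) * 3 * 2 `^ (s + 1) * 6 ^+ d * (2 * 2 `^ s * Lam).
have Ct0 : 0 < Ct by rewrite !mulr_gt0//; lra.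
(* A cutoff radius [rho * r] at which the tail costs at most one unit. *)
pose rho := Num.max 6 (d%:R * Ct / de).
have rho6 : 6 <= rho by rewrite le_max lexx.
have rho0 : 0 < rho by lra.
have rhoC : d%:R * Ct / rho <= de.
  by rewrite ler_pdivrMr// -ler_pdivrMl// mulrC le_max lexx orbT.
pose ML := Lam * (2 * rho) `^ s.
have ML0 : 0 < ML by rewrite mulr_gt0// powR_gt0// mulr_gt0.
pose K0 := d%:R * 6 ^+ d * (2 * (2 * 2 `^ s)).
have K00 : 0 < K0 by rewrite !mulr_gt0.
pose kz := de / K0.
have kz0 : 0 < kz by rewrite divr_gt0.
have [th th0 Hth] := @exists_bump_radius R d s Lam s_gt0 Lam_gt0 kz kz0.
have P7 : 0 < 7 `^ s + 1 :> R by rewrite ltr_wpDl ?powR_ge0.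
pose X1 := K0 * ((7 `^ s + 1) * (CE * ML)).
have X10 : 0 < X1 by exact: mulr_gt0 K00 (mulr_gt0 P7 (mulr_gt0 CE0 ML0)).
(* Up to distance [eta * r] the kernels are bounded through the energy, which costs
   [X1 * eta^(1/2)], exactly one unit. *)
pose eta := (de / X1) ^+ 2.
have eta0 : 0 < eta by rewrite exprn_gt0// divr_gt0.
have etaE : X1 * eta `^ 2^-1 = de.
  rewrite powR12_sqrt ?(ltW eta0)// sqrtr_sqr ger0_norm ?divr_ge0 ?(ltW de0) ?(ltW X10)//.
  by rewrite mulrC divfK// gt_eqF.
pose X2 := K0 * ((s + 1) / 2 * eta `^ (- (s + 2)) * ML).
have s12 : 0 < (s + 1) / 2 by lra.
have X20 : 0 < X2.
  by exact: mulr_gt0 K00 (mulr_gt0 (mulr_gt0 s12 (powR_gt0 _ eta0)) ML0).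
(* Beyond [eta * r] smoothing costs [X2 * tau^2]; the bound by 1/4 is the range in which [c] is
   uniform. *)
pose tau := Num.min (1 / 4) (de / X2).
have tau0 : 0 < tau by rewrite lt_min (divr_gt0 de0 X20) divr_gt0.
have tau4 : tau <= 1 / 4 by rewrite ge_min lexx.
have tauE : X2 * tau ^+ 2 <= de.
  have : tau <= de / X2 by rewrite ge_min lexx orbT.
  rewrite ler_pdivlMr// mulrC; apply: le_trans.
  by rewrite ler_wpM2l ?(ltW X20)// expr2 ler_piMr ?(ltW tau0)//; lra.
clearbody tau.
(* [kap] is multiplied by the mass of the whole cutoff ball, which is at most [ML r^s]. *)
pose kap := de / ML.
have kap0 : 0 < kap by rewrite divr_gt0.
have [G [P [w [G0 sw wC wP Sl]]]] := Hc tau kap tau0 tau4 kap0.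
have G0' : 0 < #|G|%:R :> R by rewrite ltr0n.
pose X3 := K0 * ((s + 2) * 2 * (eta / 7) `^ (- (s + 1)) * ML).
have s22 : 0 < (s + 2) * 2 by lra.
have eta70 : 0 < eta / 7 by rewrite divr_gt0.
have X30 : 0 < X3.
  by exact: mulr_gt0 K00 (mulr_gt0 (mulr_gt0 s22 (powR_gt0 _ eta70)) ML0).
pose X4 := 2 `^ sg * (#|G|%:R * (CE * ML)).
have X40 : 0 < X4.
  by apply: mulr_gt0 (mulr_gt0 G0' (mulr_gt0 CE0 ML0)); rewrite powR_gt0.
(* Chosen after the grid, since [X4] contains [#|G|]. [de / X3] pays for the displacement from grid
   points to support points, and [(th / X4)^2] ensures the density condition for bumps. *)
pose lam := Num.min (Num.min (1 / 20) tau)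
  (Num.min (eta / 2) (Num.min (de / X3) ((th / X4) ^+ 2))).
have lam0 : 0 < lam.
  have hX := divr_gt0 th0 X40.
  by rewrite !lt_min tau0 (divr_gt0 de0 X30) (exprn_gt0 2 hX) !divr_gt0.
have [l20 lt le l3 l4] : [/\ lam <= 1 / 20, lam <= tau, lam <= eta / 2, lam <= de / X3 &
    lam <= (th / X4) ^+ 2].
  have : lam <= lam by [].
  by rewrite {2}/lam !le_min => /andP[/andP[-> ->] /and3P[-> -> ->]].
exists lam => // mu _ nm refl x r r0 mux.
apply: contrapT => H.
have supp q : l2norm (q - x) <= 5 / 2 * r ->
    exists2 z, measure_supp mu z & l2norm (z - q) < lam * r.
  move=> qx; apply: contrapT => Hq; apply: H; exists q; split.
    move=> y; rewrite /l2ball/= => yq.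
    have := ler_l2normD (y - q) (q - x); rewrite addrA subrK.
    have : lam * r <= 1 / 20 * r by rewrite ler_wpM2r// ltW.
    lra.
  by apply/seteqP; split => // z [zq zs]; case: Hq; exists z.
pose Rad := 2 * rho * r.
have R0 : 0 < Rad by rewrite !mulr_gt0.
have MRE : Lam * Rad `^ s = ML * r `^ s.
  by rewrite /Rad powRM ?mulr_ge0 ?(ltW rho0) ?(ltW r0)// mulrA.
have [v vb vE] := HCE mu nm G P x r Rad lam r0 R0 lam0.
have v4 : l2norm v <= 1 / 4.
  apply: le_trans (l2norm_le_sum _) _.
  have -> : 1 / 4 = d%:R * b :> R by rewrite /b [RHS]mulrC divfK// gt_eqF.
  have sd (k : R) : d%:R * k = \sum_(i < d) k by rewrite sumr_const card_ord mulr_natl.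
  rewrite sd; apply: ler_sum => i _.
  by have /andP[? ?] := vb i; rewrite ger0_norm.
have rs0 : 0 < r `^ s by rewrite powR_gt0.
have rh0 : 0 < r `^ 2^-1 by rewrite powR_gt0.
pose E z := energy mu (l2ball x Rad) (x + r *: (P z + v)) (lam * r) sg.
have rsE : r `^ (- sg) * r `^ s * r `^ 2^-1 = 1.
  by rewrite -!powRD_gt0// (_ : _ + _ + _ = 0) ?powRr0// /sg; ring.
have {}vE : (\sum_z E z) * r `^ 2^-1 <= #|G|%:R * (CE * ML).
  rewrite MRE in vE; apply: le_trans (ler_wpM2r (ltW rh0) vE) _.
  have -> : #|G|%:R * (CE * (r `^ (- sg) * (ML * r `^ s))) * r `^ 2^-1 =
     #|G|%:R * (CE * ML) * (r `^ (- sg) * r `^ s * r `^ 2^-1) by ring.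
  by rewrite rsE mulr1.
have lamr0 : 0 < lam * r by rewrite mulr_gt0.
(* A single energy is bounded by the whole sum, at the price of [#|G|]. Comparing [(lam r)^(s+1/2)]
   with [(lam r)^s] leaves a factor [lam^(1/2)] that compensates it. *)
have en z : (2 * (lam * r)) `^ sg * E z <= th * (lam * r) `^ s.
  have E1 : E z * r `^ 2^-1 <= #|G|%:R * (CE * ML).
    apply: le_trans vE; rewrite ler_wpM2r ?(ltW rh0)// (bigD1 z)//= lerDl.
    by apply: sumr_ge0 => ? _; exact: energy_ge0.
  have lh : lam `^ 2^-1 <= th / X4.
    rewrite powR12_sqrt ?(ltW lam0)//.
    rewrite -[leRHS]ger0_norm ?divr_ge0 ?(ltW th0) ?(ltW X40)// -sqrtr_sqr.
    by rewrite ler_wsqrtr.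
  have h1 : X4 * lam `^ 2^-1 <= th by rewrite mulrC -ler_pdivlMr.
  have -> : (2 * (lam * r)) `^ sg * E z =
     (lam * r) `^ s * (2 `^ sg * (E z * r `^ 2^-1) * lam `^ 2^-1).
    rewrite powRM ?(ltW lamr0)// (powRD_gt0 _ _ lamr0).
    by rewrite [_ `^ 2^-1]powRM ?(ltW lam0) ?(ltW r0)//; ring.
  rewrite [leRHS]mulrC ler_wpM2l ?powR_ge0//; apply: le_trans h1.
  by rewrite ler_wpM2r ?powR_ge0// /X4 ler_wpM2l ?powR_ge0.
have lr20 : lam * r <= r / 20.
  by have : lam * r <= 1 / 20 * r by [rewrite ler_wpM2r// ltW]; lra.
have lrt : lam * r <= r * tau by rewrite mulrC ler_pM2l.
have lre : 2 * (lam * r) <= eta * r.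
  by have : lam * r <= eta / 2 * r by [rewrite ler_wpM2r// ltW]; lra.
have r6 : 6 * r <= rho * r by rewrite ler_pM2r.
have rhr : rho * r < Rad by rewrite /Rad ltr_pM2r//; lra.
have rR : r <= Rad by lra.
have dR0 : 0 < Rad - rho * r by rewrite subr_gt0.
pose psi := bump x Rad (Rad - rho * r).
have psi1 y : l2ball x r y -> psi y = 1.
  rewrite /l2ball/= => yr; apply: bump_eq1 => //; rewrite opprB addrCA subrr addr0; lra.
have psi0 y : ~ l2ball x Rad y -> psi y = 0.
  by move=> yR; apply: (bump_eq0 dR0); rewrite leNgt; exact/negP.
have psi01 y : 0 <= psi y <= 1 by rewrite bump_ge0 bump_le1.
have mpsi : measurable_fun setT (psi : borel_rV R d -> R).
  by apply: continuous_measurable_rV; exact: continuous_bump.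
have upper := flux_upper s_gt0 Lam_gt0 nm refl r0 lamr0 lr20 lrt lre kz0 r6 rhr G0 v4
  sw wC wP supp (fun z l => Hth mu z l nm) en (erefl psi) (fun z => erefl).
have lower := flux_lower s_gt0 nm r0 tau0 rR (ltW c0) (ltW kap0) v4 Sl mpsi psi01 psi1 psi0.
have := le_trans lower upper; apply/negP; rewrite -ltNge.
have rsN : r `^ (- s) * r `^ s = 1 by rewrite powRN mulVf// gt_eqF.
have low : 7 * de < r `^ (- s) * (c * fine (mu (l2ball x r)) - kap * fine (mu (l2ball x Rad))).
  have m1 : eps * r `^ s < fine (mu (l2ball x r)).
    by rewrite -lte_fin fineK// (nice_ball_fin_num x nm).
  have m2 : fine (mu (l2ball x Rad)) <= ML * r `^ s.
    by rewrite -lee_fin fineK ?(nice_ball_fin_num x nm)// -MRE; exact: nm.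
  have e1 : 7 * de = r `^ (- s) * (c * (eps * r `^ s) - kap * (ML * r `^ s)).
    have -> : r `^ (- s) * (c * (eps * r `^ s) - kap * (ML * r `^ s)) =
      (r `^ (- s) * r `^ s) * (c * eps - kap * ML) by ring.
    by rewrite rsN mul1r -deE /kap divfK ?gt_eqF//; ring.
  rewrite e1 ltr_pM2l ?powR_gt0//; apply: ltr_leD; first by rewrite ltr_pM2l.
  by rewrite lerN2 ler_wpM2l// ltW.
apply: le_lt_trans low.
rewrite mulrDr.
have t1 : d%:R * (Ct * (r / (rho * r))) <= de.
  have -> : d%:R * (Ct * (r / (rho * r))) = d%:R * Ct / rho.
    by field; rewrite !gt_eqF.
  by [].
pose C2 := (s + 2) * (2 * (lam * r)) * (eta * r / 7) `^ (- (s + 1)) +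
            (s + 1) / 2 * (r * tau) ^+ 2 * (eta * r) `^ (- (s + 2)).
have sc (k : R) : \sum_(z : G) k = #|G|%:R * k by rewrite sumr_const mulr_natl.
have t2 : K0 * (C2 * (Lam * Rad `^ s)) <= 2 * de.
  have e7 : (eta * r / 7) `^ (- (s + 1)) * r `^ s * r = (eta / 7) `^ (- (s + 1)).
    have -> : eta * r / 7 = eta / 7 * r by ring.
    rewrite powRM ?(ltW eta70) ?(ltW r0)// -!mulrA -{3}(powRr1 (ltW r0)) -!powRD_gt0//.
    by rewrite (_ : _ + (_ + 1) = 0) ?powRr0 ?mulr1//; ring.
  have e8 : (eta * r) `^ (- (s + 2)) * r `^ s * r ^+ 2 = eta `^ (- (s + 2)).
    rewrite powRM ?(ltW eta0) ?(ltW r0)// -!mulrA -(powR_mulrn 2 (ltW r0)) -!powRD_gt0//.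
    by rewrite (_ : _ + (_ + 2) = 0) ?powRr0 ?mulr1//; ring.
  have -> : K0 * (C2 * (Lam * Rad `^ s)) = X3 * lam + X2 * tau ^+ 2.
    rewrite MRE /C2 /X3 /X2 -e7 -e8; ring.
  have : X3 * lam <= de by rewrite mulrC -ler_pdivlMr.
  lra.
(* Unlike in [en], only the average of the energies enters, so [#|G|] cancels. This is what allowed
   [eta] to be fixed before the grid. *)
have t3 : K0 / #|G|%:R * ((7 `^ s + 1) * (eta * r) `^ 2^-1 * \sum_z E z) <= de.
  rewrite powRM ?(ltW eta0) ?(ltW r0)//.
  have -> : K0 / #|G|%:R * ((7 `^ s + 1) * (eta `^ 2^-1 * r `^ 2^-1) * \sum_z E z) =
     K0 * (7 `^ s + 1) * eta `^ 2^-1 / #|G|%:R * ((\sum_z E z) * r `^ 2^-1) by ring.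
  have K1 : 0 <= K0 * (7 `^ s + 1) * eta `^ 2^-1 / #|G|%:R.
    apply: mulr_ge0; last by rewrite invr_ge0 ltW.
    by apply: mulr_ge0; [exact: mulr_ge0 (ltW K00) (ltW P7)|exact: powR_ge0].
  apply: le_trans (ler_wpM2l K1 vE) _; rewrite -etaE /X1.
  by rewrite le_eqVlt; apply/orP; left; apply/eqP; field; rewrite gt_eqF.
have -> : d%:R * (6 ^+ d / #|G|%:R * \sum_z 2 * (2 * 2 `^ s) *
    (kz + ((7 `^ s + 1) * (eta * r) `^ 2^-1 * E z + C2 * (Lam * Rad `^ s)))) =
   de + K0 / #|G|%:R * ((7 `^ s + 1) * (eta * r) `^ 2^-1 * \sum_z E z) +
     K0 * (C2 * (Lam * Rad `^ s)).
  rewrite -mulr_sumr !big_split/= !sc -mulr_sumr.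
  have -> : de = K0 * kz by rewrite mulrC divfK// gt_eqF.
  by rewrite /K0; field; rewrite gt_eqF.
apply: le_trans (lerD t1 (lerD (lerD (lexx de) t3) t2)) _.
by move: de0; clear; lra.
Qed.
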